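(* Let $\{i,j,k\}=\{1,2,3\}$, let $z_1,z_2,z_3$ be distinct complex numbers and put $u=z_{ji}/z_{ki}$. The solutions $W_{(ab)c}$ and $W_{a(bc)}$ of the system (KZ$_3$) defined in the context satisfy the following connection formulas. (1) For $u\in\mathbb C\setminus((-\infty,0]\cup[1,\infty))$: $$W_{i(jk)}(z_1,z_2,z_3)\,\varphi_{\mathrm{KZ}}(X_{ij},-X_{jk})=W_{(ij)k}(z_1,z_2,z_3).$$ (2) For $u\in\mathbf H_{\pm}$: $$W_{(ji)k}(z_1,z_2,z_3)\,\exp(\pm X_{ij}\pi i)=W_{(ij)k}(z_1,z_2,z_3).$$ (3) For $u\in\mathbf H_{\mp}$: $$W_{i(kj)}(z_1,z_2,z_3)\,\exp(\pm X_{jk}\pi i)=W_{i(jk)}(z_1,z_2,z_3).$$ (4) For $u\in\mathbf H_{\mp}$: $$W_{k(ij)}(z_1,z_2,z_3)\,\exp(\pm(X_{ik}+X_{jk})\pi i)=W_{(ij)k}(z_1,z_2,z_3).$$ (5) For $u\in\mathbf H_{\pm}$: $$W_{(jk)i}(z_1,z_2,z_3)\,\exp(\pm(X_{ij}+X_{ik})\pi i)=W_{i(jk)}(z_1,z_2,z_3).$$ (In the exponentials $\pi i$, $i=\sqrt{-1}$; upper signs go with upper signs and lower with lower.)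
   Context: Shuffle algebra and polylogarithms. Let $\mathfrak h=\mathbb C\langle x,y\rangle$ with shuffle product $\sqcup\!\sqcup$ defined bilinearly by $1\sqcup\!\sqcup w=w\sqcup\!\sqcup 1=w$, $l_1w_1\sqcup\!\sqcup l_2w_2=l_1(w_1\sqcup\!\sqcup l_2w_2)+l_2(l_1w_1\sqcup\!\sqcup w_2)$ for letters $l_1,l_2$ and words $w,w_1,w_2$. Put $\mathfrak h^1=\mathbb C1\oplus\mathfrak hy$, $\mathfrak h^0=\mathbb C1\oplus x\mathfrak hy$; with the shuffle product $\mathfrak h=\mathfrak h^1[x]=\mathfrak h^0[x,y]$. $\mathrm{reg}:\mathfrak h=\mathfrak h^0[x,y]\to\mathfrak h^0$ takes the constant term in this decomposition. $\widehat\zeta:\mathfrak h^0\to\mathbb C$ is linear with $\widehat\zeta(1)=1$, $\widehat\zeta(x^{k_1-1}y\cdots x^{k_m-1}y)=\sum_{n_1>\dots>n_m>0}\frac1{n_1^{k_1}\cdots n_m^{k_m}}$. Let $D=\mathbb C\setminus((-\infty,0]\cup[1,\infty))$. For $w=x^{k_1-1}y\cdots x^{k_m-1}y\in\mathfrak h^1$, $\mathrm{Li}(w;z)=\sum_{n_1>\dots>n_m>0}\frac{z^{n_1}}{n_1^{k_1}\cdots n_m^{k_m}}$ for $|z|<1$, continued to $D$; $\mathrm{Li}(1;z)=1$; $\mathrm{Li}(x;z)=\log z$ (principal branch); $\mathrm{Li}(\bullet;z)$ is extended to $\mathfrak h$ as a homomorphism for the shuffle product. Formal KZ equation. Let $\mathfrak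 H=\mathbb C\langle\langle X,Y\rangle\rangle$; for a word $W$ in $X,Y$ let $w$ be the corresponding word in $x,y$. The Drinfel'd associator is $\varphi_{\mathrm{KZ}}(X,Y)=\sum_W\widehat\zeta(\mathrm{reg}(w))W$. $G_0(X,Y;z)=\sum_W\mathrm{Li}(w;z)W$ is the unique solution on $D$ of $\frac{dG}{dz}=\left(\frac Xz+\frac Y{1-z}\right)G$ with $G_0z^{-X}\to1$ ($z\to0$), and $G_1(X,Y;z)$ is the unique solution on $D$ with $G_1(1-z)^Y\to1$ ($z\to1$); here $a^A=\exp(A\log a)$ with principal logarithm and limits are coefficientwise. The system (KZ$_3$). Let $\mathfrak P_3$ be the completed algebra $\mathbb C\langle\langle X_{ab}\rangle\rangle_{1\le a\ne b\le3}$ with defining relations $X_{ab}=X_{ba}$ and $[X_{ab},X_{ac}+X_{cb}]=0$ for $a,b,c$ distinct. Put $T=X_{12}+X_{13}+X_{23}$, which is central. Put $z_{ab}=z_a-z_b$. (KZ$_3$) is the system $dW=\left(\sum_{1\le a<b\le3}X_{ab}\,d\log z_{ab}\right)W$ for $\mathfrak P_3$-valued functions $W$ on $\{(z_1,z_2,z_3)\in\mathbb C^3: z_a\ne z_b\ (a\ne b)\}$. For $\{a,b,c\}=\{1,2,3\}$ define the solutions $$W_{(ab)c}(z_1,z_2,z_3)=G_0\left(X_{ab},-X_{bc};\frac{z_{ba}}{z_{ca}}\right)z_{ca}^T,\qquad W_{a(bc)}(z_1,z_2,z_3)=G_1\left(X_{ab},-X_{bc};\frac{z_{ba}}{z_{ca}}\right)z_{ca}^T,$$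 where $z_{ca}^T=\exp(T\log z_{ca})$. Branches. $\mathbf H_+$, $\mathbf H_-$ are the open upper and lower half planes. In each formula fix a value of $\log z_{ki}$; all other logarithms occurring are determined by $\log z_{pq}=\log z_{ki}+\mathrm{Log}(z_{pq}/z_{ki})$ with $\mathrm{Log}$ the principal logarithm (the ratios are non-real when $u\in\mathbf H_\pm$). *)

(* Defs.v *)
From HB Require Import structures.
From mathcomp Require Import all_boot all_order all_algebra.
From mathcomp Require Import complex.
From mathcomp Require Import all_classical all_reals all_analysis.
From mathcomp Require Import freeg.
Set Implicit Arguments.
Unset Strict Implicit.
Unset Printing Implicit Defensive.
Import Order.TTheory GRing.Theory Num.Theory.
Import numFieldNormedType.Exports.
Local Open Scope classical_set_scope.
Local Open Scope ring_scope.
Local Open Scope complex_scope.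
Local Open Scope quotient_scope.

(* R[i] seen as a numFieldType, so that it inherits the topology and the
   normed module structure (hence [is_derive]) that MathComp-Analysis puts on
   every numFieldType. *)
Notation "'CC[' R ]" := (Num.NumField.sort R[i]) (format "'CC[' R ]").

Section ComplexFunctions.
Variable R : realType.
Notation C := CC[R].

Definition cexp (z : C) : C :=
  (expR (complex.Re z))%:C *
  (cos (complex.Im z) +i* sin (complex.Im z)).

(* Principal argument, with values in ]-pi, pi]; meaningful for z <> 0. *)
Definition Arg (z : C) : R :=
  let t := acos (complex.Re z / complex.Re `|z|) in
  if 0 <= complex.Im z then t else - t.

Definition Log (z : C) : C := ln (complex.Re `|z|) +i* Arg z.

Definition slit_plane : set C :=
  [set z | ~ (complex.Im z = 0 /\ (complex.Re z <= 0 \/ 1 <= complex.Re z))].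

(* [half_plane false] is H_+ and [half_plane true] is H_-; the boolean s stands
   for the sign (-1) ^+ s. *)
Definition half_plane (s : bool) : set C :=
  [set z | 0 < (-1) ^+ s * complex.Im z].

Definition analytic_at (f : C -> C) (z0 : C) : Prop :=
  exists a : nat -> C,
    \forall z \near z0, series (fun n => a n * (z - z0) ^+ n) @ \oo --> f z.

End ComplexFunctions.

(* A word in the letters x, y (or X, Y) is a [seq bool], with false for x (X)
   and true for y (Y). *)
Definition word := seq bool.
Notation lx := false (only parsing).
Notation ly := true (only parsing).

Definition h1_word (w : word) : bool := last ly w == ly.
Definition h0_word (w : word) : bool := (head lx w == lx) && h1_word w.

(* [index_from k w] reads x^(k1-1) y ... x^(km-1) y as [:: k1 + k; k2; ...; km]. *)
Fixpoint index_from (k : nat) (w : word) : seq nat :=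
  match w with
  | [::] => [::]
  | lx :: w' => index_from k.+1 w'
  | ly :: w' => k.+1 :: index_from 0 w'
  end.
Definition index_of : word -> seq nat := index_from 0.

(* All the shuffles of two words, listed with multiplicity. *)
Fixpoint shuffles (u : word) : word -> seq word :=
  match u with
  | [::] => fun v => [:: v]
  | a :: u' =>
    fix shuffles_u (v : word) : seq word :=
      match v with
      | [::] => [:: u]
      | b :: v' => [seq a :: w | w <- shuffles u' v] ++
                   [seq b :: w | w <- shuffles_u v']
      end
  end.

Section Polylogarithms.
Variable R : realType.
Notation C := CC[R].

(* As a vector space, C<x, y> is freely spanned by the words; <<w>> is the basis
   vector attached to w, and [fglift] is linear extension from this basis. *)
Definition hspace := {freeg word / C}.

Definition shuffle (p q : hspace) : hspace :=
  fglift (fun u => fglift (fun v => \sum_(w <- shuffles u v) <<w>>) q) p.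

Definition shuffle_exp (p : hspace) (n : nat) : hspace :=
  iter n (shuffle p) <<[::]>>.

Definition h0 : set hspace := [set p | all h0_word (dom p)].

(* The constant term of p written as a polynomial in x and y, for the shuffle
   product, with coefficients in h0. *)
Definition reg (p : hspace) : hspace :=
  xget 0 [set q | exists (N : nat) (c : nat -> nat -> hspace),
    [/\ forall a b, h0 (c a b),
        p = \sum_(a < N.+1) \sum_(b < N.+1)
              shuffle (c a b) (shuffle (shuffle_exp <<[:: lx]>> a)
                                       (shuffle_exp <<[:: ly]>> b))
      & q = c 0%N 0%N]].

(* The sum of z^n1 / (n1^k1 ... nm^km) over n > n1 > ... > nm > 0. *)
Fixpoint Li_sum (z : C) (ks : seq nat) (n : nat) : C :=
  match ks with
  | [::] => 1
  | k :: ks' => \sum_(1 <= m < n) z ^+ m / m%:R ^+ k * Li_sum 1 ks' m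
  end.

Definition zeta_word (w : word) : C := limn (Li_sum 1 (index_of w)).

Definition zeta_hat : hspace -> C := fglift (zeta_word : word -> C^o).

(* For a word w of h1: the analytic continuation of the series to D. *)
Definition Li_h1 (w : word) : C -> C :=
  xget (fun=> 0) [set f : C -> C |
    (forall z, slit_plane z -> analytic_at f z) /\
    (forall z, slit_plane z -> `|z| < 1 ->
       Li_sum z (index_of w) @ \oo --> f z)].

(* The shuffle homomorphism Li(_; z), for z in D. *)
Definition Li (z : C) : hspace -> C :=
  xget (fun=> 0) [set L : hspace -> C |
    [/\ linear (L : hspace -> C^o),
        forall p q, L (shuffle p q) = L p * L q,
        forall w, h1_word w -> L <<w>> = Li_h1 w z
      & L <<[:: lx]>> = Log z]].

End Polylogarithms.

Section NCSeries.
Variables (K : comNzRingType) (A : eqType).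

(* The algebra K<<A>>: a series is the family of its coefficients. *)
Definition ncseries := seq A -> K.
Implicit Types f g h : ncseries.

HB.instance Definition _ := GRing.Lmodule.copy ncseries (seq A -> K^o).

Definition nc_one : ncseries := fun w => (w == [::])%:R.

Definition nc_mul f g : ncseries :=
  fun w => \sum_(i < (size w).+1) f (take i w) * g (drop i w).

Lemma nc_addE f g w : (f + g) w = f w + g w. Proof. by []. Qed.
Lemma nc_oppE f w : (- f) w = - f w. Proof. by []. Qed.
Lemma nc_scaleE (c : K) f w : (c *: f) w = c * f w. Proof. by []. Qed.

Lemma nc_mulA : associative nc_mul.
Proof.
move=> f g h; apply/funext => w; rewrite /nc_mul.
pose F i j := f (take i w) * (g (take (j - i) (drop i w)) * h (drop j w)).
have -> : \sum_(i < (size w).+1) f (take i w) *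
    (\sum_(j < (size (drop i w)).+1)
        g (take j (drop i w)) * h (drop j (drop i w)))
  = \sum_(0 <= i < (size w).+1) \sum_(0 <= j < (size w).+1 | (i <= j)%N) F i j.
  rewrite big_mkord; apply: eq_bigr => i _; rewrite big_distrr /=.
  have lei : (i <= size w)%N by rewrite -ltnS.
  have -> : \sum_(0 <= j < (size w).+1 | (i <= j)%N) F i j =
      \sum_(i <= j < (size w).+1) F i j by rewrite (big_nat_widenl i 0).
  rewrite [RHS](_ : _ = \sum_(0 <= j < (size w).+1 - i) F i (j + i)%N); last first.
    by rewrite -{1}[i : nat]add0n big_addn.
  rewrite size_drop subSn // big_mkord; apply: eq_bigr => j _.
  by rewrite /F addnK drop_drop.
have -> : \sum_(j < (size w).+1)
    (\sum_(i < (size (take j w)).+1)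
        f (take i (take j w)) * g (drop i (take j w))) * h (drop j w)
  = \sum_(0 <= j < (size w).+1) \sum_(0 <= i < (size w).+1 | (i <= j)%N) F i j.
  rewrite big_mkord; apply: eq_bigr => j _; rewrite big_distrl /=.
  have lej : (j <= size w)%N by rewrite -ltnS.
  rewrite size_takel // -(big_mkord xpredT (fun i => f (take i (take j w)) *
    g (drop i (take j w)) * h (drop j w))).
  rewrite (big_nat_widen 0 j.+1 (size w).+1) //.
  apply: eq_bigr => i; rewrite ltnS => leij.
  by rewrite /F -mulrA take_takel // take_drop subnK.
exact: exchange_big_dep_nat.
Qed.

Lemma nc_mul1 : left_id nc_one nc_mul.
Proof.
move=> f; apply/funext => w; rewrite /nc_mul big_ord_recl /= take0 drop0.
rewrite /nc_one eqxx mul1r big1 ?addr0 // => i _.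
by case: w i => [|a w] i; [case: i | rewrite mul0r].
Qed.

Lemma nc_mulr1 : right_id nc_one nc_mul.
Proof.
move=> f; apply/funext => w; rewrite /nc_mul big_ord_recr /= take_size drop_size.
rewrite /nc_one eqxx mulr1 big1 ?add0r // => i _.
by rewrite -size_eq0 size_drop subn_eq0 leqNgt ltn_ord mulr0.
Qed.

Lemma nc_mulDl : left_distributive nc_mul +%R.
Proof.
move=> f g h; apply/funext => w; rewrite nc_addE /nc_mul -big_split.
by apply: eq_bigr => i _; rewrite nc_addE mulrDl.
Qed.

Lemma nc_mulDr : right_distributive nc_mul +%R.
Proof.
move=> f g h; apply/funext => w; rewrite nc_addE /nc_mul -big_split.
by apply: eq_bigr => i _; rewrite nc_addE mulrDr.
Qed.

Lemma nc_one_neq0 : nc_one != 0.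
Proof.
apply/eqP => /(congr1 (fun f : ncseries => f [::])).
by rewrite /nc_one eqxx; exact/eqP/oner_neq0.
Qed.

HB.instance Definition _ := GRing.Zmodule_isNzRing.Build ncseries
  nc_mulA nc_mul1 nc_mulr1 nc_mulDl nc_mulDr nc_one_neq0.

Lemma nc_mulE f g w :
  (f * g) w = \sum_(i < (size w).+1) f (take i w) * g (drop i w).
Proof. by []. Qed.

Lemma nc_scaleAl (c : K) (f g : ncseries) : c *: (f * g) = (c *: f) * g.
Proof.
apply/funext => w; rewrite nc_scaleE !nc_mulE big_distrr.
by apply: eq_bigr => i _; exact: mulrA.
Qed.

HB.instance Definition _ := GRing.Lmodule_isLalgebra.Build K ncseries nc_scaleAl.

Lemma nc_scaleAr (c : K) (f g : ncseries) : c *: (f * g) = f * (c *: g).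
Proof.
apply/funext => w; rewrite nc_scaleE !nc_mulE big_distrr.
by apply: eq_bigr => i _; exact: mulrCA.
Qed.

HB.instance Definition _ := GRing.Lalgebra_isAlgebra.Build K ncseries nc_scaleAr.

Definition nc_letter (a : A) : ncseries := fun w => (w == [:: a])%:R.

End NCSeries.

Section SeriesFunctions.
Variable R : realType.
Notation C := CC[R].
Variable A : eqType.
Implicit Types f g : ncseries C A.

(* exp(f) for f without constant term: f ^+ n has no term of length < n, so
   that only the n <= size w contribute to the coefficient of w. *)
Definition nc_exp f : ncseries C A :=
  fun w => \sum_(n < (size w).+1) (n`!%:R^-1 *: f ^+ n) w.

(* The power a^f = exp (f log a), with the principal logarithm. *)
Definition nc_pow (a : C) f : ncseries C A := nc_exp (Log a *: f).

(* The value c(f, g) at f, g without constant term of a series c = c(X, Y): a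
   word of length n > size v in f, g has coefficient 0 at v. *)
Definition nc_subst (c : ncseries C bool) f g : ncseries C A :=
  fun v => \sum_(n < (size v).+1) \sum_(w : n.-tuple bool)
    c w * (\prod_(b <- w) (if b then g else f)) v.

End SeriesFunctions.

Section KZ.
Variable R : realType.
Notation C := CC[R].

Notation ncX := (nc_letter C lx).
Notation ncY := (nc_letter C ly).

Definition phi_KZ : ncseries C bool := fun w => zeta_hat (reg <<w>>).

(* dG/dz = (X/z + Y/(1-z)) G on D, coefficientwise. *)
Definition KZ_solution (G : C -> ncseries C bool) : Prop :=
  forall z, slit_plane z -> forall w,
    is_derive z 1 (fun t => G t w : C)
      (((z^-1 *: ncX + (1 - z)^-1 *: ncY) * G z) w).

Definition G0 (z : C) : ncseries C bool := fun w => Li z <<w>>.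

Definition G1 : C -> ncseries C bool :=
  xget (fun=> 0) [set G | KZ_solution G /\
    forall w, (fun z => (G z * nc_pow (1 - z) ncY) w : C) @
                within (@slit_plane R) (nbhs (1 : C)) -->
              ((1 : ncseries C bool) w : C)].

End KZ.

Section P3.
Variable R : realType.
Notation C := CC[R].

(* The indices 1, 2, 3 are the elements of 'I_3, and the generators X_ab are
   indexed by the ordered pairs (a, b) with a != b. *)
Definition gen3 := {p : 'I_3 * 'I_3 | p.1 != p.2}.

Definition series3 := ncseries C gen3.

(* The junk value at a = b is 0. *)
Definition X3 (a b : 'I_3) : series3 :=
  if insub (a, b) is Some g then nc_letter C g else 0.

Inductive P3_relator : series3 -> Prop :=
| P3_sym (a b : 'I_3) : a != b -> P3_relator (X3 a b - X3 b a)
| P3_comm (a b c : 'I_3) : uniq [:: a; b; c] ->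
    P3_relator (X3 a b * (X3 a c + X3 c b) - (X3 a c + X3 c b) * X3 a b).

Inductive P3_ideal : series3 -> Prop :=
| P3_ideal0 : P3_ideal 0
| P3_idealD (f p r q : series3) :
    P3_ideal f -> P3_relator r -> P3_ideal (f + p * r * q).

(* The closure of the two-sided ideal of relations, for the topology defined by
   the length of words. *)
Definition P3_null : {pred series3} := fun f =>
  `[< forall n, exists2 g, P3_ideal g & forall w, (size w < n)%N -> f w = g w >].

Lemma P3_ideal_add f g : P3_ideal f -> P3_ideal g -> P3_ideal (f + g).
Proof.
move=> If; elim=> [|g' p r q _ IH rel_r]; first by rewrite addr0.
by rewrite addrA; apply: P3_idealD.
Qed.

Lemma P3_ideal_opp f : P3_ideal f -> P3_ideal (- f).
Proof.
elim=> [|g p r q _ IH rel_r]; first by rewrite oppr0; apply: P3_ideal0.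
by rewrite opprD -!mulNr; apply: P3_idealD.
Qed.

Lemma P3_ideal_mull h f : P3_ideal f -> P3_ideal (h * f).
Proof.
elim=> [|g p r q _ IH rel_r]; first by rewrite mulr0; apply: P3_ideal0.
by rewrite mulrDr !mulrA; apply: P3_idealD.
Qed.

Lemma P3_ideal_mulr h f : P3_ideal f -> P3_ideal (f * h).
Proof.
elim=> [|g p r q _ IH rel_r]; first by rewrite mul0r; apply: P3_ideal0.
by rewrite mulrDl -[_ * q * h]mulrA; apply: P3_idealD.
Qed.

Lemma X3_nil a b : X3 a b [::] = 0.
Proof. by rewrite /X3; case: insubP. Qed.

Lemma series3_mul_nil (f g : series3) : (f * g) [::] = f [::] * g [::].
Proof. by rewrite nc_mulE big_ord1. Qed.

Lemma P3_ideal_nil f : P3_ideal f -> f [::] = 0.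
Proof.
elim=> // g p r q _ IH rel_r; rewrite nc_addE IH add0r !series3_mul_nil.
suff -> : r [::] = 0 by rewrite mulr0 mul0r.
by case: rel_r => *; rewrite nc_addE nc_oppE ?series3_mul_nil !X3_nil;
  rewrite ?mul0r ?mulr0 subr0.
Qed.

Lemma P3_null_zmod_closed : zmod_closed P3_null.
Proof.
split=> [|f g /asboolP Nf /asboolP Ng]; apply/asboolP => n.
  by exists 0 => //; apply: P3_ideal0.
have [p Ip eqp] := Nf n; have [q Iq eqq] := Ng n.
exists (p - q) => [|w lt_wn]; first exact/P3_ideal_add/P3_ideal_opp.
by rewrite !nc_addE !nc_oppE eqp ?eqq.
Qed.

HB.instance Definition _ :=
  GRing.isZmodClosed.Build series3 P3_null P3_null_zmod_closed.

Lemma P3_null_mull h f : f \in P3_null -> h * f \in P3_null.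
Proof.
move=> /asboolP Nf; apply/asboolP => n; have [g Ig eqg] := Nf n.
exists (h * g) => [|w lt_wn]; first exact: P3_ideal_mull.
apply: eq_bigr => i _; rewrite eqg // size_drop.
exact: leq_ltn_trans (leq_subr _ _) lt_wn.
Qed.

Lemma P3_null_mulr h f : f \in P3_null -> f * h \in P3_null.
Proof.
move=> /asboolP Nf; apply/asboolP => n; have [g Ig eqg] := Nf n.
exists (g * h) => [|w lt_wn]; first exact: P3_ideal_mulr.
apply: eq_bigr => i _; rewrite eqg // size_take_min.
exact: leq_ltn_trans (geq_minr _ _) lt_wn.
Qed.

Lemma P3_null1 : 1 \notin P3_null.
Proof.
apply/negP => /asboolP /(_ 1%N)[g Ig /(_ [::] isT)].
by rewrite (P3_ideal_nil Ig) => /eqP; rewrite [_ == _]oner_eq0.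
Qed.

(* The completed algebra C<<X_ab>> / relations. *)
Definition P3 := Quotient.quot P3_null.
HB.instance Definition _ := GRing.Zmodule.on P3.
HB.instance Definition _ := Quotient.on P3.
HB.instance Definition _ : EqQuotient series3 (Quotient.equiv P3_null) P3 :=
  EqQuotient.on P3.
HB.instance Definition _ := @isZmodQuotient.Build
  series3 (Quotient.equiv P3_null) 0 -%R +%R P3 (lock _)
  (@Quotient.pi_opp _ _) (@Quotient.pi_add _ _).

Definition P3_one : P3 := lift_cst P3 1.
Definition P3_mul := lift_op2 P3 *%R.
Canonical pi_P3_one := PiConst P3_one.

Lemma pi_P3_mul : {morph \pi : x y / x * y >-> P3_mul x y}.
Proof.
move=> x y; unlock P3_mul; apply/eqP; rewrite piE Quotient.equivE.
rewrite -[_ * _](addrNK (x * repr (\pi_P3 y))) -mulrBr -addrA -mulrBl.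
have eq_pi (f : series3) : f - repr (\pi_P3 f) \in P3_null.
  by rewrite Quotient.idealrBE reprK.
by rewrite rpredD //; [exact: P3_null_mull | exact: P3_null_mulr].
Qed.
Canonical pi_P3_mul_morph := PiMorph2 pi_P3_mul.

Lemma P3_mulA : associative P3_mul.
Proof. by move=> x y z; rewrite -[x]reprK -[y]reprK -[z]reprK !piE mulrA. Qed.

Lemma P3_mul1 : left_id P3_one P3_mul.
Proof. by move=> x; rewrite -[x]reprK !piE mul1r. Qed.

Lemma P3_mulr1 : right_id P3_one P3_mul.
Proof. by move=> x; rewrite -[x]reprK !piE mulr1. Qed.

Lemma P3_mulDl : left_distributive P3_mul +%R.
Proof.
move=> x y z; rewrite -[x]reprK -[y]reprK -[z]reprK.
by rewrite !piE mulrDl.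
Qed.

Lemma P3_mulDr : right_distributive P3_mul +%R.
Proof.
move=> x y z; rewrite -[x]reprK -[y]reprK -[z]reprK.
by rewrite !piE mulrDr.
Qed.

Lemma P3_one_neq0 : P3_one != 0.
Proof. by rewrite piE Quotient.equivE subr0 P3_null1. Qed.

HB.instance Definition _ := GRing.Zmodule_isNzRing.Build P3
  P3_mulA P3_mul1 P3_mulr1 P3_mulDl P3_mulDr P3_one_neq0.
HB.instance Definition _ := @isNzRingQuotient.Build
  series3 (Quotient.equiv P3_null) 0 -%R +%R 1 *%R P3 (lock _) pi_P3_mul.

Definition T3 : series3 :=
  X3 (inord 0) (inord 1) + X3 (inord 0) (inord 2) + X3 (inord 1) (inord 2).

(* W_(ab)c and W_a(bc) at (z_1, z_2, z_3), for the value lca of log z_ca. *)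
Definition W_left (a b c : 'I_3) (z : 'I_3 -> C) (lca : C) : P3 :=
  \pi_P3 (nc_subst (G0 ((z b - z a) / (z c - z a))) (X3 a b) (- X3 b c) *
          nc_exp (lca *: T3)).

Definition W_right (a b c : 'I_3) (z : 'I_3 -> C) (lca : C) : P3 :=
  \pi_P3 (nc_subst (G1 ((z b - z a) / (z c - z a))) (X3 a b) (- X3 b c) *
          nc_exp (lca *: T3)).

End P3.

Arguments X3 {R} a b.

(* Main.v *)
Require Import Defs.
From HB Require Import structures.
From mathcomp Require Import all_boot all_order all_algebra.
From mathcomp Require Import complex.
From mathcomp Require Import all_classical all_reals all_analysis.
From mathcomp Require Import freeg ring lra zify.
Set Implicit Arguments.
Unset Strict Implicit.
Unset Printing Implicit Defensive.
Import Order.TTheory GRing.Theory Num.Theory.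
Import numFieldNormedType.Exports.
Local Open Scope ring_scope.
Local Open Scope complex_scope.
Local Open Scope quotient_scope.

(** Idea. Formulas (2)-(5) all come from Landen's connection formula in the free
    algebra,
      G_0(X, X - Y; u / (u - 1)) exp(+- pi i X) = G_0(X, Y; u)   (u in H_+-):
    both sides solve the KZ equation, and as u -> 0 their coefficients have the
    same expansion, a polynomial in log u up to terms negligible against every
    power of log u. One substitutes X = X_ij, Y = - X_jk, uses that T is central,
    and removes T from the second argument of G_0 by
      G_0(A, B + T; z) = G_0(A, B; z) exp(- log (1 - z) T),
    which holds because the coefficients of G_0 multiply by shuffle. The formulas
    with G_1 follow by G_1(X, Y; z) = G_0(- Y, - X; 1 - z), and (4), (5) also by
    Log (- w) = Log w -+ pi i.

    For (1), G_0 = G_1 C with C constant, and the coefficient C_w is the constant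
    term in log (1 - z) of Li(w; z) at z = 1. Writing w as a polynomial in x and y
    over h^0, this constant term is zeta (reg w): Li(x; z) = log z vanishes at 1,
    Li(y; z) = - log (1 - z), and Abel's theorem handles the words of h^0.

    G_0 itself is given near 0 by a power series times z^X, and continued to the
    slit plane by power series in the coordinate of its Riemann map to the unit
    disc. *)

(** [Li_h1], [Li], [reg] and [G1] are chosen among the objects with a given property, so each calls
    for existence and for enough uniqueness. [Gsol] supplies existence for the functions; uniqueness
    comes from the identity theorem, from h = h^1[x], or from the KZ equation. The coefficients of
    G_0 have no limit at 0, so solutions cannot be compared by initial values. Negligibility is
    required against every power of the logarithm in order that negligible functions form an ideal:
    products of expansions are then expansions, the polynomial is unique, and integration constants
    are read off from it. The map u -> u / (u - 1) fixes 0 and exchanges 1 and infinity. With u -> 1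
    - u it generates the six substitutions that permutations of z_i, z_j, z_k induce on u, which is
    why one formula yields (2)-(5). The passage to the disc makes every primitive a power series
    integrated term by term. Substitutions are compared modulo a closed ideal left arbitrary: it is
    the zero ideal for scalar exponentials and the ideal of relations in the end. *)

(** * Modulus and derivative of complex functions *)

Section ComplexModulus.
Local Open Scope classical_set_scope.
Local Open Scope ring_scope.
Variable R : realType.
Notation C := CC[R].
Implicit Types (z w : C) (x y e : R).

(** Real-valued, so that estimates take place in the totally ordered field [R]; the norm of [C] has
    its values in [C]. *)
Definition modc (z : C) : R := complex.Re `|z|.

Lemma normE z : `|z| = (modc z)%:C.
Proof. by rewrite /modc normc_def. Qed.

Lemma modc_def z : modc z = Num.sqrt (complex.Re z ^+ 2 + complex.Im z ^+ 2).
Proof. by rewrite /modc normc_def. Qed.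

Lemma modc_ge0 z : 0 <= modc z.
Proof. by rewrite modc_def sqrtr_ge0. Qed.

Lemma modc0 : modc 0 = 0.
Proof. by rewrite /modc normr0. Qed.

Lemma modc1 : modc 1 = 1.
Proof. by rewrite /modc normr1. Qed.

Lemma modc_eq0 z : (modc z == 0) = (z == 0).
Proof. by rewrite -[RHS]normr_eq0 normE; exact/esym/(inj_eq (@complexI R)). Qed.

Lemma modc_gt0 z : (0 < modc z) = (z != 0).
Proof. by rewrite lt0r modc_eq0 modc_ge0 andbT. Qed.

Lemma modcN z : modc (- z) = modc z.
Proof. by rewrite /modc normrN. Qed.

Lemma modc_sub z w : modc (z - w) = modc (w - z).
Proof. by rewrite -modcN opprB. Qed.

Lemma modcM z w : modc (z * w) = modc z * modc w.
Proof. by apply: (@complexI R); rewrite rmorphM -!normE normrM. Qed.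

Lemma modcV z : modc z^-1 = (modc z)^-1.
Proof. by apply: (@complexI R); rewrite fmorphV -!normE normfV. Qed.

Lemma modcX z n : modc (z ^+ n) = modc z ^+ n.
Proof. by apply: (@complexI R); rewrite rmorphXn /= -!normE normrX. Qed.

Lemma modcD z w : modc (z + w) <= modc z + modc w.
Proof. by rewrite -lecR rmorphD /= -!normE ler_normD. Qed.

Lemma modcB z w : modc (z - w) <= modc z + modc w.
Proof. by rewrite -[modc w]modcN modcD. Qed.

Lemma modc_dist z w : modc z - modc w <= modc (z - w).
Proof. by have := modcD (z - w) w; rewrite subrK lerBlDr. Qed.

Lemma modc_sum (I : Type) (r : seq I) (P : pred I) (F : I -> C) :
  modc (\sum_(i <- r | P i) F i) <= \sum_(i <- r | P i) modc (F i).
Proof.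
elim/big_rec2 : _ => [|i x z _ le_xz]; first by rewrite modc0.
exact: le_trans (modcD _ _) (lerD (lexx _) le_xz).
Qed.

Lemma modc_real x : modc x%:C = `|x|.
Proof. by rewrite modc_def /= expr0n addr0 sqrtr_sqr. Qed.

Lemma modc_nat n : modc n%:R = n%:R.
Proof. by rewrite /modc normr_nat -(rmorph_nat (real_complex R)). Qed.

Lemma modc_Re z : `|complex.Re z| <= modc z.
Proof. by rewrite -lecR -normE normc_ge_Re. Qed.

Lemma modc_Im z : `|complex.Im z| <= modc z.
Proof.
rewrite modc_def -sqrtr_sqr; apply: ler_wsqrtr.
by rewrite lerDr sqr_ge0.
Qed.

Lemma modc_le z : modc z <= `|complex.Re z| + `|complex.Im z|.
Proof.
rewrite modc_def -[leRHS]ger0_norm ?addr_ge0// -[leRHS]sqrtr_sqr; apply: ler_wsqrtr.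
rewrite sqrrD !real_normK ?num_real// lerD2r lerDl.
by rewrite mulrn_wge0 // mulr_ge0.
Qed.

Lemma Re_sum (I : Type) (r : seq I) (P : pred I) (F : I -> C) :
  complex.Re (\sum_(i <- r | P i) F i) = \sum_(i <- r | P i) complex.Re (F i).
Proof. by elim/big_rec2 : _ => // i x [? ?] _ /= <-; case: (F i). Qed.

Lemma Im_sum (I : Type) (r : seq I) (P : pred I) (F : I -> C) :
  complex.Im (\sum_(i <- r | P i) F i) = \sum_(i <- r | P i) complex.Im (F i).
Proof. by elim/big_rec2 : _ => // i x [? ?] _ /= <-; case: (F i). Qed.

Lemma ReB z w : complex.Re (z - w) = complex.Re z - complex.Re w.
Proof. by case: z w => ? ? []. Qed.

Lemma ImB z w : complex.Im (z - w) = complex.Im z - complex.Im w.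
Proof. by case: z w => ? ? []. Qed.

Lemma ReD z w : complex.Re (z + w) = complex.Re z + complex.Re w.
Proof. by case: z w => ? ? []. Qed.

Lemma ImD z w : complex.Im (z + w) = complex.Im z + complex.Im w.
Proof. by case: z w => ? ? []. Qed.

Lemma ReN z : complex.Re (- z) = - complex.Re z.
Proof. by case: z. Qed.

Lemma ImN z : complex.Im (- z) = - complex.Im z.
Proof. by case: z. Qed.

Lemma ReM z w :
  complex.Re (z * w) = complex.Re z * complex.Re w - complex.Im z * complex.Im w.
Proof. by case: z w => ? ? []. Qed.

Lemma ImM z w :
  complex.Im (z * w) = complex.Re z * complex.Im w + complex.Im z * complex.Re w.
Proof. by case: z w => ? ? []. Qed.

Lemma eqC z w : complex.Re z = complex.Re w -> complex.Im z = complex.Im w -> z = w.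
Proof. by case: z w => ? ? [? ?] /= -> ->. Qed.

Lemma nbhs_modcP z (A : set C) :
  nbhs z A <-> exists2 e, 0 < e & forall w, modc (w - z) < e -> A w.
Proof.
rewrite -nbhs_ballE; split=> [[e /= e0 Ae]|[e e0 Ae]].
  have e_real : e = (complex.Re e)%:C by rewrite RRe_real// gtr0_real.
  exists (complex.Re e); first by move: e0; rewrite [e in 0 < e]e_real ltcR.
  move=> w lt_we; apply: Ae; rewrite /ball /= distrC normE [ltRHS]e_real.
  by rewrite ltcR.
exists e%:C; first by rewrite /= ltcR.
by move=> w; rewrite /ball /= distrC normE ltcR => /Ae.
Qed.

Lemma cvg_modcP (T : Type) (F : set_system T) (FF : Filter F) (f : T -> C) (l : C) :
  f @ F --> l <-> forall e, 0 < e -> \forall t \near F, modc (f t - l) < e.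
Proof.
split=> [fl e e0|fl].
  by apply: (fl [set w | modc (w - l) < e]); apply/nbhs_modcP; exists e.
move=> A /nbhs_modcP [e e0 Ae]; rewrite /nbhs /=.
by apply: filterS (fl e e0) => t; apply: Ae.
Qed.

Lemma cvg_seqP (u : nat -> C) (l : C) :
  u @ \oo --> l <->
  forall e, 0 < e -> exists N, forall n, (N <= n)%N -> modc (u n - l) < e.
Proof.
split=> [/cvg_modcP ul e /ul [N _ uN]|ul]; first by exists N.
by apply/cvg_modcP => e /ul [N uN]; exists N.
Qed.

Lemma cvgC_unique (T : Type) (F : set_system T) (FF : ProperFilter F)
  (f : T -> C) (a b : C) : f @ F --> a -> f @ F --> b -> a = b.
Proof.
move=> /cvg_modcP fa /cvg_modcP fb; apply/eqP; rewrite -subr_eq0 -modc_eq0.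
rewrite eq_le modc_ge0 andbT; apply/ler_addgt0Pl => e e0; rewrite addr0.
have e2 : 0 < e / 2 by rewrite divr_gt0.
have [t [lta ltb]] := filter_ex (filterI (fa _ e2) (fb _ e2)).
rewrite -[a - b](subrKA (f t)) (le_trans (modcD _ _))// modc_sub.
by rewrite [leRHS]splitr lerD // ltW.
Qed.

Lemma near_modc_lt z e : 0 < e -> \forall w \near z, modc (w - z) < e.
Proof. by move=> e0; apply/nbhs_modcP; exists e. Qed.

(** The first-order expansion instead of the limit of a quotient: no division by [h], hence no
    exclusion of [h = 0]. *)
Definition is_cderive (z : C) (f : C -> C) (d : C) :=
  forall e, 0 < e -> exists2 r, 0 < r &
    forall h, modc h < r -> modc (f (z + h) - f z - d * h) <= e * modc h.

Lemma is_cderiveP z f d : is_derive z 1 f d <-> is_cderive z f d.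
Proof.
have P1 : is_derive z 1 f d <->
    (fun h => h^-1 *: ((f \o shift z) (h *: (1 : C)) - f z)) @ 0^' --> d.
  split=> [[fz <-] //|fz]; split; first by apply: cvgP fz.
  by apply: cvg_lim fz; exact: norm_hausdorff.
rewrite P1 cvg_modcP; split=> fz e e0.
  have /nbhs_modcP [r r0 rP] := fz e e0; exists r => // h hr.
  have [->|h0] := eqVneq h 0.
    by rewrite addr0 subrr mulr0 subr0 modc0 mulr0.
  have /(rP h) /= : modc (h - 0) < r by rewrite subr0.
  move=> /(_ h0) /ltW; rewrite [h%:A](mulr1 h) [h + z]addrC => le_e.
  have -> : f (z + h) - f z - d * h = (h^-1 * (f (z + h) - f z) - d) * h.
    by rewrite mulrBl mulrAC mulVf// mul1r.
  by rewrite modcM; apply: ler_wpM2r le_e; exact: modc_ge0.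
have [r r0 rP] := fz _ (divr_gt0 e0 (ltr0n R 2)).
apply/nbhs_modcP; exists r => // h; rewrite subr0 => /rP le_e h0 /=.
have h0' : 0 < modc h by rewrite modc_gt0.
rewrite [h%:A](mulr1 h) [h + z]addrC.
have -> : h^-1 *: (f (z + h) - f z) - d = h^-1 * (f (z + h) - f z - d * h).
  by rewrite mulrBr [h^-1 * (d * h)]mulrCA mulVf// mulr1.
rewrite modcM modcV mulrC ltr_pdivrMr //; apply: le_lt_trans le_e _.
by rewrite ltr_pM2r// ltr_pdivrMr// ltr_pMr// ltr1n.
Qed.

Lemma is_cderive_cont z f d : is_cderive z f d -> f @ z --> f z.
Proof.
move=> df; apply/(cvg_modcP (nbhs_filter z)) => e e0.
have [r r0 rP] := df _ (@ltr01 R).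
have m0 : 0 < 1 + modc d by rewrite ltr_pwDl// modc_ge0.
apply/nbhs_modcP; exists (Num.min r (e / (1 + modc d))).
  by rewrite lt_min r0 divr_gt0.
move=> w; rewrite lt_min ltr_pdivlMr// => /andP[lt_r lt_e].
have := rP _ lt_r; rewrite addrCA subrr addr0 mul1r => le1.
apply: le_lt_trans lt_e; rewrite mulrDr mulr1.
rewrite -[f w - f z](subrK (d * (w - z))) (le_trans (modcD _ _))//.
by rewrite lerD // modcM mulrC.
Qed.

Lemma is_cderive_comp z f g d d' :
  is_cderive z f d -> is_cderive (f z) g d' ->
  is_cderive z (g \o f) (d' * d).
Proof.
move=> /is_cderiveP[/derivable1_diffP df <-] /is_cderiveP[/derivable1_diffP dg <-].
have dgf := differentiable_comp df dg.
apply/is_cderiveP; split; first exact/derivable1_diffP.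
rewrite (deriveE _ dgf) (diff_comp df dg) (deriveE _ df) (deriveE _ dg).
have lin (D : {linear C -> C}) (x : C) : D x = D 1 * x.
  have -> : x = x *: (1 : C) by rewrite [RHS]mulr1.
  by rewrite linearZ [RHS]mulrC [_ *: _]mulr1.
exact: (lin ('d g (f z)) ('d f z 1)).
Qed.

Lemma is_cderiveD z f g a b : is_cderive z f a -> is_cderive z g b ->
  is_cderive z (fun t => f t + g t) (a + b).
Proof. by move=> /is_cderiveP ? /is_cderiveP ?; apply/is_cderiveP; exact: is_deriveD. Qed.

Lemma is_cderiveM z f g a b : is_cderive z f a -> is_cderive z g b ->
  is_cderive z (fun t => f t * g t) (a * g z + f z * b).
Proof.
move=> /is_cderiveP ? /is_cderiveP ?; apply/is_cderiveP.
have -> : a * g z + f z * b = f z *: b + g z *: a.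
  by rewrite addrC [a * _]mulrC.
exact: is_deriveM.
Qed.

Lemma is_cderive_cst z (a : C) : is_cderive z (fun=> a) 0.
Proof. by apply/is_cderiveP; exact: is_derive_cst. Qed.

Lemma is_cderive_id z : is_cderive z id 1.
Proof. by apply/is_cderiveP; exact: is_derive_id. Qed.

Lemma is_cderive_eq z f a b : is_cderive z f a -> a = b -> is_cderive z f b.
Proof. by move=> df <-. Qed.

Lemma is_cderiveZ z f a (c : C) : is_cderive z f a ->
  is_cderive z (fun t => c * f t) (c * a).
Proof.
move=> df; apply: is_cderive_eq (is_cderiveM (is_cderive_cst z c) df) _.
by rewrite mul0r add0r.
Qed.

Lemma is_cderiveN z f a : is_cderive z f a -> is_cderive z (fun t => - f t) (- a).
Proof. by move=> /is_cderiveP ?; apply/is_cderiveP; exact: is_deriveN. Qed.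

Lemma is_cderiveB z f g a b : is_cderive z f a -> is_cderive z g b ->
  is_cderive z (fun t => f t - g t) (a - b).
Proof. by move=> df dg; exact: is_cderiveD df (is_cderiveN dg). Qed.

Lemma is_cderiveV z f a : f z != 0 -> is_cderive z f a ->
  is_cderive z (fun t => (f t)^-1) (- a / f z ^+ 2).
Proof.
move=> fz0 /is_cderiveP [df fa]; apply/is_cderiveP; split.
  exact: derivableV.
by rewrite deriveV// fa -[LHS]/(- (f z ^+ 2)^-1 * a) !mulNr mulrC.
Qed.

Lemma is_cderive_sum z (I : Type) (r : seq I) (F : I -> C -> C) (d : I -> C) :
  (forall i, is_cderive z (F i) (d i)) ->
  is_cderive z (fun t => \sum_(i <- r) F i t) (\sum_(i <- r) d i).
Proof.
move=> dF; elim: r => [|i r IH].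
  have -> : (fun t => \sum_(i <- [::]) F i t) = (fun=> 0 : C).
    by apply/funext => t; rewrite big_nil.
  by rewrite big_nil; exact: is_cderive_cst.
have -> : (fun t => \sum_(j <- i :: r) F j t) =
    (fun t => F i t + \sum_(j <- r) F j t).
  by apply/funext => t; rewrite big_cons.
by rewrite big_cons; exact: is_cderiveD.
Qed.

Lemma is_cderive_near z f g a : (\forall w \near z, f w = g w) ->
  is_cderive z f a -> is_cderive z g a.
Proof.
move=> /[dup] fg /nbhs_singleton fgz; move/nbhs_modcP: fg => [s s0 fg] df e e0.
have [r r0 rP] := df e e0.
exists (Num.min r s); first by rewrite lt_min r0.
move=> h; rewrite lt_min => /andP[hr hs]; rewrite -fgz -fg; first exact: rP.
by rewrite addrC addKr.
Qed.

(* The real mean value theorem, for the real and the imaginary part. *)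
Lemma is_cderive0_segment (f : C -> C) (a b : C) :
  (forall t : R, 0 <= t <= 1 -> is_cderive (a + t%:C * (b - a)) f 0) -> f a = f b.
Proof.
move=> df.
have key (g : C -> R) (gB : forall z w, g (z - w) = g z - g w)
    (g_le : forall z, `|g z| <= modc z) : g (f a) = g (f b).
  pose k t := g (f (a + t%:C * (b - a))).
  have dk (t : R) : 0 <= t <= 1 -> is_derive t 1 k 0.
    move=> t01.
    suff kl : (fun h => h^-1 *: ((k \o shift t) (h *: (1 : R)) - k t)) @ 0^' --> (0 : R).
      by split; [apply: cvgP kl|apply: cvg_lim kl].
    apply/cvgrPdist_le => e e0.
    have M0 : 0 < 1 + modc (b - a) by rewrite ltr_pwDl// modc_ge0.
    have [r r0 rP] := df t t01 _ (divr_gt0 e0 M0).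
    near=> h; rewrite sub0r normrN [h%:A]mulr1 /= /k -gB normrZ normfV.
    have h0 : h != 0 by near: h; exact: nbhs_dnbhs_neq.
    rewrite ler_pdivrMl ?normr_gt0//; apply: le_trans (g_le _) _.
    have := rP (h%:C * (b - a)); rewrite mul0r subr0 modcM modc_real.
    have -> : a + (h + t)%:C * (b - a) = a + t%:C * (b - a) + h%:C * (b - a).
      by rewrite rmorphD /=; ring.
    move=> /(_ _) /le_trans; apply.
      apply: (@le_lt_trans _ _ (`|h| * (1 + modc (b - a)))).
        by rewrite ler_wpM2l// lerDr.
      rewrite -ltr_pdivlMr//; near: h; apply: dnbhs0_lt.
      by rewrite divr_gt0.
    rewrite mulrCA ler_wpM2l// mulrAC ler_pdivrMr// ler_wpM2l ?lerDr//.
    exact: ltW.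
  have cont : {within `[0, 1]%classic, continuous k}.
    apply: continuous_in_subspaceT => t; rewrite inE /= in_itv /= => t01.
    by have [/derivable1_diffP/differentiable_continuous] := dk t t01.
  have dk' (t : R) : t \in `]0, 1[ -> is_derive t 1 k ((fun=> 0) t).
    by rewrite in_itv /= => /andP[t0 t1]; apply: dk; rewrite !ltW.
  have [t _] := @MVT _ k (fun=> 0) 0 1 ltr01 dk' cont.
  rewrite mul0r /k mul0r addr0 mul1r addrCA subrr addr0 => /eqP.
  by rewrite subr_eq0 => /eqP.
by apply/eqP; rewrite eq_complex; apply/andP; split; apply/eqP; apply: key;
  [exact: ReB|exact: modc_Re|exact: ImB|exact: modc_Im].
Unshelve. all: by end_near. Qed.

End ComplexModulus.

(** * Exponential and principal logarithm on the cut and slit planes *)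

Section ExpLog.
Local Open Scope classical_set_scope.
Local Open Scope ring_scope.
Variable R : realType.
Notation C := CC[R].
Implicit Types (z w : C) (x y e : R).

Lemma is_derive_dist (f : R -> R) x (d : R) : is_derive x (1 : R) f d ->
  forall e, 0 < e -> exists2 r, 0 < r &
    forall h, `|h| < r -> `|f (x + h) - f x - d * h| <= e * `|h|.
Proof.
case=> fx fd e e0.
have fl : (fun h => h^-1 *: ((f \o shift x) (h *: (1 : R)) - f x)) @ 0^' --> d.
  by rewrite -fd; exact: fx.
move/cvgrPdist_le : fl => /(_ e e0) [r /= r0 rP]; exists r => // h hr.
have [->|h0] := eqVneq h 0.
  by rewrite addr0 subrr mulr0 subr0 normr0 mulr0.
have := rP h; rewrite /= sub0r normrN => /(_ hr h0).
rewrite [h%:A]mulr1 [h + x]addrC => le_e.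
have -> : f (x + h) - f x - d * h = - (d - h^-1 * (f (x + h) - f x)) * h.
  by rewrite opprB mulrBl mulrAC mulVf// mul1r.
by rewrite normrM normrN; apply: ler_wpM2r le_e.
Qed.

Lemma cexpE z : cexp z =
  (expR (complex.Re z) * cos (complex.Im z)) +i*
  (expR (complex.Re z) * sin (complex.Im z)).
Proof. by apply: eqC; rewrite ?ReM ?ImM /= mul0r ?subr0 ?addr0. Qed.

Lemma cexp0 : cexp 0 = 1 :> C.
Proof. by rewrite cexpE /= expR0 cos0 sin0 mulr1 mulr0. Qed.

Lemma cexpD z w : cexp (z + w) = cexp z * cexp w.
Proof.
by apply: eqC; rewrite !cexpE ?ReM ?ImM /= ReD ImD expRD ?cosD ?sinD; ring.
Qed.

Lemma modc_cexp z : modc (cexp z) = expR (complex.Re z).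
Proof.
rewrite modc_def cexpE /= !exprMn -mulrDr cos2Dsin2 mulr1 sqrtr_sqr.
by rewrite ger0_norm ?expR_ge0.
Qed.

Lemma cexp_neq0 z : cexp z != 0.
Proof. by rewrite -modc_gt0 modc_cexp expR_gt0. Qed.

Lemma cexpN z : cexp (- z) = (cexp z)^-1.
Proof.
by apply: (mulfI (cexp_neq0 z)); rewrite -cexpD subrr cexp0 divff// cexp_neq0.
Qed.

(** The functional equation reduces this to the point 0, where the real expansions of [expR], [sin]
    and [cos] combine. *)
Lemma is_cderive_cexp z : is_cderive z (@cexp R) (cexp z).
Proof.
suff d0 : is_cderive 0 (@cexp R) 1.
  move=> e e0; have m0 : 0 < modc (cexp z) by rewrite modc_gt0 cexp_neq0.
  have [r r0 rP] := d0 _ (divr_gt0 e0 m0); exists r => // h hr.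
  have := rP h hr; rewrite add0r cexp0 mul1r cexpD => le_e.
  have -> : cexp z * cexp h - cexp z - cexp z * h = cexp z * (cexp h - 1 - h).
    by ring.
  by rewrite modcM mulrC -ler_pdivlMr// mulrAC.
(* The errors of the real and imaginary parts add up to at most 6 k |h|; taking |h| below k / 2
   turns the quadratic one into k |h|. *)
move=> e e0; pose k := Num.min 1 (e / 8).
have k0 : 0 < k by rewrite lt_min ltr01 divr_gt0.
have k1 : k <= 1 by rewrite ge_min lexx.
have k8 : k <= e / 8 by rewrite ge_min lexx orbT.
have [r1 r10 r1P] := is_derive_dist (is_derive_expR 0) k0.
have [r2 r20 r2P] := is_derive_dist (is_derive_sin 0) k0.
have [r3 r30 r3P] := is_derive_dist (is_derive_cos 0) k0.
exists (Num.min (k / 2) (Num.min r1 (Num.min r2 r3))).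
  by rewrite !lt_min r10 r20 r30 divr_gt0.
move=> h; rewrite !lt_min => /and4P[hk h1 h2 h3].
rewrite add0r cexp0 mul1r.
have hRe := modc_Re h; have hIm := modc_Im h.
have le : `|expR (complex.Re h) - 1 - complex.Re h| <= k * `|complex.Re h|.
  by have := r1P _ (le_lt_trans hRe h1); rewrite add0r expR0 mul1r.
have ls : `|sin (complex.Im h) - complex.Im h| <= k * `|complex.Im h|.
  by have := r2P _ (le_lt_trans hIm h2); rewrite add0r sin0 cos0 mul1r subr0.
have lc : `|cos (complex.Im h) - 1| <= k * `|complex.Im h|.
  by have := r3P _ (le_lt_trans hIm h3); rewrite add0r sin0 cos0 oppr0 mul0r subr0.
apply: le_trans (modc_le _) _.
rewrite !ReB !ImB cexpE /= subr0.
move: (complex.Re h) (complex.Im h) hRe hIm lc ls le => x y hRe hIm lc ls le.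
have -> : expR x * cos y - 1 - x = (expR x - 1 - x) + expR x * (cos y - 1) by ring.
have -> : expR x * sin y - y = expR x * (sin y - y) + (expR x - 1) * y by ring.
have m0 := modc_ge0 h; set m := modc h in hk hRe hIm m0 *.
have le' : `|expR x - 1 - x| <= k * m by apply: le_trans le _; rewrite ler_pM2l.
have ls' : `|sin y - y| <= k * m by apply: le_trans ls _; rewrite ler_pM2l.
have lc' : `|cos y - 1| <= k * m by apply: le_trans lc _; rewrite ler_pM2l.
have mk : m <= k / 2 by exact: ltW.
have km : k * m <= m by rewrite ler_piMl.
have E1 : `|expR x - 1| <= 2 * m.
  by rewrite -[_ - 1](subrK x) (le_trans (ler_normD _ _))//; lra.
have E2 : `|expR x| <= 2.
  by rewrite -[expR x](subrK 1) (le_trans (ler_normD _ _))// normr1; lra.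
have t1 : `|expR x - 1 - x + expR x * (cos y - 1)| <= k * m + 2 * (k * m).
  by rewrite (le_trans (ler_normD _ _))// lerD// normrM ler_pM.
have t2 : `|expR x * (sin y - y) + (expR x - 1) * y| <= 2 * (k * m) + 2 * m * m.
  by rewrite (le_trans (ler_normD _ _))// lerD// normrM ler_pM.
have mm : 2 * m * m <= k * m by rewrite ler_wpM2r//; lra.
have : k * m <= e / 8 * m by rewrite ler_wpM2r.
have := mulr_ge0 (ltW e0) m0.
lra.
Qed.

Definition cut_plane : set C :=
  [set z | ~ (complex.Im z = 0 /\ complex.Re z <= 0)].

Lemma cut_plane_neq0 z : cut_plane z -> z != 0.
Proof. by move=> zc; apply/eqP => z0; apply: zc; rewrite z0. Qed.

Lemma Re_modc_itv z : z != 0 -> -1 <= complex.Re z / modc z <= 1.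
Proof.
rewrite -modc_gt0 => z0; rewrite -ler_norml normrM normfV.
by rewrite [`|modc z|]gtr0_norm// ler_pdivrMr// mul1r modc_Re.
Qed.

Lemma cos_Arg z : z != 0 -> cos (Arg z) = complex.Re z / modc z.
Proof.
move=> z0; rewrite /Arg -/(modc z); have zI := Re_modc_itv z0.
by case: ifP => _; rewrite ?cosN acosK.
Qed.

Lemma sin_Arg z : z != 0 -> sin (Arg z) = complex.Im z / modc z.
Proof.
move=> z0; rewrite /Arg -/(modc z); have zI := Re_modc_itv z0.
have m0 : 0 < modc z by rewrite modc_gt0.
have E : sin (acos (complex.Re z / modc z)) = `|complex.Im z| / modc z.
  rewrite sin_acos//.
  have m2 : modc z ^+ 2 = complex.Re z ^+ 2 + complex.Im z ^+ 2.
    by rewrite modc_def sqr_sqrtr// addr_ge0// sqr_ge0.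
  have m20 : modc z ^+ 2 != 0 by rewrite expf_neq0// gt_eqF.
  have -> : 1 - (complex.Re z / modc z) ^+ 2 = (`|complex.Im z| / modc z) ^+ 2.
    rewrite !expr_div_n real_normK ?num_real//; apply: (mulIf m20).
    by rewrite mulrBl !divfK// mul1r m2 [X in X - _]addrC addrK.
  by rewrite sqrtr_sqr; apply: ger0_norm; rewrite divr_ge0 ?modc_ge0.
case: ifPn => Iz; rewrite ?sinN E; first by rewrite ger0_norm.
by rewrite ltr0_norm ?ltNge// mulNr opprK.
Qed.

Lemma LogK z : z != 0 -> cexp (Log z) = z.
Proof.
move=> z0; rewrite cexpE /= -/(modc z) cos_Arg// sin_Arg//.
have m0 : 0 < modc z by rewrite modc_gt0.
rewrite lnK ?posrE//.
by apply: eqC; rewrite /= mulrC divfK// gt_eqF.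
Qed.

Lemma cexpK z : - pi < complex.Im z <= pi -> Log (cexp z) = z.
Proof.
move=> /andP[zl zr]; rewrite /Log -/(modc _) modc_cexp expRK.
case: z zl zr => x y /= yl yr; congr (_ +i* _).
rewrite /Arg -/(modc _) modc_cexp cexpE /= mulrAC divff ?gt_eqF ?expR_gt0// mul1r.
rewrite pmulr_rge0 ?expR_gt0//.
have [y0|y0] := leP 0 y.
  by rewrite sin_ge0_pi ?y0// cosK// in_itv /= y0.
have -> : (0 <= sin y) = false.
  apply/negbTE; rewrite -ltNge -[y]opprK sinN oppr_lt0.
  by rewrite sin_gt0_pi// oppr_gt0 y0 ltrNl.
by rewrite cosKN ?opprK// !ltW.
Qed.

Lemma Arg_le_pi z : z != 0 -> - pi <= Arg z <= pi.
Proof.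
move=> z0; rewrite /Arg -/(modc z); have zI := Re_modc_itv z0.
have a0 := acos_ge0 zI; have a1 := acos_lepi zI; have := @pi_gt0 R.
by case: ifP => _ p0; apply/andP; split; lra.
Qed.

Lemma Arg_Im_gt0 z : 0 < complex.Im z -> 0 < Arg z < pi.
Proof.
move=> Iz; have z0 : z != 0 by apply: contraTneq Iz => ->; rewrite ltxx.
have := sin_Arg z0; have m0 : 0 < modc z by rewrite modc_gt0.
rewrite /Arg (ltW Iz) -/(modc z); have zI := Re_modc_itv z0.
have a0 := acos_ge0 zI; have a1 := acos_lepi zI.
have s0 : 0 < complex.Im z / modc z by rewrite divr_gt0.
move=> sE; rewrite !lt_neqAle a0 a1 !andbT; apply/andP; split; apply/eqP => aE.
  by move: sE s0; rewrite -aE sin0 => <-; rewrite ltxx.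
by move: sE s0; rewrite aE sinpi => <-; rewrite ltxx.
Qed.

Lemma Arg_Im_lt0 z : complex.Im z < 0 -> - pi < Arg z < 0.
Proof.
move=> Iz; have z0 : z != 0 by apply: contraTneq Iz => ->; rewrite ltxx.
have := sin_Arg z0; have m0 : 0 < modc z by rewrite modc_gt0.
rewrite /Arg leNgt Iz -/(modc z) /= sinN; have zI := Re_modc_itv z0.
have a0 := acos_ge0 zI; have a1 := acos_lepi zI.
have s0 : complex.Im z / modc z < 0 by rewrite pmulr_llt0// invr_gt0.
move=> sE; rewrite ltrN2 oppr_lt0 !lt_neqAle a0 a1 !andbT.
apply/andP; split; apply/eqP => aE.
  by move: sE s0; rewrite aE sinpi oppr0 => <-; rewrite ltxx.
by move: sE s0; rewrite -aE sin0 oppr0 => <-; rewrite ltxx.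
Qed.

Lemma Arg_cut z : cut_plane z -> - pi < Arg z < pi.
Proof.
move=> zc; have [Iz|Iz|Iz] := ltrgtP (complex.Im z) 0.
- by have /andP[-> /lt_trans->//] := Arg_Im_lt0 Iz; exact: pi_gt0.
- have /andP[a0 ->] := Arg_Im_gt0 Iz; rewrite andbT (lt_trans _ a0)//.
  by rewrite oppr_lt0 pi_gt0.
- have Rz : 0 < complex.Re z by rewrite ltNge; apply/negP => Rz; exact: zc.
  rewrite /Arg Iz lexx -/(modc z) modc_def Iz expr0n addr0 sqrtr_sqr gtr0_norm//.
  by rewrite divff ?gt_eqF// acos1 oppr_lt0 pi_gt0.
Qed.

Lemma Log1 : Log 1 = 0 :> C.
Proof. by rewrite -cexp0 cexpK //= oppr_lt0 pi_gt0 pi_ge0. Qed.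

Lemma Log_opp (s : bool) z : half_plane s z ->
  Log (- z) = Log z - (0 +i* ((-1) ^+ s * pi)).
Proof.
rewrite /half_plane /= => zs.
have z0 : z != 0 by apply: contraTneq zs => ->; rewrite mulr0 ltxx.
have -> : - z = cexp (Log z - (0 +i* ((-1) ^+ s * pi))).
  rewrite cexpD LogK// [X in _ * X]cexpE /= oppr0 expR0 !mul1r cosN sinN.
  have -> : cos ((-1) ^+ s * pi) = -1 :> R.
    by case: s {zs} => /=; rewrite ?expr1 ?expr0 ?mulN1r ?cosN ?mul1r cospi.
  have -> : sin ((-1) ^+ s * pi) = 0 :> R.
    by case: s {zs} => /=; rewrite ?expr1 ?expr0 ?mulN1r ?sinN ?mul1r sinpi ?oppr0.
  by apply: eqC; rewrite ?ReM ?ImM ?ReN ?ImN /= oppr0; ring.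
rewrite cexpK// ImB /=.
case: s zs => /=; rewrite ?expr1 ?expr0 ?mulN1r ?mul1r ?oppr_gt0.
  by move=> /Arg_Im_lt0 /andP[a b]; apply/andP; split; have := @pi_gt0 R; lra.
by move=> /Arg_Im_gt0 /andP[a b]; apply/andP; split; have := @pi_gt0 R; lra.
Qed.

Lemma modc_Log z : z != 0 -> modc (Log z) <= `|ln (modc z)| + pi.
Proof.
move=> z0; apply: le_trans (modc_le _) _; rewrite /= lerD2l ler_norml.
exact: Arg_le_pi.
Qed.

Lemma Log_near z w : cut_plane z -> w != 0 ->
  `|complex.Im (Log w)| < pi - `|Arg z| -> Log (z * w) = Log z + Log w.
Proof.
move=> zc w0 lt_w; have z0 := cut_plane_neq0 zc.
rewrite -{1}(LogK z0) -{1}(LogK w0) -cexpD cexpK// ImD [complex.Im (Log z)]/=.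
move: lt_w; rewrite ltr_norml => /andP[h1 h2].
have := ler_norm (Arg z); have := lerNnormlW (lexx `|Arg z|).
by move=> h3 h4; apply/andP; split; lra.
Qed.

Lemma Log_small e : 0 < e -> exists2 r, 0 < r &
  forall h, modc h < r -> 1 + h != 0 /\ modc (Log (1 + h)) < e.
Proof.
move=> e0; pose e' := Num.min 1 (e / 2).
have e'0 : 0 < e' by rewrite lt_min ltr01 divr_gt0.
have e'1 : e' <= 1 by rewrite ge_min lexx.
have e'2 : e' <= e / 2 by rewrite ge_min lexx orbT.
have pi2 := @pi_ge2 R.
have c1 : cos e' < 1.
  by rewrite -[ltRHS]cos0 ltr_cos ?in_itv /= ?lexx ?pi_ge0// ltW//=; lra.
(* The first bound keeps 1 + h away from 0, the second makes the cosine of its argument exceed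
   [cos e'], the third makes the logarithm of its modulus less than e / 4. *)
pose r := Num.min (1 / 2) (Num.min ((1 - cos e') / 4) (e / 8)).
exists r; first by rewrite !lt_min !divr_gt0//= subr_gt0 c1.
move=> h; rewrite !lt_min => /and3P[h2 hc he].
have m0 := modc_ge0 h; set m := modc h in h2 hc he m0 *.
have mu : modc (1 + h) <= 1 + m by have := modcD 1 h; rewrite modc1.
have ml : 1 - m <= modc (1 + h).
  by have := modc_dist 1 (- h); rewrite opprK modc1 modcN.
have M0 : 0 < modc (1 + h) by lra.
have n0 : 1 + h != 0 by rewrite -modc_gt0.
split=> //; apply: le_lt_trans (modc_le _) _; rewrite [complex.Re _]/= -/(modc _).
have l1 : `|ln (modc (1 + h))| <= 2 * m.
  rewrite ler_norml; apply/andP; split; last first.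
    have := @le_ln1Dx R (modc (1 + h) - 1); rewrite addrCA subrr addr0.
    have h1 : -1 < modc (1 + h) - 1 by lra.
    by move=> /(_ h1); lra.
  rewrite lerNl -lnV ?posrE//.
  have v : (modc (1 + h))^-1 <= 1 + 2 * m.
    rewrite invf_ple ?posrE//; last lra.
    by rewrite -[leLHS]mul1r ler_pdivrMr; nra.
  have V0 : 0 < (modc (1 + h))^-1 by rewrite invr_gt0.
  have := @le_ln1Dx R ((modc (1 + h))^-1 - 1); rewrite addrCA subrr addr0.
  have h1 : -1 < (modc (1 + h))^-1 - 1 by lra.
  by move=> /(_ h1); lra.
have l2 : `|Arg (1 + h)| < e'.
  have tI := Re_modc_itv n0; have a0 := acos_ge0 tI; have ap := acos_lepi tI.
  have -> : `|Arg (1 + h)| = acos (complex.Re (1 + h) / modc (1 + h)).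
    by rewrite /Arg -/(modc _); case: ifP => _; rewrite ?normrN ger0_norm.
  rewrite -ltr_cos ?in_itv /= ?a0 ?ap//; last by rewrite ltW//=; lra.
  rewrite acosK ?in_itv//= ltr_pdivlMr//.
  have := modc_Re h; rewrite ler_norml ReD /= -/m => /andP[h3 h4].
  have c1' : -1 <= cos e' by rewrite cos_geN1.
  by nra.
by rewrite [complex.Im _]/=; lra.
Qed.

Lemma is_cderive_Log z : cut_plane z -> is_cderive z (@Log R) z^-1.
Proof.
move=> zc; have z0 := cut_plane_neq0 zc; have M0 : 0 < modc z by rewrite modc_gt0.
move=> e e0.
(* With w = Log (1 + h / z), the bound 1 / 2 gives |w| <= 2 |h / z|, and the other one then turns
   the error k |w| into at most e |h|. *)
pose k := Num.min (1 / 2) (modc z * e / 2).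
have k0 : 0 < k by rewrite lt_min !divr_gt0// mulr_gt0.
have k1 : k <= 1 / 2 by rewrite ge_min lexx.
have k2 : k <= modc z * e / 2 by rewrite ge_min lexx orbT.
have [r r0 rP] := is_cderive_cexp 0 k0.
have p0 : 0 < pi - `|Arg z|.
  by rewrite subr_gt0 ltr_norml; exact: Arg_cut.
have rp : 0 < Num.min r (pi - `|Arg z|) by rewrite lt_min r0.
have [s s0 sP] := Log_small rp.
exists (s * modc z) => [|h hs]; first exact: mulr_gt0.
have hz : modc (h / z) < s by rewrite modcM modcV ltr_pdivrMr.
have [n0] := sP _ hz; rewrite lt_min => /andP[lr lp].
have -> : z + h = z * (1 + h / z) by rewrite mulrDr mulr1 mulrC divfK.
rewrite Log_near//; last by apply: le_lt_trans lp; exact: modc_Im.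
set w := Log _ in lr lp *.
have := rP w lr; rewrite add0r cexp0 mul1r LogK// [1 + _]addrC addrK => le_w.
have a1 : modc w <= 2 * modc (h / z).
  have := modc_dist w (h / z); rewrite modc_sub.
  have : k * modc w <= 1 / 2 * modc w by rewrite ler_wpM2r// modc_ge0.
  by lra.
rewrite [Log z + w]addrC addrK -modcN opprB [z^-1 * h]mulrC.
apply: le_trans le_w _.
have -> : modc h = modc z * modc (h / z) by rewrite -modcM mulrC divfK.
have := modc_ge0 w; have := modc_ge0 (h / z).
by nra.
Qed.

Lemma slit_cut z : slit_plane z -> cut_plane z.
Proof. by move=> zs [z1 z2]; apply: zs; split=> //; left. Qed.

Lemma slit_subr z : slit_plane z -> slit_plane (1 - z).
Proof.
move=> zs [z1 z2]; apply: zs; move: z1 z2; rewrite ImB ReB /= sub0r.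
move=> /eqP; rewrite oppr_eq0 => /eqP -> [] z2; split=> //; [right|left]; lra.
Qed.

Lemma slit_neq0 z : slit_plane z -> z != 0.
Proof. by move=> /slit_cut/cut_plane_neq0. Qed.

Lemma slit_neq1 z : slit_plane z -> 1 - z != 0.
Proof. by move=> /slit_subr/slit_neq0. Qed.

Lemma half_slit s z : half_plane s z -> slit_plane z.
Proof. by rewrite /half_plane /= => zs [z0 _]; move: zs; rewrite z0 mulr0 ltxx. Qed.

Lemma half_real : (2^-1 : C) = (2^-1)%:C.
Proof. by rewrite fmorphV rmorph_nat. Qed.

(** The two cuts lie on rays issued from 1/2, so the slit plane is star-shaped about that point; a
    zero derivative then forces constancy. *)
Lemma slit_star z (t : R) : slit_plane z -> 0 <= t <= 1 ->
  slit_plane (2^-1 + t%:C * (z - 2^-1)).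
Proof.
move=> zs /andP[t0 t1] [I0 R0].
move: I0 R0; rewrite half_real ReD ImD ReM ImM ReB ImB /= !mul0r !subr0 !add0r addr0.
move=> /eqP; rewrite mulf_eq0 => /orP[/eqP t00|/eqP Iz].
  by rewrite t00 mul0r; lra.
move=> Rz; apply: zs; split=> //; case: Rz => Rz; [left|right]; rewrite leNgt; apply/negP => Rz'.
  have tx : 0 <= t * complex.Re z by rewrite mulr_ge0// ltW.
  have tE : t = 1 by rewrite mulrBr in Rz; lra.
  by rewrite tE mul1r in Rz; lra.
have tx : 0 <= t * (1 - complex.Re z) by rewrite mulr_ge0// subr_ge0 ltW.
have tE : t = 1 by rewrite !mulrBr in Rz tx; lra.
by rewrite tE mul1r in Rz; lra.
Qed.

Lemma slit_open z : slit_plane z -> \forall w \near z, slit_plane w.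
Proof.
move=> zs; apply/nbhs_modcP.
have [Iz|Iz] := eqVneq (complex.Im z) 0; last first.
  exists `|complex.Im z|; first by rewrite normr_gt0.
  move=> w wz [w0 _]; have := modc_Im (w - z); rewrite ImB w0 sub0r normrN.
  by rewrite leNgt wz.
have [R0 R1] : 0 < complex.Re z /\ complex.Re z < 1.
  by split; rewrite ltNge; apply/negP => h; apply: zs; split=> //; [left|right].
exists (Num.min (complex.Re z) (1 - complex.Re z)).
  by rewrite lt_min R0 subr_gt0.
move=> w wz [_]; have := le_lt_trans (modc_Re (w - z)) wz.
by rewrite lt_min ReB !ltr_norml => /andP[/andP[? ?] /andP[? ?]]; lra.
Qed.

Lemma slit_half : slit_plane (2^-1 : C).
Proof.
by rewrite half_real => -[_] /=; lra.
Qed.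

Lemma is_cderive_Log1B z : slit_plane z ->
  is_cderive z (fun t => Log (1 - t)) (- (1 - z)^-1).
Proof.
move=> zs; have d1 := is_cderiveB (is_cderive_cst z 1) (is_cderive_id z).
apply: is_cderive_eq (is_cderive_comp d1 (is_cderive_Log (slit_cut (slit_subr zs)))) _.
by rewrite sub0r mulrN1.
Qed.

Lemma is_cderive0_star (S : set C) (a : C) (f : C -> C) :
  (forall z (t : R), S z -> 0 <= t <= 1 -> S (a + t%:C * (z - a))) ->
  (forall z, S z -> is_cderive z f 0) -> forall z, S z -> f z = f a.
Proof.
by move=> starS df z Sz; apply/esym/is_cderive0_segment => t t01; exact/df/starS.
Qed.

Lemma slit_div_cut w : slit_plane w -> cut_plane (w / (1 - w)).
Proof.
move=> ws [I0 R0]; set q := w / (1 - w) in I0 R0.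
have w1 := slit_neq1 ws.
have qE : q = (complex.Re q)%:C by apply: eqC.
have q1 : 1 + q != 0.
  have -> : 1 + q = (1 - w)^-1 by rewrite /q; field.
  by rewrite invr_neq0.
have wE : w = q / (1 + q).
  by rewrite /q; field; rewrite w1 /= subrK oner_neq0.
apply: ws; rewrite wE qE -(rmorph1 (real_complex R)) -rmorphD -fmorphV -rmorphM /=.
split=> //; move: q1; rewrite qE -(rmorph1 (real_complex R)) -rmorphD /=.
rewrite (inj_eq (@complexI R)); move: (complex.Re q) R0 => x x0 x1.
have [xl|xr] := ltP x (-1).
  by right; rewrite ler_ndivlMr; lra.
have x2 : 0 < 1 + x by rewrite lt_neqAle eq_sym x1; lra.
by left; rewrite pmulr_lle0 ?invr_gt0.
Qed.

(** Both sides have the same derivative on the slit plane and vanish at 1/2. *)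
Lemma Log_div1B z : slit_plane z -> Log (z / (1 - z)) = Log z - Log (1 - z).
Proof.
move=> zs; apply/eqP; rewrite -subr_eq0; apply/eqP.
pose f w := Log (w / (1 - w)) - (Log w - Log (1 - w)) : C.
rewrite -[LHS]/(f z).
rewrite (@is_cderive0_star (@slit_plane R) 2^-1 f) //; last 2 first.
- by move=> w t; exact: slit_star.
- move=> w ws; have w0 := slit_neq0 ws; have w1 := slit_neq1 ws.
  have d1 := is_cderiveB (is_cderive_cst w 1) (is_cderive_id w).
  have d2 := is_cderiveM (is_cderive_id w)
    (@is_cderiveV _ w (fun t => 1 - t) _ w1 d1).
  have d3 := is_cderive_comp d2 (is_cderive_Log (slit_div_cut ws)).
  have d4 := is_cderiveB (is_cderive_Log (slit_cut ws)) (is_cderive_Log1B ws).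
  apply: is_cderive_eq (is_cderiveB d3 d4) _.
  by field; rewrite w1 w0.
rewrite /f.
have -> : 1 - 2^-1 = 2^-1 :> C by field.
by rewrite divff ?Log1 ?subrr// invr_neq0// pnatr_eq0.
Qed.

End ExpLog.

(** * Power series: operations, derivatives, primitives, zeros *)

Section PowerSeries.
Local Open Scope classical_set_scope.
Local Open Scope ring_scope.
Variable R : realType.
Notation C := CC[R].
Implicit Types (a b c : nat -> C) (f g : C -> C) (r s : R).

(* The coefficients of a power series of radius of convergence at least r. *)
Definition geom r a :=
  forall s, 0 < s < r -> exists M, forall n, modc (a n) * s ^+ n <= M.

Definition psum a (z : C) (N : nat) : C := \sum_(n < N) a n * z ^+ n.

Lemma psumE a z : psum a z = series (fun n => a n * z ^+ n).
Proof. by apply/funext => N; rewrite /series /= big_mkord. Qed.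

Definition pseries r a f :=
  geom r a /\ forall z, modc z < r -> psum a z @ \oo --> f z.

Lemma cvg_psumP a z l : psum a z @ \oo --> l <->
  forall e, 0 < e -> exists N, forall n, (N <= n)%N -> modc (psum a z n - l) < e.
Proof. exact: cvg_seqP. Qed.

Lemma cvg_succ (u : nat -> C) (l : C) :
  (fun n => u n.+1) @ \oo --> l <-> u @ \oo --> l.
Proof.
rewrite !cvg_seqP; split=> ul e /ul[N NP].
  by exists N.+1 => -[|n] // /NP.
by exists N => n Nn; apply: NP; exact: leqW.
Qed.

Lemma seq_bounded (u : nat -> C) (B : R) (N : nat) :
  (forall n, (N <= n)%N -> modc (u n) <= B) -> exists M, forall n, modc (u n) <= M.
Proof.
move=> uB; exists (`|B| + \sum_(i < N) modc (u i)) => n.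
have S0 : 0 <= \sum_(i < N) modc (u i) by apply: sumr_ge0 => i _; exact: modc_ge0.
have [lt_nN|/uB le_n] := ltnP n N; last first.
  by apply: le_trans le_n _; have := ler_norm B; lra.
rewrite (bigD1 (Ordinal lt_nN))//= addrCA lerDl addr_ge0// sumr_ge0// => i _.
exact: modc_ge0.
Qed.

Lemma geom_ge0 r a s : 0 < s < r -> geom r a ->
  exists2 M, 0 < M & forall n, modc (a n) * s ^+ n <= M.
Proof.
move=> s_r /(_ s s_r) [M MP]; exists (`|M| + 1).
  by rewrite ltr_wpDl.
by move=> n; apply: le_trans (MP n) _; have := ler_norm M; lra.
Qed.

Lemma geomD r a b : geom r a -> geom r b -> geom r (fun n => a n + b n).
Proof.
move=> ga gb s s_r; have [M MP] := ga s s_r; have [N NP] := gb s s_r.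
exists (M + N) => n; apply: le_trans (lerD (MP n) (NP n)); rewrite -mulrDl.
by rewrite ler_wpM2r ?modcD// exprn_ge0//; case/andP: s_r => /ltW.
Qed.

Lemma geomZ r (k : C) a : geom r a -> geom r (fun n => k * a n).
Proof.
move=> ga s s_r; have [M MP] := ga s s_r.
exists (modc k * M) => n; rewrite modcM -mulrA ler_wpM2l//; exact: modc_ge0.
Qed.

Definition shiftc a n : C := if n is m.+1 then a m else 0.

Lemma geom_shift r a : geom r a -> geom r (shiftc a).
Proof.
move=> ga s s_r; have [M M0 MP] := geom_ge0 s_r ga; have /andP[s0 _] := s_r.
exists (s * M) => -[|n] /=; first by rewrite modc0 mul0r mulr_ge0// ltW.
by rewrite exprS mulrCA ler_pM2l.
Qed.

Lemma geom_drop r a : geom r a -> geom r (fun n => a n.+1).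
Proof.
move=> ga s s_r; have [M M0 MP] := geom_ge0 s_r ga; have /andP[s0 _] := s_r.
exists (M / s) => n; rewrite ler_pdivlMr// -mulrA -exprSr; exact: MP.
Qed.

(** Each of the n terms of the geometric sum is at least q^n. *)
Lemma natmul_geometric (q : R) n : 0 <= q < 1 -> n%:R * q ^+ n <= (1 - q)^-1.
Proof.
move=> /andP[q0 q1]; have q' : 0 < 1 - q by rewrite subr_gt0.
have sum1 : (1 - q) * \sum_(i < n) q ^+ i = 1 - q ^+ n.
  by rewrite -[in RHS](expr1n R n) subrXX big_distrr [RHS]big_distrr /=;
     apply: eq_bigr => i _; rewrite expr1n mul1r.
rewrite -[leRHS]mul1r ler_pdivlMr// mulrC.
have le_S : n%:R * q ^+ n <= \sum_(i < n) q ^+ i.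
  rewrite -[n in n%:R]card_ord -sumr_const big_distrl ler_sum// => i _ /=.
  by rewrite mul1r ler_wiXn2l ?(ltW q1)// ltnW.
have qn : 0 <= q ^+ n by rewrite exprn_ge0.
by apply: le_trans (ler_wpM2l (ltW q') le_S) _; rewrite sum1 gerBl.
Qed.

Lemma geom_natmul r a : geom r a -> geom r (fun n => n%:R * a n).
Proof.
move=> ga s /andP[s0 sr]; pose t := (s + r) / 2.
have t_r : 0 < t < r by rewrite /t; apply/andP; split; lra.
have [M M0 MP] := geom_ge0 t_r ga; have t0 : 0 < t by case/andP: t_r.
have q01 : 0 <= s / t < 1.
  by rewrite divr_ge0 ?ltW//= ltr_pdivrMr// mul1r /t; lra.
exists (M * (1 - s / t)^-1) => n; rewrite modcM modc_nat.
have -> : n%:R * modc (a n) * s ^+ n =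
    modc (a n) * t ^+ n * (n%:R * (s / t) ^+ n).
  have tn : t ^+ n != 0 by rewrite expf_neq0// gt_eqF.
  rewrite [(s / t) ^+ n]expr_div_n; move: (s ^+ n) (t ^+ n) tn => x y y0.
  by field.
rewrite ler_pM ?natmul_geometric//; first by rewrite mulr_ge0 ?modc_ge0 ?exprn_ge0 ?ltW.
by rewrite mulr_ge0// exprn_ge0//; case/andP: q01.
Qed.

Lemma sum_geometric_le (q : R) N : 0 <= q < 1 -> \sum_(i < N) q ^+ i <= (1 - q)^-1.
Proof.
move=> /andP[q0 q1]; have q' : 0 < 1 - q by rewrite subr_gt0.
rewrite -[leRHS]mul1r ler_pdivlMr// mulrC.
have -> : (1 - q) * \sum_(i < N) q ^+ i = 1 - q ^+ N.
  by rewrite -[in RHS](expr1n R N) subrXX big_distrr [RHS]big_distrr /=;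
     apply: eq_bigr => i _; rewrite expr1n mul1r.
by rewrite gerBl exprn_ge0.
Qed.

Lemma cvg_dominated a z (u : nat -> R) :
  (forall n, modc (a n * z ^+ n) <= u n) -> cvg (series u @ \oo) ->
  exists l : C, psum a z @ \oo --> l.
Proof.
move=> au cu.
have cvgR (g : C -> R) (gle : forall w, `|g w| <= modc w) :
    cvg (series (fun n => g (a n * z ^+ n)) @ \oo).
  apply: normed_cvg; apply: (@series_le_cvg _ _ u) cu.
  - by move=> n /=.
  - by move=> n; apply: le_trans (au n); exact: modc_ge0.
  - by move=> n /=; apply: le_trans (au n).
have /cvg_ex[/= x xP] := cvgR _ (@modc_Re R).
have /cvg_ex[/= y yP] := cvgR _ (@modc_Im R).
exists (x +i* y : C); apply/cvg_psumP => e e0.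
have e2 : 0 < e / 2 by rewrite divr_gt0.
move/cvgrPdist_lt : xP => /(_ _ e2) [N1 _ N1P].
move/cvgrPdist_lt : yP => /(_ _ e2) [N2 _ N2P].
exists (maxn N1 N2) => n; rewrite geq_max => /andP[n1 n2].
have := N1P n n1; have := N2P n n2; rewrite /= !seriesEord /=.
rewrite -Re_sum -Im_sum distrC [in X in _ -> X -> _]distrC.
move=> h1 h2; apply: le_lt_trans (modc_le _) _; rewrite ReB ImB /= /psum.
lra.
Qed.

Lemma cvg_geom r a z : geom r a -> modc z < r -> exists l : C, psum a z @ \oo --> l.
Proof.
move=> ga zr; pose s := (modc z + r) / 2.
have z0 := modc_ge0 z; have s_r : 0 < s < r by rewrite /s; apply/andP; split; lra.
have [M M0 MP] := geom_ge0 s_r ga; have s0 : 0 < s by case/andP: s_r.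
have q01 : 0 <= modc z / s < 1.
  by rewrite divr_ge0 ?(ltW s0)//= ltr_pdivrMr// mul1r /s; lra.
apply: (@cvg_dominated _ _ (geometric M (modc z / s))) => [n|].
  rewrite modcM modcX /= [(_ / s) ^+ n]expr_div_n mulrA ler_pdivlMr ?exprn_gt0// mulrAC.
  by rewrite ler_wpM2r// exprn_ge0.
by apply: is_cvg_geometric_series; rewrite ger0_norm; case/andP: q01.
Qed.

Lemma pseries_ex r a : geom r a -> exists f, pseries r a f.
Proof.
move=> ga; have zP (z : C) : exists l : C, modc z < r -> psum a z @ \oo --> l.
  by have [/(cvg_geom ga)[l]|_] := ltP (modc z) r; [exists l|exists 0].
by have [f fP] := choice zP; exists f.
Qed.

Lemma pseries_uniq r a f g : pseries r a f -> pseries r a g ->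
  forall z, modc z < r -> f z = g z.
Proof. by move=> [_ fa] [_ ga] z zr; apply: cvgC_unique (fa z zr) (ga z zr). Qed.

Lemma pseries0 r a f : 0 < r -> pseries r a f -> f 0 = a 0%N.
Proof.
move=> r0 [_ fa]; have := fa 0; rewrite modc0 => /(_ r0) f0.
apply: cvgC_unique f0 _; apply/cvg_psumP => e e0; exists 1%N => -[|n] // _.
rewrite /psum big_ord_recl expr0 mulr1 big1 ?addr0 ?subrr ?modc0// => i _.
by rewrite expr0n mulr0.
Qed.

Definition cstc (k : C) n : C := if n is 0%N then k else 0.

Lemma pseries_cst r (k : C) : pseries r (cstc k) (fun=> k).
Proof.
split=> [s /andP[s0 s1]|t _].
  exists (modc k) => -[|n] /=; first by rewrite expr0 mulr1.
  by rewrite modc0 mul0r modc_ge0.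
apply/cvg_psumP => e e0; exists 1%N => -[|n] // _.
rewrite /psum big_ord_recl expr0 mulr1 big1 ?addr0 ?subrr ?modc0// => i _.
by rewrite mul0r.
Qed.

Lemma pseries_ext r a f g : (forall t, modc t < r -> f t = g t) ->
  pseries r a f -> pseries r a g.
Proof.
move=> fg [ga fa]; split; first exact: ga.
by move=> t tr; rewrite -(fg t tr); exact: fa.
Qed.

Lemma pseriesD r a b f g : pseries r a f -> pseries r b g ->
  pseries r (fun n => a n + b n) (fun z => f z + g z).
Proof.
move=> [ga fa] [gb fb]; split=> [|z zr]; first exact: geomD.
have -> : psum (fun n => a n + b n) z = (fun N => psum a z N + psum b z N).
  apply/funext => N; rewrite -big_split; apply: eq_bigr => n _; exact: mulrDl.
by apply: cvgD; [exact: fa|exact: fb].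
Qed.

Lemma pseriesZ r (k : C) a f : pseries r a f ->
  pseries r (fun n => k * a n) (fun z => k * f z).
Proof.
move=> [ga fa]; split=> [|z zr]; first exact: geomZ.
have -> : psum (fun n => k * a n) z = (fun N => k * psum a z N).
  apply/funext => N; rewrite /psum big_distrr; apply: eq_bigr => n _ /=.
  by rewrite mulrA.
by apply: cvgMr; exact: fa.
Qed.

Lemma psum_shift a z N : psum (shiftc a) z N.+1 = z * psum a z N.
Proof.
rewrite /psum big_ord_recl /= mul0r add0r big_distrr; apply: eq_bigr => n _ /=.
by rewrite exprS mulrCA.
Qed.

Lemma pseries_mulz r a f : pseries r a f -> pseries r (shiftc a) (fun z => z * f z).
Proof.
move=> [ga fa]; split=> [|z zr]; first exact: geom_shift.
apply/cvg_succ.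
have -> : (fun n => psum (shiftc a) z n.+1) = (fun N => z * psum a z N).
  by apply/funext => N; rewrite -psum_shift.
by apply: cvgMr; exact: fa.
Qed.

(** The recurrence says that the series of [c] times al - z is the series of [a]; the pole al lies
    outside the disc, so the radius does not shrink. *)
Lemma pseries_div r (al : C) a c f : 0 < r <= modc al ->
  (forall n, al * c n = a n + shiftc c n) ->
  pseries r a f -> pseries r c (fun z => f z / (al - z)).
Proof.
move=> /andP[r0 ral] cE [ga fa]; have al0 : 0 < modc al by exact: lt_le_trans ral.
have gc : geom r c.
  move=> s s_r; have [M M0 MP] := geom_ge0 s_r ga; have /andP[s0 sr] := s_r.
  have sal : 0 < modc al - s by rewrite subr_gt0 (lt_le_trans sr).
  (* The fixed point of B -> (M + s B) / |al|, which is the bound that the recurrence propagates. *)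
  exists (M / (modc al - s)) => n.
  have cn m : modc (c m) * s ^+ m <= (M + modc (shiftc c m) * s ^+ m) / modc al.
    rewrite ler_pdivlMr// mulrAC [modc _ * modc _]mulrC -modcM cE.
    apply: le_trans (ler_wpM2r _ (modcD _ _)) _; first by rewrite exprn_ge0// ltW.
    by rewrite mulrDl lerD2r.
  have B0 : 0 <= M / (modc al - s) by rewrite divr_ge0// ltW.
  elim: n => [|n IH]; apply: le_trans (cn _) _.
    rewrite /= modc0 mul0r addr0 ler_pM2l// lef_pV2 ?posrE//; lra.
  rewrite ler_pdivrMr// /= exprS mulrCA.
  have : s * (modc (c n) * s ^+ n) <= s * (M / (modc al - s)) by rewrite ler_pM2l.
  have : M / (modc al - s) * (modc al - s) = M by rewrite divfK// gt_eqF.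
  lra.
split; first exact: gc.
move=> z zr; have [l lP] := cvg_geom gc zr.
have zal : al - z != 0.
  by apply/eqP => /subr0_eq alz; move: zr; rewrite -alz ltNge ral.
suff -> : f z / (al - z) = l by [].
apply: (mulIf zal); rewrite divfK//.
apply: (@cvgC_unique _ nat \oo _ (fun N => psum a z N.+1)).
  exact/cvg_succ/fa.
have -> : (fun N => psum a z N.+1) = (fun N => al * psum c z N.+1 - z * psum c z N).
  apply/funext => N; rewrite -psum_shift /psum big_distrr -sumrB.
  by apply: eq_bigr => n _ /=; rewrite mulrA cE mulrDl addrK.
have -> : l * (al - z) = al * l - z * l by ring.
apply: cvgB; apply: cvgMr => //.
exact/(cvg_succ (psum c z)).
Qed.

Fixpoint divc (al : C) a n : C :=
  (a n + (if n is m.+1 then divc al a m else 0)) / al.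

Lemma divcE al a n : al != 0 -> al * divc al a n = a n + shiftc (divc al a) n.
Proof. by move=> al0; case: n => [|n] /=; rewrite mulrC divfK. Qed.

Lemma modc_lim_le (u : nat -> C) l (B : R) :
  (forall n, modc (u n) <= B) -> u @ \oo --> l -> modc l <= B.
Proof.
move=> uB /cvg_seqP ul; apply/ler_addgt0Pl => e e0.
have [N /(_ N (leqnn N)) NP] := ul e e0.
have := modc_dist l (u N); rewrite modc_sub; have := uB N; lra.
Qed.

(** The remainder is at most n^2 s^(n-2) |h|^2; multiplying by s^2 avoids the exponent n - 2, which
    may be negative. *)
Lemma exprD_taylor (z h : C) (s : R) n : 0 < s -> modc z <= s -> modc (z + h) <= s ->
  modc ((z + h) ^+ n - z ^+ n - n%:R * z ^+ n.-1 * h) * s ^+ 2 <=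
    (n%:R * n%:R * s ^+ n) * modc h ^+ 2.
Proof.
move=> s0 zs zhs; elim: n => [|n IH].
  by rewrite !expr0 subrr !mul0r subrr modc0 mul0r.
have -> : (z + h) ^+ n.+1 - z ^+ n.+1 - n.+1%:R * z ^+ n.+1.-1 * h =
    (z + h) * ((z + h) ^+ n - z ^+ n - n%:R * z ^+ n.-1 * h) +
    n%:R * z ^+ n.-1 * h ^+ 2.
  case: n {IH} => [|n]; first by rewrite /= !expr1 !expr0; ring.
  by rewrite /= !exprS -!natr1; ring.
apply: le_trans (ler_wpM2r _ (modcD _ _)) _; first by rewrite exprn_ge0// ltW.
rewrite !modcM !modcX modc_nat mulrDl.
have h0 : 0 <= modc h ^+ 2 by rewrite exprn_ge0// modc_ge0.
have t1 : modc (z + h) * (modc ((z + h) ^+ n - z ^+ n - n%:R * z ^+ n.-1 * h) * s ^+ 2)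
    <= s * (n%:R * n%:R * s ^+ n * modc h ^+ 2).
  by rewrite ler_pM ?modc_ge0// mulr_ge0 ?modc_ge0// exprn_ge0// ltW.
have t2 : n%:R * modc z ^+ n.-1 * modc h ^+ 2 * s ^+ 2 <=
    n%:R * (s ^+ n.+1 * modc h ^+ 2).
  case: n {IH t1} => [|n]; first by rewrite !mul0r.
  have zn : modc z ^+ n <= s ^+ n by rewrite lerXn2r ?nnegrE ?modc_ge0// ltW.
  have -> : n.+1%:R * (s ^+ n.+2 * modc h ^+ 2) =
      n.+1%:R * s ^+ n * modc h ^+ 2 * s ^+ 2 by rewrite !exprS; ring.
  do 2!(rewrite ler_wpM2r ?exprn_ge0 ?modc_ge0 ?(ltW s0)//).
  by rewrite ler_wpM2l.
rewrite mulrA in t1; apply: le_trans (lerD t1 t2) _.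
have -> : s * (n%:R * n%:R * s ^+ n * modc h ^+ 2) + n%:R * (s ^+ n.+1 * modc h ^+ 2)
   = (n%:R * n%:R + n%:R) * (s ^+ n.+1 * modc h ^+ 2) by rewrite [s ^+ n.+1]exprS; ring.
rewrite -[leRHS]mulrA ler_wpM2r ?mulr_ge0 ?exprn_ge0 ?(ltW s0) ?modc_ge0//.
by rewrite -natr1; have : 0 <= n%:R :> R by []; lra.
Qed.

Definition derc a n : C := n.+1%:R * a n.+1.

Lemma geom_derc r a : geom r a -> geom r (derc a).
Proof. by move=> /geom_natmul/geom_drop. Qed.

Lemma pseries_derive r a f g : pseries r a f -> pseries r (derc a) g ->
  forall z, modc z < r -> is_cderive z f (g z).
Proof.
move=> [ga fa] [gb fb] z zr.
(* The disc of radius s contains z and z + h; the larger radius t leaves a ratio s / t below 1 that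
   absorbs the factors n. *)
pose s := (modc z + r) / 2; pose t := (s + r) / 2.
have z0 := modc_ge0 z; have zs : modc z < s by rewrite /s; lra.
have s0 : 0 < s by lra.
have sr : s < r by rewrite /s; lra.
have t_r : 0 < t < r by rewrite /t; apply/andP; split; lra.
have t0 : 0 < t by case/andP: t_r.
have [M M0 MP] := geom_ge0 t_r (geom_natmul (geom_natmul ga)).
have q01 : 0 <= s / t < 1.
  by rewrite divr_ge0 ?(ltW s0) ?(ltW t0)//= ltr_pdivrMr// mul1r /t; lra.
(* M bounds n^2 |a_n| t^n, the geometric series in s / t sums the remainders, and s^2 comes from
   [exprD_taylor]. *)
pose K := M * (1 - s / t)^-1 / s ^+ 2.
have K0 : 0 < K.
  by rewrite !divr_gt0 ?exprn_gt0// subr_gt0; case/andP: q01.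
move=> e e0; exists (Num.min (s - modc z) (e / K)).
  by rewrite lt_min subr_gt0 zs divr_gt0.
move=> h; rewrite lt_min => /andP[hs he].
have zhs : modc (z + h) <= s by have := modcD z h; lra.
apply: (@le_trans _ _ (K * modc h ^+ 2)); last first.
  rewrite expr2 mulrA ler_wpM2r ?modc_ge0// mulrC -ler_pdivlMr//; exact: ltW.
pose u N := psum a (z + h) N.+1 - psum a z N.+1 - psum (derc a) z N * h.
apply: (@modc_lim_le u); last first.
  apply: cvgB.
    apply: cvgB; last exact/(cvg_succ (psum a z))/fa.
    apply/(cvg_succ (psum a (z + h)))/fa; exact: le_lt_trans zhs sr.
  by apply: cvgMl; exact: fb.
move=> N; have -> : u N = \sum_(n < N.+1)
    a n * ((z + h) ^+ n - z ^+ n - n%:R * z ^+ n.-1 * h).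
  rewrite /u [psum (derc a) _ _ * _]big_distrl /=.
  have -> : \sum_(i < N) derc a i * z ^+ i * h =
      \sum_(n < N.+1) n%:R * a n * z ^+ n.-1 * h.
    by rewrite big_ord_recl /= !mul0r add0r.
  by rewrite -!sumrB; apply: eq_bigr => n _; ring.
apply: le_trans (modc_sum _ _ _) _.
rewrite -(ler_pM2r (exprn_gt0 2 s0)) big_distrl /=.
apply: (@le_trans _ _ (\sum_(n < N.+1) M * modc h ^+ 2 * (s / t) ^+ n)).
  apply: ler_sum => n _; rewrite modcM -[leLHS]mulrA.
  apply: le_trans (ler_wpM2l (modc_ge0 _) (exprD_taylor n s0 (ltW zs) zhs)) _.
  have -> : M * modc h ^+ 2 * (s / t) ^+ n = M * (s / t) ^+ n * modc h ^+ 2 by ring.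
  rewrite mulrA ler_wpM2r ?exprn_ge0 ?modc_ge0//.
  have := MP n; rewrite !modcM modc_nat => /(ler_wpM2r (exprn_ge0 n (ltW (divr_gt0 s0 t0)))).
  apply: le_trans; rewrite [(s / t) ^+ n]expr_div_n.
  have -> : n%:R * (n%:R * modc (a n)) * t ^+ n * (s ^+ n / t ^+ n) =
     modc (a n) * (n%:R * n%:R * s ^+ n) * (t ^+ n / t ^+ n) by ring.
  by rewrite divff ?mulr1// expf_neq0// gt_eqF.
rewrite -big_distrr /=.
have -> : K * modc h ^+ 2 * s ^+ 2 = M * modc h ^+ 2 * (1 - s / t)^-1.
  rewrite /K; have := lt0r_neq0 (exprn_gt0 2 s0).
  by move: (s ^+ 2) (modc h ^+ 2) (1 - s / t)^-1 => x y v x0; field.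
rewrite ler_wpM2l ?mulr_ge0 ?exprn_ge0 ?modc_ge0 ?(ltW M0)//.
exact: sum_geometric_le.
Qed.

Definition primc a n : C := shiftc a n / n%:R.

Lemma derc_primc a : derc (primc a) = a.
Proof. by apply/funext => n; rewrite /derc /primc /= mulrC divfK// pnatr_eq0. Qed.

Lemma geom_primc r a : geom r a -> geom r (primc a).
Proof.
move=> /geom_shift ga s s_r; have [M M0 MP] := geom_ge0 s_r ga; exists M => n.
apply: le_trans (MP n); have s0 : 0 < s by case/andP: s_r.
apply: ler_wpM2r; first by rewrite exprn_ge0// ltW.
rewrite modcM modcV modc_nat ler_piMr ?modc_ge0//.
by case: n => [|n]; rewrite ?invr0// invf_le1// ler1n.
Qed.

Lemma pseries_prim r a f : 0 < r -> pseries r a f -> exists g,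
  [/\ pseries r (primc a) g, g 0 = 0 & forall z, modc z < r -> is_cderive z g (f z)].
Proof.
move=> r0 fa; have [g gP] := pseries_ex (geom_primc fa.1).
exists g; split=> //; first by rewrite (pseries0 r0 gP) /primc mul0r.
by apply: pseries_derive gP _; rewrite derc_primc.
Qed.

Lemma pseries_cont0 r a f : 0 < r -> pseries r a f -> f @ (0 : C) --> f 0.
Proof.
move=> r0 fa; have [g gP] := pseries_ex (geom_derc fa.1).
apply: is_cderive_cont (pseries_derive fa gP _); by rewrite modc0.
Qed.

Lemma pseries_drop r a f : 0 < r -> pseries r a f -> a 0%N = 0 ->
  exists2 g, pseries r (fun n => a n.+1) g & forall z, modc z < r -> f z = z * g z.
Proof.
move=> r0 fa a0; have [g gP] := pseries_ex (geom_drop fa.1); exists g => // z zr.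
apply: (pseries_uniq fa _ zr (g := fun z => z * g z)).
suff -> : a = shiftc (fun n => a n.+1) by exact: pseries_mulz.
by apply/funext => -[|n].
Qed.

(** The identity theorem at the centre: continuity kills the constant term, and after division by z
    the same zeros remain. *)
Lemma pseries_zeros r a f : 0 < r -> pseries r a f ->
  (forall e, 0 < e -> exists2 z, 0 < modc z < e & f z = 0) -> forall n, a n = 0.
Proof.
move=> r0 fa fz n; elim: n a f fa fz => [|n IH] a f fa fz.
  rewrite -(pseries0 r0 fa); apply/eqP; rewrite -modc_eq0 eq_le modc_ge0 andbT.
  apply/ler_addgt0Pl => e e0; rewrite addr0.
  have /(cvg_modcP (nbhs_filter (0 : C)))/(_ e e0)/nbhs_modcP[d d0 dP] :=
    pseries_cont0 r0 fa.
  have [z /andP[z0 zd] fz0] := fz d d0.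
  have := dP z; rewrite subr0 fz0 sub0r modcN => /(_ zd); exact: ltW.
have a0 : a 0%N = 0.
  rewrite -(pseries0 r0 fa); apply/eqP; rewrite -modc_eq0 eq_le modc_ge0 andbT.
  apply/ler_addgt0Pl => e e0; rewrite addr0.
  have /(cvg_modcP (nbhs_filter (0 : C)))/(_ e e0)/nbhs_modcP[d d0 dP] :=
    pseries_cont0 r0 fa.
  have [z /andP[z0 zd] fz0] := fz d d0.
  have := dP z; rewrite subr0 fz0 sub0r modcN => /(_ zd); exact: ltW.
have [g gP fg] := pseries_drop r0 fa a0.
apply: (IH _ g gP) => e e0.
have [|z /andP[z0 ze] fz0] := fz (Num.min e r); first by rewrite lt_min e0.
move: ze; rewrite lt_min => /andP[ze zr]; exists z; first by rewrite z0.
move: fz0; rewrite fg// => /eqP; rewrite mulf_eq0 -modc_eq0 gt_eqF//= => /eqP.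
exact.
Qed.

(** [analytic_at] speaks of convergence only. The terms of the convergent series at r / 2 are
    bounded, and this bound is the growth condition on the smaller disc. *)
Lemma psum_geom a (f : C -> C) r : 0 < r ->
  (forall z, modc z < r -> psum a z @ \oo --> f z) ->
  exists2 r', 0 < r' <= r & pseries r' a f.
Proof.
move=> r0 fa; exists (r / 2); first by rewrite divr_gt0//=; lra.
have r20 : 0 < r / 2 by rewrite divr_gt0.
split=> [s /andP[s0 sr]|z zr]; last by apply: fa; lra.
pose w : C := (r / 2)%:C.
have wE : modc w = r / 2 by rewrite modc_real gtr0_norm.
have /fa /cvg_psumP /(_ 1 ltr01) [N NP] : modc w < r by rewrite wE; lra.
have [M MP] : exists M, forall n, modc (a n * w ^+ n) <= M.
  apply: (@seq_bounded _ 2 N) => n Nn.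
  have -> : a n * w ^+ n = (psum a w n.+1 - f w) - (psum a w n - f w).
    by rewrite /psum big_ord_recr /=; ring.
  have := NP n Nn; have := NP n.+1 (leqW Nn).
  by have := modcB (psum a w n.+1 - f w) (psum a w n - f w); lra.
exists M => n; apply: le_trans (MP n); rewrite modcM modcX wE.
by rewrite ler_wpM2l ?modc_ge0// lerXn2r ?nnegrE ?(ltW s0) ?(ltW r20)// ltW.
Qed.

End PowerSeries.

(** * Shuffles of words and sums over them *)

Section Shuffles.
Implicit Types (u v w : word) (a b : bool).

Lemma shufflesw0 u : shuffles u [::] = [:: u].
Proof. by case: u. Qed.

Lemma shuffles_cons a u b v : shuffles (a :: u) (b :: v) =
  [seq a :: w | w <- shuffles u (b :: v)] ++ [seq b :: w | w <- shuffles (a :: u) v].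
Proof. by []. Qed.

Lemma shuffles1P a v w : w \in shuffles [:: a] v ->
  exists v1 v2, v = v1 ++ v2 /\ w = v1 ++ a :: v2.
Proof.
elim: v w => [|b v IH] w; first by rewrite inE => /eqP ->; exists [::], [::].
rewrite shuffles_cons mem_cat => /orP[|] /mapP [x xs ->].
  by move: xs; rewrite inE => /eqP ->; exists [::], (b :: v).
by have [v1 [v2 [-> ->]]] := IH x xs; exists (b :: v1), v2.
Qed.

Lemma size_shuffles u v w : w \in shuffles u v -> size w = (size u + size v)%N.
Proof.
elim: u v w => [|a u IHu] v w; first by rewrite inE => /eqP ->.
elim: v w => [|b v IHv] w; first by rewrite inE => /eqP ->; rewrite addn0.
rewrite shuffles_cons mem_cat => /orP[|] /mapP [x xs ->] /=.
  by rewrite (IHu _ _ xs).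
by rewrite (IHv _ xs) /= addnS.
Qed.

Lemma trailingP (w : word) : exists v n, h1_word v /\ w = v ++ nseq n lx.
Proof.
elim/last_ind: w => [|w a [v [n [hv ->]]]]; first by exists [::], 0%N.
case: a; first by exists (rcons (v ++ nseq n lx) ly), 0%N;
  rewrite cats0 /h1_word last_rcons.
exists v, n.+1; split=> //.
by rewrite rcons_cat -[in RHS]addn1 nseqD cats1.
Qed.

Section Sums.
Variable V : zmodType.
Implicit Types F G : word -> V.

(** The linear extension of [F] evaluated at the shuffle product of two words. The values may be
    numbers, polynomials or elements of the shuffle algebra itself. *)
Definition shsum F u v : V := \sum_(w <- shuffles u v) F w.

Lemma shsum0w F v : shsum F [::] v = F v.
Proof. by rewrite /shsum big_seq1. Qed.

Lemma shsumw0 F u : shsum F u [::] = F u.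
Proof. by rewrite /shsum shufflesw0 big_seq1. Qed.

Lemma shsum_cons F a u b v : shsum F (a :: u) (b :: v) =
  shsum (F \o cons a) u (b :: v) + shsum (F \o cons b) (a :: u) v.
Proof. by rewrite /shsum shuffles_cons big_cat !big_map. Qed.

Lemma shsum1_cons F a b v :
  shsum F [:: a] (b :: v) = F (a :: b :: v) + shsum (F \o cons b) [:: a] v.
Proof. by rewrite shsum_cons shsum0w. Qed.

Lemma shsumC F u v : shsum F u v = shsum F v u.
Proof.
elim: u v F => [|a u IHu] v F; first by rewrite shsum0w shsumw0.
elim: v F => [|b v IHv] F; first by rewrite shsum0w shsumw0.
by rewrite !shsum_cons IHu IHv addrC.
Qed.

Lemma shsumD F G u v :
  shsum (fun x => F x + G x) u v = shsum F u v + shsum G u v.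
Proof. exact: big_split. Qed.

Lemma eq_shsum F G u v : F =1 G -> shsum F u v = shsum G u v.
Proof. by move=> FG; apply: eq_bigr => x _; apply: FG. Qed.

(** Removing the first letter [a] replaces [F] by [F \o cons a], so [F] has to vary in the triple
    induction. *)
Lemma shsumA F u v w : shsum (fun x => shsum F x w) u v =
  shsum (shsum F u) v w.
Proof.
elim: u v w F => [|a u IHu] v w F.
  by rewrite shsum0w; apply: eq_shsum => x; rewrite shsum0w.
elim: v w F => [|b v IHv] w F; first by rewrite shsumw0 shsum0w.
elim: w F => [|c w IHw] F.
  by rewrite shsumw0; apply: eq_shsum => x; rewrite shsumw0.
pose Fa := F \o cons a; pose Fb := F \o cons b; pose Fc := F \o cons c.
have l1 x : shsum F (a :: x) (c :: w) = shsum Fa x (c :: w) + shsum Fc (a :: x) w.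
  exact: shsum_cons.
have l2 x : shsum F (b :: x) (c :: w) = shsum Fb x (c :: w) + shsum Fc (b :: x) w.
  exact: shsum_cons.
have r1 x : shsum F (a :: u) (b :: x) = shsum Fa u (b :: x) + shsum Fb (a :: u) x.
  exact: shsum_cons.
have r2 x : shsum F (a :: u) (c :: x) = shsum Fa u (c :: x) + shsum Fc (a :: u) x.
  exact: shsum_cons.
rewrite [LHS]shsum_cons [RHS]shsum_cons /comp.
rewrite (eq_shsum _ _ l1) (eq_shsum _ _ l2) (eq_shsum _ _ r1) (eq_shsum _ _ r2).
rewrite !shsumD (IHu (b :: v) (c :: w)) (IHv (c :: w)).
have -> : shsum (shsum Fa u) (b :: v) (c :: w) =
    shsum (fun x => shsum Fa u (b :: x)) v (c :: w) +
    shsum (fun x => shsum Fa u (c :: x)) (b :: v) w by exact: shsum_cons.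
have := IHw Fc; rewrite shsum_cons /comp => <-.
rewrite -!addrA; congr (_ + _); rewrite [RHS]addrCA; congr (_ + _).
by rewrite addrCA.
Qed.

(** The inserted letter falls on one side of [b] or on the other. *)
Lemma shsum1_cat F a p b q : shsum F [:: a] (p ++ b :: q) =
  shsum (fun w => F (w ++ b :: q)) [:: a] p +
  shsum (fun w => F (p ++ b :: w)) [:: a] q.
Proof.
elim: p F => [|c p IH] F; first by rewrite /= shsumw0 shsum1_cons.
by rewrite /= !shsum1_cons IH addrA.
Qed.

Lemma shsum1_nseq F a n :
  shsum F [:: a] (nseq n a) = F (nseq n.+1 a) *+ n.+1.
Proof.
elim: n F => [|n IH] F; first by rewrite shsumw0.
by rewrite /= shsum1_cons IH -mulrS.
Qed.

End Sums.
End Shuffles.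

(** * Functionals that are multiplicative for the shuffle product *)

Section ShuffleCharacter.
Variable K : numFieldType.
Implicit Types F G : word -> K.

(** Uniqueness of the extension from h^1 to h = h^1[x]: the shuffle of x with v y x^n is n + 1 times
    v y x^(n+1) plus words with only n trailing x, so the values follow by induction on n. *)
Lemma trailing_ext F G :
  (forall w, shsum F [:: lx] w = F [:: lx] * F w) ->
  (forall w, shsum G [:: lx] w = G [:: lx] * G w) ->
  F [:: lx] = G [:: lx] -> (forall w, h1_word w -> F w = G w) ->
  forall w, F w = G w.
Proof.
move=> FM GM FGx FG w; have [v [n [hv ->]]] := trailingP w.
elim: n v hv => [|n IH] v hv {w}; first by rewrite cats0 FG.
have n0 : (n.+1%:R : K) != 0 by rewrite pnatr_eq0.
apply: (mulIf n0); rewrite !mulr_natr.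
case/lastP: v hv => [_|v b].
  by rewrite /= -!(@shsum1_nseq K) FM GM FGx -[nseq n lx]/([::] ++ nseq n lx) IH.
rewrite /h1_word last_rcons => /eqP -> {b}; rewrite !cat_rcons.
have key (H : word -> K) : H (v ++ ly :: nseq n.+1 lx) *+ n.+1 =
    shsum H [:: lx] (v ++ ly :: nseq n lx) -
    shsum (fun w => H (rcons w ly ++ nseq n lx)) [:: lx] v.
  rewrite shsum1_cat (@shsum1_nseq K (fun w => H (v ++ ly :: w))).
  have -> : shsum (fun w => H (rcons w ly ++ nseq n lx)) [:: lx] v =
      shsum (fun w => H (w ++ ly :: nseq n lx)) [:: lx] v.
    by apply: eq_shsum => x; rewrite cat_rcons.
  by rewrite [X in X - _]addrC addrK.
rewrite !key FM GM FGx -cat_rcons IH; last by rewrite /h1_word last_rcons.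
congr (_ - _); apply: eq_bigr => x _.
by apply: IH; rewrite /h1_word last_rcons.
Qed.

Lemma character_nseq F a n : (forall u v, shsum F u v = F u * F v) -> F [::] = 1 ->
  F (nseq n a) = F [:: a] ^+ n / n`!%:R.
Proof.
move=> FM F1; elim: n => [|n IH]; first by rewrite expr0 divr1.
have n0 : (n.+1%:R : K) != 0 by rewrite pnatr_eq0.
have f0 : (n`!%:R : K) != 0 by rewrite pnatr_eq0 -lt0n fact_gt0.
apply: (mulIf n0); rewrite [LHS]mulr_natr -(@shsum1_nseq K) FM IH factS natrM exprS.
by move: (F _ ^+ n) (n.+1%:R : K) (n`!%:R : K) n0 f0 => x y t y0 t0; field; rewrite ?y0 ?t0.
Qed.

End ShuffleCharacter.

(** * Linear extension from a basis *)

Section LinearMaps.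
Variables (K : nzRingType) (U M : lmodType K) (f : U -> M).
Hypothesis lf : linear f.

Lemma linear_mapD u v : f (u + v) = f u + f v.
Proof. by rewrite -[u]scale1r lf !scale1r. Qed.

Lemma linear_map0 : f 0 = 0.
Proof. by apply: (addrI (f 0)); rewrite -linear_mapD !addr0. Qed.

Lemma linear_mapZ c u : f (c *: u) = c *: f u.
Proof. by rewrite -[c *: u]addr0 lf linear_map0 addr0. Qed.

Lemma linear_map_sum I (r : seq I) (P : pred I) (F : I -> U) :
  f (\sum_(i <- r | P i) F i) = \sum_(i <- r | P i) f (F i).
Proof. exact: (big_morph f linear_mapD linear_map0). Qed.

End LinearMaps.

Section FreeModule.
Variables (K : nzRingType) (A : choiceType) (M : lmodType K).

Lemma fglift_is_linear (f : A -> M) : linear (fglift f).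
Proof.
have B (p q : {freeg A / K}) : fglift f (p - q) = fglift f p - fglift f q.
  exact: lift_is_additive.
have Z : fglift f 0 = 0 by rewrite -(subrr 0) B subrr.
have D (p q : {freeg A / K}) : fglift f (p + q) = fglift f p + fglift f q.
  by rewrite -{1}[q]opprK B -[- q]sub0r B Z sub0r opprK.
have sumE I (r : seq I) (F : I -> {freeg A / K}) :
    fglift f (\sum_(i <- r) F i) = \sum_(i <- r) fglift f (F i).
  exact: (big_morph _ D Z).
have scaleE c p : fglift f (c *: p) = c *: fglift f p.
  have pE : fglift f p = \sum_(z <- dom p) coeff z p *: f z.
    rewrite -{1}(freeg_sumE p) sumE.
    by apply: eq_bigr => z _; rewrite liftU.
  rewrite pE scaler_sumr [c *: p]/(fgscale c p) /fgscale sumE.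
  by apply: eq_bigr => z _; rewrite liftU scalerA.
by move=> c p q; rewrite D scaleE.
Qed.

Lemma freegZU (c : K) (a : A) : c *: << a >> = << c *g a >> :> {freeg A / K}.
Proof. by apply/eqP/freeg_eqP => b; rewrite coeffZ !coeffU mul1r. Qed.

Lemma freeg_basis (p : {freeg A / K}) :
  p = \sum_(a <- dom p) coeff a p *: << a >>.
Proof.
by rewrite -{1}(freeg_sumE p); apply: eq_bigr => a _; rewrite freegZU.
Qed.

Lemma fglift1 (f : A -> M) a : fglift f << a >> = f a.
Proof. by rewrite liftU scale1r. Qed.

Lemma linear_freeg (f : {freeg A / K} -> M) : linear f ->
  forall p, f p = \sum_(a <- dom p) coeff a p *: f << a >>.
Proof.
move=> lf p; rewrite {1}(freeg_basis p) (linear_map_sum lf).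
by apply: eq_bigr => a _; rewrite (linear_mapZ lf).
Qed.

Lemma linear_freeg_ext (f g : {freeg A / K} -> M) : linear f -> linear g ->
  (forall a, f << a >> = g << a >>) -> f =1 g.
Proof.
move=> lf lg fg p; rewrite (linear_freeg lf) (linear_freeg lg).
by apply: eq_bigr => a _; rewrite fg.
Qed.

End FreeModule.

(** * The shuffle algebra and the decomposition over h^0[x, y] *)

Section ShuffleAlgebra.
Variable R : realType.
Notation C := CC[R].
Notation h := (hspace R).
Implicit Types (p q r c : h) (u v w : word).

Lemma shuffleUl u q :
  shuffle << u >> q = fglift (fun v => \sum_(w <- shuffles u v) << w >>) q.
Proof. by rewrite /shuffle fglift1. Qed.

Lemma shuffleU u v : shuffle << u >> << v >> = shsum (fun w => << w >> : h) u v.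
Proof. by rewrite shuffleUl fglift1. Qed.

Lemma shuffle_linearl q : linear (fun p => shuffle p q).
Proof. by move=> a p p'; rewrite /shuffle fglift_is_linear. Qed.

Lemma shuffle_linearr p : linear (shuffle p).
Proof.
move=> a q q'; pose f c : h := shuffle c (a *: q + q').
pose g c : h := a *: shuffle c q + shuffle c q'.
rewrite -[LHS]/(f p) -[RHS]/(g p); apply: linear_freeg_ext.
- exact: shuffle_linearl.
- move=> b c c'; rewrite /g !(shuffle_linearl _ b c c') !scalerDr !scalerA.
  by rewrite [a * b]mulrC addrACA.
- by move=> u; rewrite /f /g !shuffleUl fglift_is_linear.
Qed.

Lemma shuffle_sumr (I : Type) (r : seq I) p (F : I -> h) :
  shuffle p (\sum_(i <- r) F i) = \sum_(i <- r) shuffle p (F i).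
Proof. exact: (linear_map_sum (shuffle_linearr p)). Qed.

Lemma shuffle_suml (I : Type) (r : seq I) q (F : I -> h) :
  shuffle (\sum_(i <- r) F i) q = \sum_(i <- r) shuffle (F i) q.
Proof. exact: (linear_map_sum (shuffle_linearl q)). Qed.

Lemma shuffleC p q : shuffle p q = shuffle q p.
Proof.
move: p; apply: linear_freeg_ext; [exact: shuffle_linearl|exact: shuffle_linearr|].
move=> u; move: q; apply: linear_freeg_ext;
  [exact: shuffle_linearr|exact: shuffle_linearl|].
by move=> v; rewrite !shuffleU shsumC.
Qed.

Lemma shuffleA p q r : shuffle p (shuffle q r) = shuffle (shuffle p q) r.
Proof.
move: p; apply: linear_freeg_ext; first exact: shuffle_linearl.
  by move=> a p p'; rewrite !(shuffle_linearl, shuffle_linearr).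
move=> u; move: q; apply: linear_freeg_ext.
- by move=> a q q'; rewrite !(shuffle_linearl, shuffle_linearr).
- by move=> a q q'; rewrite !(shuffle_linearl, shuffle_linearr).
move=> v; move: r; apply: linear_freeg_ext.
- by move=> a r r'; rewrite !shuffle_linearr.
- by move=> a r r'; rewrite !shuffle_linearr.
move=> w; rewrite !shuffleU shuffle_sumr shuffle_suml.
under eq_bigr do rewrite shuffleU.
by under [RHS]eq_bigr do rewrite shuffleU; rewrite -[LHS]/(shsum _ _ _) -shsumA.
Qed.

Lemma shuffle1p p : shuffle << [::] >> p = p.
Proof.
move: p; apply: linear_freeg_ext => [|//|u]; first exact: shuffle_linearr.
by rewrite shuffleU shsum0w.
Qed.

Lemma h0D p q : h0 p -> h0 q -> h0 (p + q).
Proof.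
move=> /allP hp /allP hq; apply/allP => w /domD_subset.
by rewrite mem_cat => /orP[/hp|/hq].
Qed.

Lemma h00 : h0 (0 : h).
Proof. by rewrite /h0 /= dom0. Qed.

Lemma h0Z (a : C) p : h0 p -> h0 (a *: p).
Proof. by move=> /allP hp; apply/allP => w /domZ_subset /hp. Qed.

Lemma h0U w : h0_word w -> h0 (<< w >> : h).
Proof. by move=> w0; rewrite /h0 /= domU1 /= w0. Qed.

Definition reg_term (t : h * nat * nat) : h :=
  shuffle t.1.1 (shuffle (shuffle_exp << [:: lx] >> t.1.2)
                         (shuffle_exp << [:: ly] >> t.2)).

(** A list of monomials instead of the doubly indexed family of [reg]: sums become concatenations,
    and shuffling with x or y raises one exponent. [reg_exists] regroups the list. *)
Definition regular p := exists2 s : seq (h * nat * nat),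
  forall t, t \in s -> h0 t.1.1 & p = \sum_(t <- s) reg_term t.

Lemma regularD p q : regular p -> regular q -> regular (p + q).
Proof.
move=> [s s0 ->] [t t0 ->]; exists (s ++ t); last by rewrite big_cat.
by move=> x; rewrite mem_cat => /orP[/s0|/t0].
Qed.

Lemma regular_map p (f : h -> h) (g : h * nat * nat -> h * nat * nat) :
  linear f -> (forall t, h0 t.1.1 -> h0 (g t).1.1) ->
  (forall t, f (reg_term t) = reg_term (g t)) -> regular p -> regular (f p).
Proof.
move=> lf gh fg [s s0 ->]; exists (map g s).
  by move=> _ /mapP [t /s0 t0 ->]; exact: gh.
by rewrite (linear_map_sum lf) big_map; apply: eq_bigr => t _; rewrite fg.
Qed.

Lemma regularZ (a : C) p : regular p -> regular (a *: p).
Proof.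
apply: (@regular_map p (fun q => a *: q) (fun t => (a *: t.1.1, t.1.2, t.2))).
- by move=> b q q'; rewrite scalerDr !scalerA mulrC.
- by move=> t /=; exact: h0Z.
- by move=> t; rewrite /reg_term /= (linear_mapZ (shuffle_linearl _)).
Qed.

Lemma regular_shx p : regular p -> regular (shuffle << [:: lx] >> p).
Proof.
apply: (@regular_map p _ (fun t => (t.1.1, t.1.2.+1, t.2))) => //.
  exact: shuffle_linearr.
move=> t; rewrite /reg_term /= [RHS]shuffleC.
by rewrite [shuffle t.1.1 _]shuffleC -!shuffleA.
Qed.

Lemma regular_shy p : regular p -> regular (shuffle << [:: ly] >> p).
Proof.
apply: (@regular_map p _ (fun t => (t.1.1, t.1.2, t.2.+1))) => //.
  exact: shuffle_linearr.
move=> t; rewrite /reg_term /=.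
rewrite shuffleC -shuffleA; congr (shuffle _ _).
by rewrite -shuffleA; congr (shuffle _ _); rewrite shuffleC.
Qed.

Lemma regular_sum (I : eqType) (r : seq I) (F : I -> h) :
  (forall i, i \in r -> regular (F i)) -> regular (\sum_(i <- r) F i).
Proof.
move=> rF; rewrite big_seq; apply: big_ind => //; last exact: regularD.
by exists [::]; rewrite ?big_nil.
Qed.

Lemma regularN p : regular p -> regular (- p).
Proof. by rewrite -scaleN1r; exact: regularZ. Qed.

Lemma regular_h0 w : h0_word w -> regular << w >>.
Proof.
move=> w0; exists [:: (<< w >>, 0%N, 0%N)].
  by move=> t; rewrite inE => /eqP -> /=; exact: h0U.
by rewrite big_seq1 /reg_term /= /shuffle_exp /= shuffle1p shuffleC shuffle1p.
Qed.

Lemma regular_muln p n : regular (p *+ n.+1) -> regular p.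
Proof.
move=> rp; have n0 : (n.+1%:R : C) != 0 by rewrite pnatr_eq0.
rewrite -[p]scale1r -(mulVf n0) -scalerA scaler_nat; exact: regularZ.
Qed.

Lemma regular_h1 w : (forall u, (size u < size w)%N -> regular << u >>) ->
  h1_word w -> regular << w >>.
Proof.
move=> IHs hw; have [m [v [wE hv]]] : exists m v, w = nseq m ly ++ v /\ head lx v = lx.
  elim: (w) => [|[] u [m [v [-> hv]]]]; first by exists 0%N, [::].
    by exists m.+1, v.
  by exists 0%N, (lx :: nseq m ly ++ v).
elim: m w v wE hv IHs hw => [|m IH] w v wE hv IHs hw.
  by rewrite wE in hw *; apply: regular_h0; rewrite /h0_word hv hw.
case: v hv wE => [_ wE|b v bE wE].
  rewrite cats0 in wE; apply: (@regular_muln _ m).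
  rewrite wE -(@shsum1_nseq h (fun w => << w >>)) -shuffleU; apply: regular_shy.
  by apply: IHs; rewrite wE !size_nseq.
rewrite /= in bE; rewrite {}bE in wE; apply: (@regular_muln _ m).
have := @shsum1_cat h (fun w => << w >>) ly (nseq m ly) lx v.
rewrite (@shsum1_nseq h (fun w => << w ++ lx :: v >>)) -wE => /eqP.
rewrite -subr_eq -shuffleU => /eqP <-; apply: regularD.
  apply: regular_shy; apply: IHs.
  by rewrite wE !size_cat !size_nseq.
apply/regularN/regular_sum => x xs; apply: (IH _ (lx :: x)) => //.
  move=> u; rewrite size_cat /= (size_shuffles xs) => uw; apply: IHs.
  by rewrite wE size_cat /= size_nseq; move: uw; rewrite size_nseq /=; lia.
move: hw; rewrite wE /h1_word !last_cat /=.
(* Wherever the inserted y lands, the word still ends in y: it is itself the last letter, or the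
   last letter is that of [w]. *)
have [v1 [v2 [-> ->]]] := shuffles1P xs.
by rewrite !last_cat /=; case: v2 {xs} => [|? ?].
Qed.

(* Shuffling x with v y x^n gives n + 1 times v y x^(n+1), plus words ending with
   y x^n; y is treated likewise at the other end, in [regular_h1]. *)
Lemma regular_word w : regular << w >>.
Proof.
move: {2}(size w).+1 (ltnSn (size w)) => k; elim: k w => // k IHk w.
rewrite ltnS => wk; have [v [n [hv wE]]] := trailingP w.
elim: n w v wE hv wk => [|n IH] w v wE hv wk.
  rewrite cats0 in wE; rewrite wE in wk *; apply: regular_h1 => // u uv.
  by apply: IHk; apply: leq_trans uv wk.
apply: (@regular_muln _ n); case/lastP: v hv wE => [_ wE|v b].
  rewrite wE /= -(@shsum1_nseq h (fun w => << w >>)) -shuffleU; apply: regular_shx.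
  by apply: IHk; rewrite size_nseq; move: wk; rewrite wE size_nseq.
rewrite /h1_word last_rcons => /eqP -> {b} wE; rewrite cat_rcons in wE.
have := @shsum1_cat h (fun w => << w >>) lx v ly (nseq n lx).
rewrite (@shsum1_nseq h (fun w => << v ++ ly :: w >>)) -wE addrC => /eqP.
rewrite -subr_eq -shuffleU => /eqP <-; apply: regularD.
  apply: regular_shx; apply: IHk.
  by move: wk; rewrite wE !size_cat /= !size_nseq; lia.
apply/regularN/regular_sum => x xs.
apply: (IH _ (rcons x ly)); first by rewrite cat_rcons.
  by rewrite /h1_word last_rcons.
move: wk; rewrite wE !size_cat /= !size_nseq (size_shuffles xs) /=; lia.
Qed.

Lemma reg_exists w : exists (N : nat) (c : nat -> nat -> h),
  (forall a b, h0 (c a b)) /\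
  << w >> = \sum_(a < N.+1) \sum_(b < N.+1)
     shuffle (c a b) (shuffle (shuffle_exp << [:: lx] >> a)
                              (shuffle_exp << [:: ly] >> b)).
Proof.
have [s s0 ->] := regular_word w.
pose N := (\sum_(t <- s) (t.1.2 + t.2))%N.
have sN t : t \in s -> (t.1.2 < N.+1)%N && (t.2 < N.+1)%N.
  move=> ts; rewrite !ltnS /N (big_rem t)//=.
  apply/andP; split; first by rewrite -addnA leq_addr.
  by rewrite addnAC leq_addl.
exists N, (fun a b => \sum_(t <- s | (t.1.2 == a) && (t.2 == b)) t.1.1); split.
  move=> a b; rewrite big_seq_cond; apply: big_ind => //; [exact: h00|exact: h0D|].
  by move=> t /andP[/s0].
transitivity (\sum_(t <- s) \sum_(a < N.+1) \sum_(b < N.+1)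
   (if (t.1.2 == a) && (t.2 == b) then reg_term t else 0)).
  rewrite big_seq [RHS]big_seq; apply: eq_bigr => t /sN/andP[ta tb].
  rewrite (bigD1 (Ordinal ta))//= (bigD1 (Ordinal tb))//= !eqxx /=.
  rewrite !big1 ?addr0// => [a|b].
    by rewrite -val_eqE /= eq_sym => /negbTE -> ; rewrite big1.
  by rewrite -val_eqE /= eq_sym => /negbTE ->.
rewrite exchange_big; apply: eq_bigr => a _.
rewrite exchange_big; apply: eq_bigr => b _.
rewrite (linear_map_sum (shuffle_linearl _)) -big_mkcond.
by apply: eq_bigr => t /andP[/eqP <- /eqP <-].
Qed.

End ShuffleAlgebra.

(** * Substitution of series without constant term *)

Section Substitution.
Variables (R : realType) (A : eqType).
Notation C := CC[R].
Notation series := (ncseries C A).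
Implicit Types (f g h p q : series) (c d : ncseries C bool).

Fixpoint words n : seq word :=
  if n is m.+1 then [seq lx :: w | w <- words m] ++ [seq ly :: w | w <- words m]
  else [:: [::]].

Lemma mem_words n w : (w \in words n) = (size w == n).
Proof.
elim: n w => [|n IH] [|b w] //=; rewrite mem_cat.
  by apply/negbTE; rewrite negb_or; apply/andP; split; apply/negP => /mapP[].
case: b.
  rewrite mem_map ?IH; last by move=> ? ? [].
  by rewrite orb_idl // => /mapP[].
rewrite orbC mem_map ?IH; last by move=> ? ? [].
by rewrite orb_idl // => /mapP[].
Qed.

Lemma uniq_words n : uniq (words n).
Proof.
elim: n => //= n IH; rewrite cat_uniq !map_inj_uniq ?IH ?andbT /=; last 2 first.
- by move=> ? ? [].
- by move=> ? ? [].
by apply/hasPn => _ /mapP [w _ ->]; apply/negP => /mapP [].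
Qed.

Lemma sum_tuple_words (V : nmodType) n (F : word -> V) :
  \sum_(w : n.-tuple bool) F w = \sum_(w <- words n) F w.
Proof.
rewrite -(big_map (@tval n bool) xpredT F) /=; apply: perm_big.
apply: uniq_perm; first by rewrite map_inj_uniq ?index_enum_uniq//; exact: val_inj.
  exact: uniq_words.
move=> w; rewrite mem_words; apply/mapP/eqP => [[t _ ->]|sw].
  by rewrite size_tuple.
by have sw' : size w == n by [rewrite sw]; exists (Tuple sw'); rewrite ?mem_index_enum.
Qed.

Definition nilfree f := f [::] = 0.

Definition agree n f g := forall w, (size w < n)%N -> f w = g w.

Lemma nc_mul_nil f g : (f * g) [::] = f [::] * g [::].
Proof. by rewrite nc_mulE big_ord1. Qed.

Lemma nc_oneE w : (1 : series) w = (w == [::])%:R.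
Proof. by []. Qed.

(** A left factor without constant term gains one length. This contraction is what inductions on the
    order of agreement rest on. *)
Lemma agree_mul n f g h : nilfree f -> agree n g h -> agree n.+1 (f * g) (f * h).
Proof.
move=> f0 gh w; rewrite ltnS => wn; rewrite !nc_mulE !big_ord_recl.
rewrite !take0 f0 !mul0r; congr (_ + _); apply: eq_bigr => i _.
by rewrite gh// size_drop lift0; have := ltn_ord i; lia.
Qed.

Lemma agree_mull n f g h : agree n g h -> agree n (f * g) (f * h).
Proof.
move=> gh w wn; rewrite !nc_mulE; apply: eq_bigr => i _.
by rewrite gh// size_drop; lia.
Qed.

Definition nc_tail b c : ncseries C bool := fun w => c (b :: w).

Definition mon f g (w : word) : series := \prod_(b <- w) (if b then g else f).

Definition homp f g c n : series := \sum_(w <- words n) c w *: mon f g w.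

Lemma nc_sumE (I : Type) (r : seq I) (F : I -> series) w :
  (\sum_(i <- r) F i) w = \sum_(i <- r) F i w.
Proof. by elim: r => [|i r IH]; rewrite ?big_nil// !big_cons nc_addE IH. Qed.

Lemma nc_substE c f g v : nc_subst c f g v = \sum_(n < (size v).+1) homp f g c n v.
Proof.
apply: eq_bigr => n _; rewrite /homp nc_sumE.
exact: (sum_tuple_words n (fun w => c w * mon f g w v)).
Qed.

Lemma hompS f g c n : homp f g c n.+1 =
  f * homp f g (nc_tail lx c) n + g * homp f g (nc_tail ly c) n.
Proof.
rewrite /homp /= big_cat !big_map /= !big_distrr /=.
by congr (_ + _); apply: eq_bigr => w _; rewrite /mon big_cons scalerAr.
Qed.

Lemma homp0 f g c : homp f g c 0 = c [::] *: 1.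
Proof. by rewrite /homp /= big_seq1 /mon big_nil. Qed.

Lemma homp_agree0 f g c n : nilfree f -> nilfree g -> agree n (homp f g c n) 0.
Proof.
move=> f0 g0; elim: n c => [|n IH] c w wn //; rewrite hompS nc_addE.
have := agree_mul f0 (IH (nc_tail lx c)); have := agree_mul g0 (IH (nc_tail ly c)).
by rewrite !mulr0 => -> // -> //; rewrite addr0.
Qed.

Lemma nc_subst_trunc c f g v N : nilfree f -> nilfree g -> (size v < N)%N ->
  nc_subst c f g v = \sum_(n < N) homp f g c n v.
Proof.
move=> f0 g0 vN; rewrite nc_substE (big_ord_widen N (fun n => homp f g c n v) vN).
rewrite big_mkcond; apply: eq_bigr => n _; case: ifPn => //; rewrite -leqNgt => vn.
by rewrite (homp_agree0 c f0 g0).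
Qed.

(** The decomposition of [c] by first letter. It replaces the truncated sums of the definition by a
    recursion, and [subst_rec_uniq] makes it characteristic. *)
Lemma nc_subst_unfold c f g : nilfree f -> nilfree g ->
  nc_subst c f g = c [::] *: 1 + f * nc_subst (nc_tail lx c) f g +
                   g * nc_subst (nc_tail ly c) f g.
Proof.
move=> f0 g0; apply/funext => v.
have trunc d : agree (size v).+1 (nc_subst d f g) (\sum_(n < (size v).+1) homp f g d n).
  by move=> w wv; rewrite (nc_subst_trunc d f0 g0 wv) nc_sumE.
rewrite (@nc_subst_trunc _ _ _ _ (size v).+2)// big_ord_recl homp0 /=.
rewrite !nc_addE -addrA; congr (_ + _).
rewrite (agree_mul f0 (trunc (nc_tail lx c))) ?ltnS//.
rewrite (agree_mul g0 (trunc (nc_tail ly c))) ?ltnS//.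
rewrite !big_distrr !nc_sumE -big_split /=; apply: eq_bigr => n _.
by rewrite hompS nc_addE.
Qed.

Lemma nc_subst_nil c f g : nilfree f -> nilfree g -> nc_subst c f g [::] = c [::].
Proof.
by move=> f0 g0; rewrite nc_substE big_ord1 homp0 nc_scaleE nc_oneE mulr1.
Qed.

Lemma agree_add n f g f' g' : agree n f f' -> agree n g g' -> agree n (f + g) (f' + g').
Proof. by move=> ff gg w wn; rewrite !nc_addE ff// gg. Qed.

Lemma subst_rec_uniq (X Y : ncseries C bool -> series) f g :
  nilfree f -> nilfree g ->
  (forall c, X c = c [::] *: 1 + f * X (nc_tail lx c) + g * X (nc_tail ly c)) ->
  (forall c, Y c = c [::] *: 1 + f * Y (nc_tail lx c) + g * Y (nc_tail ly c)) ->
  forall c, X c = Y c.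
Proof.
move=> f0 g0 XE YE c; apply/funext => v.
suff : forall n c, agree n (X c) (Y c) by move=> /(_ (size v).+1 c v); apply.
elim=> [//|n IH] {}c; rewrite XE YE; apply: agree_add; last exact: agree_mul.
by apply: agree_add; [|exact: agree_mul].
Qed.

Lemma nc_subst_linear f g (a : C) c d : nilfree f -> nilfree g ->
  nc_subst (a *: c + d) f g = a *: nc_subst c f g + nc_subst d f g.
Proof.
move=> f0 g0; apply/funext => v; rewrite nc_addE nc_scaleE !nc_substE.
rewrite big_distrr -big_split; apply: eq_bigr => n _ /=.
rewrite /homp !nc_sumE big_distrr -big_split; apply: eq_bigr => w _ /=.
by rewrite !nc_scaleE nc_addE nc_scaleE mulrDl mulrA.
Qed.

Lemma nc_subst0 f g : nc_subst (0 : ncseries C bool) f g = 0.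
Proof.
apply/funext => v; rewrite nc_substE big1// => n _.
by rewrite /homp big1 ?nc_scaleE// => w _; rewrite scale0r.
Qed.

Lemma nc_substZ f g (a : C) c : nilfree f -> nilfree g ->
  nc_subst (a *: c) f g = a *: nc_subst c f g.
Proof.
by move=> f0 g0; rewrite -[a *: c]addr0 nc_subst_linear// nc_subst0 addr0.
Qed.

Lemma nc_substD f g c d : nilfree f -> nilfree g ->
  nc_subst (c + d) f g = nc_subst c f g + nc_subst d f g.
Proof. by move=> f0 g0; rewrite -[c]scale1r nc_subst_linear// !scale1r. Qed.

Lemma nc_subst1 f g : nilfree f -> nilfree g ->
  nc_subst (1 : ncseries C bool) f g = 1.
Proof.
move=> f0 g0; rewrite nc_subst_unfold//.
have s0 b : nc_tail b (1 : ncseries C bool) = (0 : C) *: (1 : ncseries C bool).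
  by apply/funext => w; rewrite nc_scaleE mul0r.
by rewrite !s0 !nc_substZ// !scale0r !mulr0 !addr0 [X in X *: _]/= scale1r.
Qed.

End Substitution.

(** * Products, composition and exponentials under substitution *)

Section SubstitutionMul.
Variables (R : realType) (A : eqType).
Notation C := CC[R].
Notation series := (ncseries C A).
Implicit Types (f g h p q : series) (c d : ncseries C bool).

Lemma nc_mul_cons c d b : nc_tail b (c * d) = c [::] *: (nc_tail b d) + (nc_tail b c) * d.
Proof.
apply/funext => w; rewrite nc_addE nc_scaleE [LHS]/nc_tail !nc_mulE big_ord_recl /=.
by congr (_ + _); apply: eq_bigr.
Qed.

Lemma nc_substM f g c d : nilfree f -> nilfree g ->
  nc_subst (c * d) f g = nc_subst c f g * nc_subst d f g.
Proof.
move=> f0 g0; apply/funext => v.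
suff : forall n c, agree n (nc_subst (c * d) f g) (nc_subst c f g * nc_subst d f g).
  by move=> /(_ (size v).+1 c v); apply.
elim=> [//|n IH] {}c.
have -> : nc_subst c f g * nc_subst d f g =
   (c [::] * d [::]) *: 1 + f * (c [::] *: nc_subst (nc_tail lx d) f g +
      nc_subst (nc_tail lx c) f g * nc_subst d f g) +
   g * (c [::] *: nc_subst (nc_tail ly d) f g +
      nc_subst (nc_tail ly c) f g * nc_subst d f g).
  rewrite {1}(nc_subst_unfold c f0 g0) !mulrDl -scalerAl mul1r.
  rewrite {1}(nc_subst_unfold d f0 g0) !scalerDr !mulrDr !scalerA !mulrA -!scalerAr.
  by rewrite -!addrA; congr (_ + (_ + _)); rewrite addrCA.
rewrite nc_subst_unfold// nc_mul_nil; apply: agree_add; last first.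
  apply: agree_mul => //; rewrite nc_mul_cons nc_subst_linear//.
  by apply: agree_add => //; exact: IH.
apply: agree_add => //; apply: agree_mul => //; rewrite nc_mul_cons nc_subst_linear//.
by apply: agree_add => //; exact: IH.
Qed.

Lemma nc_subst_comp f g c (p q : ncseries C bool) : nilfree f -> nilfree g ->
  nilfree p -> nilfree q ->
  nc_subst (nc_subst c p q) f g = nc_subst c (nc_subst p f g) (nc_subst q f g).
Proof.
move=> f0 g0 p0 q0; move: c.
apply: (@subst_rec_uniq R A _ _ (nc_subst p f g) (nc_subst q f g)).
- by rewrite /nilfree nc_subst_nil.
- by rewrite /nilfree nc_subst_nil.
- move=> c; rewrite {1}(nc_subst_unfold c p0 q0) !nc_substD// !nc_substM//.
  by rewrite nc_substZ// nc_subst1.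
- by move=> c; rewrite {1}nc_subst_unfold ///nilfree nc_subst_nil.
Qed.

(** The coefficients of exp(X + Y). At (0, h) this series becomes exp h, so statements about
    substitutions cover exponentials. *)
Definition inv_fact : ncseries C bool := fun w => (size w)`!%:R^-1.

Lemma homp_inv_fact h n : homp 0 h inv_fact n = (n`!%:R^-1 : C) *: h ^+ n.
Proof.
have hE k c : (forall w, size w = n -> c w = k) -> homp 0 h c n = k *: h ^+ n.
  elim: n c => [|m IH] c ck; first by rewrite homp0 ck// expr0.
  rewrite hompS mul0r add0r IH ?exprS ?scalerAr// => w wm /=.
  by rewrite /nc_tail ck //= wm.
by apply: hE => w <-.
Qed.

Lemma nc_exp_subst h : nilfree h -> nc_exp h = nc_subst inv_fact 0 h.
Proof.
move=> h0; apply/funext => v; rewrite nc_substE; apply: eq_bigr => n _.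
by rewrite homp_inv_fact.
Qed.

Lemma nc_exp_agree h n : nilfree h ->
  agree n (nc_exp h) (\sum_(m < n) (m`!%:R^-1 : C) *: h ^+ m).
Proof.
move=> h0 w wn; rewrite nc_exp_subst// (nc_subst_trunc _ _ h0 wn)// nc_sumE.
by apply: eq_bigr => m _; rewrite homp_inv_fact.
Qed.

End SubstitutionMul.

(** * Letters, their exponentials, and inverses *)

Section SubstitutionLetters.
Variables (R : realType) (A : eqType).
Notation C := CC[R].
Notation series := (ncseries C A).
Implicit Types (f g h p q : series) (c d : ncseries C bool).

Lemma nilfreeZ (k : C) f : nilfree f -> nilfree (k *: f).
Proof. by rewrite /nilfree nc_scaleE => ->; rewrite mulr0. Qed.

Lemma nilfreeD f g : nilfree f -> nilfree g -> nilfree (f + g).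
Proof. by rewrite /nilfree nc_addE => -> ->; rewrite addr0. Qed.

Lemma nilfreeN f : nilfree f -> nilfree (- f).
Proof. by rewrite /nilfree nc_oppE => ->; rewrite oppr0. Qed.

Lemma nilfree0 : nilfree (0 : series).
Proof. by []. Qed.

Lemma nc_mul_letter (a b : A) f w :
  (nc_letter C a * f) (b :: w) = (a == b)%:R * f w.
Proof.
rewrite nc_mulE !big_ord_recl /= take0 drop0 mul0r add0r big1 ?addr0.
  by rewrite /nc_letter /= eqseq_cons andbT eq_sym.
move=> i _; rewrite /= /nc_letter eqseq_cons.
by case: w i => [|c w] [i iw] //=; rewrite andbF mul0r.
Qed.

Lemma nc_mul_letter_nil (a : A) f : (nc_letter C a * f) [::] = 0.
Proof. by rewrite nc_mul_nil mul0r. Qed.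

Lemma nc_exp_letter (a : A) (k : C) w : nc_exp (k *: nc_letter C a) w =
  (w == nseq (size w) a)%:R * (k ^+ size w / (size w)`!%:R).
Proof.
have l0 : nilfree (k *: nc_letter C a) by apply: nilfreeZ.
rewrite nc_exp_subst//; pose E c := nc_subst c 0 (k *: nc_letter C a) : series.
have EE c v : E c v = (v == nseq (size v) a)%:R * (k ^+ size v * c (nseq (size v) ly)).
  elim: v c => [|b v IH] c; first by rewrite /E nc_subst_nil //= expr0 !mul1r.
  rewrite /E nc_subst_unfold// mul0r addr0 nc_addE -scalerAl !nc_scaleE nc_oneE mulr0 add0r.
  rewrite nc_mul_letter -/(E _) IH /= eqseq_cons eq_sym.
  by case: eqP => _; rewrite ?mul0r ?mulr0 //= mul1r exprS mulrCA !mulrA.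
by rewrite -/(E _) EE /inv_fact size_nseq.
Qed.

Lemma nc_subst_X f g : nilfree f -> nilfree g ->
  nc_subst (nc_letter C lx) f g = f.
Proof.
move=> f0 g0; rewrite nc_subst_unfold// scale0r add0r.
have -> : nc_tail lx (nc_letter C lx) = 1.
  by apply/funext => w; rewrite /nc_tail /nc_letter eqseq_cons eqxx.
have -> : nc_tail ly (nc_letter C lx) = 0.
  by apply/funext => w; rewrite /nc_tail /nc_letter eqseq_cons.
by rewrite nc_subst1// nc_subst0 mulr1 mulr0 addr0.
Qed.

Lemma nc_subst_Y f g : nilfree f -> nilfree g ->
  nc_subst (nc_letter C ly) f g = g.
Proof.
move=> f0 g0; rewrite nc_subst_unfold// scale0r add0r.
have -> : nc_tail ly (nc_letter C ly) = 1.
  by apply/funext => w; rewrite /nc_tail /nc_letter eqseq_cons eqxx.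
have -> : nc_tail lx (nc_letter C ly) = 0.
  by apply/funext => w; rewrite /nc_tail /nc_letter eqseq_cons.
by rewrite nc_subst1// nc_subst0 mulr1 mulr0 add0r.
Qed.

Lemma nc_subst_exp f g (p : ncseries C bool) : nilfree f -> nilfree g -> nilfree p ->
  nc_subst (nc_exp p) f g = nc_exp (nc_subst p f g).
Proof.
move=> f0 g0 p0; rewrite (nc_exp_subst p0) nc_subst_comp// nc_subst0.
rewrite -nc_exp_subst//; by rewrite /nilfree nc_subst_nil.
Qed.

(** The geometric series in 1 - f, obtained by substituting 1 - f for Y in the series with all
    coefficients 1. *)
Lemma nc_right_inverse f : f [::] = 1 -> exists g, f * g = 1.
Proof.
move=> f1; have k0 : nilfree (1 - f) by rewrite /nilfree nc_addE nc_oppE f1 subrr.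
pose c : ncseries C bool := fun=> 1.
have := nc_subst_unfold c nilfree0 k0; rewrite mul0r addr0 [c [::]]/= scale1r.
have -> : nc_tail ly c = c by [].
set g := nc_subst c 0 (1 - f) => gE; exists g.
have -> : f * g = g - (1 - f) * g by rewrite mulrBl mul1r opprB addrC subrK.
by rewrite {1}gE addrK.
Qed.

End SubstitutionLetters.

(** * Substitution modulo a closed ideal, and shifts by commuting elements *)

Section SubstitutionModulo.
Variables (R : realType) (A : eqType).
Notation C := CC[R].
Notation series := (ncseries C A).
Implicit Types (f g h p q : series) (c d : ncseries C bool).

(* A two-sided ideal, closed for the topology defined by the length of words. *)
Variable J : series -> Prop.
Hypothesis J0 : J 0.
Hypothesis JD : forall f g, J f -> J g -> J (f + g).
Hypothesis Jl : forall h f, J f -> J (h * f).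
Hypothesis Jr : forall h f, J f -> J (f * h).
Hypothesis Jclosed :
  forall f, (forall n, exists2 g, J g & agree n f g) -> J f.

Definition eqJ f g := J (f - g).
(** Congruence up to length n, on which inductions run; [Jclosed] turns all of these into [eqJ]. *)
Definition eqJn n f g := exists2 k, J k & agree n (f - g) k.

Lemma eqJ_refl f : eqJ f f.
Proof. by rewrite /eqJ subrr. Qed.

Lemma eqJ_trans g f h : eqJ f g -> eqJ g h -> eqJ f h.
Proof. by rewrite /eqJ -[f - h](subrKA g) => fg gh; exact: JD. Qed.

Lemma eqJD f g f' g' : eqJ f f' -> eqJ g g' -> eqJ (f + g) (f' + g').
Proof. by rewrite /eqJ opprD addrACA; exact: JD. Qed.

Lemma eqJM f g f' g' : eqJ f f' -> eqJ g g' -> eqJ (f * g) (f' * g').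
Proof.
move=> ff gg; rewrite /eqJ -[_ - _](subrKA (f' * g)) -mulrBl -mulrBr.
by apply: JD; [exact: Jr|exact: Jl].
Qed.

Lemma eqJZ (a : C) f g : eqJ f g -> eqJ (a *: f) (a *: g).
Proof.
rewrite /eqJ -scalerBr => fg.
by have := Jl a%:A fg; rewrite -scalerAl mul1r.
Qed.

Lemma eqJnP f g : (forall n, eqJn n f g) -> eqJ f g.
Proof. by move=> fg; apply: Jclosed => n; have [k Jk fk] := fg n; exists k. Qed.

Lemma eqJ_eqJn n f g : eqJ f g -> eqJn n f g.
Proof. by move=> fg; exists (f - g). Qed.

Lemma eqJn0 f g : eqJn 0 f g.
Proof. by exists 0. Qed.

Lemma agree_eqJn n f g : agree n f g -> eqJn n f g.
Proof. by move=> fg; exists 0 => // w wn; rewrite nc_addE nc_oppE fg ?subrr. Qed.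

Lemma eqJnD n f g f' g' : eqJn n f f' -> eqJn n g g' -> eqJn n (f + g) (f' + g').
Proof.
move=> [k Jk fk] [l Jl' gl]; exists (k + l); first exact: JD.
by rewrite opprD addrACA; exact: agree_add.
Qed.

Lemma eqJn_trans n g f h : eqJn n f g -> eqJn n g h -> eqJn n f h.
Proof.
move=> [k Jk fk] [l Jl' gl]; exists (k + l); first exact: JD.
by rewrite -[f - h](subrKA g); exact: agree_add.
Qed.

Lemma eqJn_mul n h f g : nilfree h -> eqJn n f g -> eqJn n.+1 (h * f) (h * g).
Proof.
move=> h0 [k Jk fk]; exists (h * k); first exact: Jl.
by rewrite -mulrBr; exact: agree_mul.
Qed.

Lemma nc_subst_congr c f g f' g' : nilfree f -> nilfree g -> nilfree f' ->
  nilfree g' -> eqJ f f' -> eqJ g g' -> eqJ (nc_subst c f g) (nc_subst c f' g').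
Proof.
move=> f0 g0 f'0 g'0 ff gg; apply: eqJnP => n; elim: n c => [|n IH] c.
  exact: eqJn0.
rewrite (nc_subst_unfold c f0 g0) (nc_subst_unfold c f'0 g'0).
have step h h' c' : nilfree h' -> eqJ h h' ->
    eqJn n.+1 (h * nc_subst c' f g) (h' * nc_subst c' f' g').
  move=> h'0 hh; apply: (@eqJn_trans _ (h' * nc_subst c' f g)).
    by apply: eqJ_eqJn; apply: eqJM => //; exact: eqJ_refl.
  exact: eqJn_mul.
apply: eqJnD; last exact: step.
by apply: eqJnD; [apply: eqJ_eqJn; exact: eqJ_refl|exact: step].
Qed.

Lemma nc_subst_commute c f g h : nilfree f -> nilfree g ->
  eqJ (h * f) (f * h) -> eqJ (h * g) (g * h) ->
  eqJ (h * nc_subst c f g) (nc_subst c f g * h).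
Proof.
move=> f0 g0 hf hg; apply: eqJnP => n; elim: n c => [|n IH] c; first exact: eqJn0.
rewrite (nc_subst_unfold c f0 g0) !mulrDr !mulrDl -scalerAr -scalerAl mulr1 mul1r.
have step k c' : nilfree k -> eqJ (h * k) (k * h) ->
    eqJn n.+1 (h * (k * nc_subst c' f g)) (k * nc_subst c' f g * h).
  move=> k0 hk; apply: (@eqJn_trans _ (k * (h * nc_subst c' f g))).
    by apply: eqJ_eqJn; rewrite !mulrA; apply: eqJM => //; exact: eqJ_refl.
  by rewrite -mulrA; exact: eqJn_mul.
apply: eqJnD; last exact: step.
by apply: eqJnD; [apply: eqJ_eqJn; exact: eqJ_refl|exact: step].
Qed.

Lemma nc_exp_congr f g : nilfree f -> nilfree g -> eqJ f g -> eqJ (nc_exp f) (nc_exp g).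
Proof.
move=> f0 g0 fg; rewrite !nc_exp_subst//; apply: nc_subst_congr => //.
exact: eqJ_refl.
Qed.

Lemma nc_exp_commute f h : nilfree f -> eqJ (h * f) (f * h) ->
  eqJ (h * nc_exp f) (nc_exp f * h).
Proof.
move=> f0 hf; rewrite nc_exp_subst//; apply: nc_subst_commute => //.
by rewrite mulr0 mul0r; exact: eqJ_refl.
Qed.

(* For a shuffle character c this computes the substitution of a sum g + h with h
   central as a product, by collecting the occurrences of h. *)
Definition collect m c : ncseries C bool := fun v => shsum c v (nseq m ly).

Lemma collect0 c : collect 0 c = c.
Proof. by apply/funext => v; rewrite /collect shsumw0. Qed.

Lemma collectS_nil m c : collect m.+1 c [::] = collect m (nc_tail ly c) [::].
Proof. by rewrite /collect !shsum0w. Qed.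

Lemma collectS_tail m c b : nc_tail b (collect m.+1 c) =
  collect m.+1 (nc_tail b c) + nc_tail b (collect m (nc_tail ly c)).
Proof. by apply/funext => v; rewrite nc_addE /nc_tail /collect shsum_cons. Qed.

Lemma nc_subst_collectS m c f g : nilfree f -> nilfree g ->
  nc_subst (collect m.+1 c) f g = nc_subst (collect m (nc_tail ly c)) f g +
    (f * nc_subst (collect m.+1 (nc_tail lx c)) f g +
     g * nc_subst (collect m.+1 (nc_tail ly c)) f g).
Proof.
move=> f0 g0; rewrite (nc_subst_unfold _ f0 g0) !collectS_tail collectS_nil.
rewrite !nc_substD// !mulrDr.
rewrite [X in _ = X + _](nc_subst_unfold _ f0 g0) -!addrA; congr (_ + _).
by rewrite addrCA; congr (_ + _); rewrite [RHS]addrC addrA.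
Qed.

(** The expected value of c(f, g + h), where m counts the factors h moved to the far right. *)
Definition collect_sum M c f g h : series :=
  \sum_(m < M) nc_subst (collect m c) f g * h ^+ m.

(** A leading h shows up here on the right; commutation enters when [nc_subst_collect] brings it
    back to the left. *)
Lemma collect_sum_unfold M c f g h : nilfree f -> nilfree g ->
  collect_sum M.+1 c f g h = c [::] *: 1 +
    f * collect_sum M.+1 (nc_tail lx c) f g h +
    g * collect_sum M.+1 (nc_tail ly c) f g h +
    collect_sum M (nc_tail ly c) f g h * h.
Proof.
move=> f0 g0; rewrite /collect_sum ![in LHS]big_ord_recl collect0 expr0 mulr1.
under eq_bigr => m _ do rewrite lift0 nc_subst_collectS// !mulrDl.
rewrite !big_split /= (nc_subst_unfold c f0 g0).
rewrite ![in RHS]big_ord_recl !collect0 !expr0 !mulr1 !mulrDr -!addrA.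
have dist k (F G : nat -> series) :
    k * \sum_(m < M) F m * G m = \sum_(m < M) k * F m * G m.
  by rewrite big_distrr; apply: eq_bigr => m _ /=; rewrite mulrA.
rewrite (dist f (fun m => nc_subst (collect m.+1 _) f g) (fun m => h ^+ m.+1)).
rewrite (dist g (fun m => nc_subst (collect m.+1 _) f g) (fun m => h ^+ m.+1)).
have -> : (\sum_(m < M) nc_subst (collect m (nc_tail ly c)) f g * h ^+ m) * h =
    \sum_(m < M) nc_subst (collect m (nc_tail ly c)) f g * h ^+ m.+1.
  by rewrite big_distrl; apply: eq_bigr => m _ /=; rewrite exprSr mulrA.
congr (_ + (_ + _)); rewrite [RHS]addrCA; congr (_ + _).
by rewrite addrC addrA.
Qed.

Lemma eqJ_commute_sum (n : nat) (F : nat -> series) h :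
  (forall m, eqJ (h * F m) (F m * h)) ->
  eqJ (h * \sum_(m < n) F m) ((\sum_(m < n) F m) * h).
Proof.
move=> hF; rewrite big_distrr big_distrl /=.
elim/big_rec2 : _ => [|m p q _]; [exact: eqJ_refl|exact: eqJD].
Qed.

Lemma eqJ_commuteM f g h : eqJ (h * f) (f * h) -> eqJ (h * g) (g * h) ->
  eqJ (h * (f * g)) (f * g * h).
Proof.
move=> hf hg; rewrite mulrA; apply: (@eqJ_trans (f * h * g)).
  by apply: eqJM => //; exact: eqJ_refl.
by rewrite -!mulrA; apply: eqJM => //; exact: eqJ_refl.
Qed.

(** Both sides obey the same recursion on the first letter. A leading h lowers M and n together,
    which keeps n <= M. *)
Lemma nc_subst_collect M n c f g h : nilfree f -> nilfree g -> nilfree h ->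
  eqJ (h * f) (f * h) -> eqJ (h * g) (g * h) -> (n <= M)%N ->
  eqJn n (nc_subst c f (g + h)) (collect_sum M c f g h).
Proof.
move=> f0 g0 h0 hf hg; elim: n M c => [|n IH] [|M] c; rewrite ?ltnS => nM //;
  try exact: eqJn0.
rewrite collect_sum_unfold// nc_subst_unfold; [|by []|exact: nilfreeD].
rewrite mulrDl addrA; apply: eqJnD.
  apply: eqJnD; last by apply: eqJn_mul => //; apply: IH; exact: leqW.
  apply: eqJnD; first by apply: eqJ_eqJn; exact: eqJ_refl.
  by apply: eqJn_mul => //; apply: IH; exact: leqW.
apply: (@eqJn_trans _ (h * collect_sum M (nc_tail ly c) f g h)).
  by apply: eqJn_mul => //; exact: IH.
apply: eqJ_eqJn; apply: (@eqJ_commute_sum M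
  (fun m => nc_subst (collect m (nc_tail ly c)) f g * h ^+ m)) => m.
apply: eqJ_commuteM; first exact: nc_subst_commute.
by rewrite -exprS exprSr; exact: eqJ_refl.
Qed.

(** Multiplicativity for the shuffle product makes [collect m c] equal to c(y)^m / m! times [c], so
    the collected sum is a product with an exponential. *)
Lemma nc_subst_shift c f g h : nilfree f -> nilfree g -> nilfree h ->
  eqJ (h * f) (f * h) -> eqJ (h * g) (g * h) ->
  (forall u v, shsum c u v = c u * c v) -> c [::] = 1 ->
  eqJ (nc_subst c f (g + h)) (nc_subst c f g * nc_exp (c [:: ly] *: h)).
Proof.
move=> f0 g0 h0 hf hg cM c1; apply: eqJnP => n.
apply: eqJn_trans (nc_subst_collect c f0 g0 h0 hf hg (leqnn n)) _.
have -> : collect_sum n c f g h = nc_subst c f g *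
    \sum_(m < n) (m`!%:R^-1 : C) *: (c [:: ly] *: h) ^+ m.
  rewrite big_distrr; apply: eq_bigr => m _ /=.
  have -> : collect m c = (c [:: ly] ^+ m / m`!%:R) *: c.
    by apply/funext => v; rewrite nc_scaleE /collect cM mulrC (character_nseq _ _ cM).
  by rewrite nc_substZ// exprZn scalerA -scalerAl -scalerAr mulrC.
apply: agree_eqJn => w wn; apply/esym; apply: agree_mull wn.
by apply: nc_exp_agree; exact: nilfreeZ.
Qed.

(** Words of lengths p and q have binomial(p + q, p) shuffles, all of length p + q. *)
Lemma inv_fact_character u v :
  shsum (inv_fact R) u v = inv_fact R u * inv_fact R v.
Proof.
have sz (a b : word) : size (shuffles a b) = 'C(size a + size b, size a).
  elim: a b => [|x a IHa] b; first by rewrite bin0.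
  elim: b => [|y b IHb]; first by rewrite addn0 binn.
  by rewrite shuffles_cons size_cat !size_map IHa IHb /= addSn !addnS binS addnC.
rewrite /shsum big_seq (eq_bigr (fun=> ((size u + size v)`!%:R^-1 : C))); last first.
  by move=> w /size_shuffles wE; rewrite /inv_fact wE.
rewrite -big_seq big_const_seq count_predT iter_addr addr0 sz /inv_fact.
have nz k : (k`!%:R : C) != 0 by rewrite pnatr_eq0 -lt0n fact_gt0.
have := bin_fact (leq_addr (size v) (size u)); rewrite addKn => E.
rewrite -[LHS]mulr_natl; apply: (mulIf (nz (size u + size v))).
rewrite divfK// -E !natrM; have := nz (size u); have := nz (size v).
by move: (_`!%:R) (_`!%:R) => x y; move: (_%:R) => b x0 y0; field; rewrite x0 y0.
Qed.

(** [nc_subst_shift] for the character exp(X + Y) with 0 in place of X. *)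
Lemma nc_expD f g : nilfree f -> nilfree g -> eqJ (g * f) (f * g) ->
  eqJ (nc_exp (f + g)) (nc_exp f * nc_exp g).
Proof.
move=> f0 g0 fg; rewrite !(nc_exp_subst (nilfreeD f0 g0), nc_exp_subst f0).
have := @nc_subst_shift (inv_fact R) 0 f g.
rewrite [inv_fact R [:: ly]]invr1 scale1r; apply => //.
- by rewrite mulr0 mul0r; exact: eqJ_refl.
- exact: inv_fact_character.
- by rewrite /inv_fact invr1.
Qed.

End SubstitutionModulo.

(** * Exponentials of the multiples of one series *)

Section ExponentialScalar.
Variables (R : realType) (A : eqType).
Notation C := CC[R].
Implicit Types (f : ncseries C A) (a b : C).

(** [nc_expD] for the zero ideal, for which congruence is equality. *)
Lemma nc_exp_scaleD f a b : nilfree f ->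
  nc_exp ((a + b) *: f) = nc_exp (a *: f) * nc_exp (b *: f).
Proof.
move=> f0; rewrite scalerDl; apply/eqP; rewrite -subr_eq0; apply/eqP.
apply: (@nc_expD R A (fun g => g = 0)).
- by [].
- by move=> ? ? -> ->; rewrite addr0.
- by move=> ? ? ->; rewrite mulr0.
- by move=> ? ? ->; rewrite mul0r.
- move=> g gP; apply/funext => w.
  by have [k -> ->] := gP (size w).+1.
- exact: nilfreeZ.
- exact: nilfreeZ.
by rewrite /eqJ -!scalerAl -!scalerAr !scalerA mulrC subrr.
Qed.

Lemma nc_exp_scale0 f : nilfree f -> nc_exp (0 *: f) = 1.
Proof.
move=> f0; rewrite scale0r nc_exp_subst// nc_subst_unfold// !mul0r !addr0.
by rewrite /inv_fact invr1 scale1r.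
Qed.

Lemma nc_exp_scaleN f a : nilfree f -> nc_exp (a *: f) * nc_exp ((- a) *: f) = 1.
Proof. by move=> f0; rewrite -nc_exp_scaleD// subrr nc_exp_scale0. Qed.

End ExponentialScalar.

(** * The formal KZ equation and its solution near 0 *)

Section FormalKZ.
Local Open Scope classical_set_scope.
Local Open Scope ring_scope.
Variable R : realType.
Notation C := CC[R].
Notation series := (ncseries C bool).
Notation ncX := (nc_letter C lx).
Notation ncY := (nc_letter C ly).
Implicit Types (z : C) (w v : word).

Definition is_ncderive z (G : C -> series) (D : series) :=
  forall w, is_cderive z (fun t => G t w) (D w).

Lemma is_ncderiveM z (F G : C -> series) (D E : series) :
  is_ncderive z F D -> is_ncderive z G E ->
  is_ncderive z (fun t => F t * G t) (D * G z + F z * E).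
Proof.
move=> dF dG w; have -> : (D * G z + F z * E) w = \sum_(i < (size w).+1)
    (D (take i w) * G z (drop i w) + F z (take i w) * E (drop i w)).
  by rewrite nc_addE !nc_mulE -big_split.
have -> : (fun t => (F t * G t) w) =
    (fun t => \sum_(i < (size w).+1) F t (take i w) * G t (drop i w)).
  by apply/funext => t; rewrite nc_mulE.
by apply: is_cderive_sum => i; exact: is_cderiveM.
Qed.

Lemma is_ncderive_cst z (F : series) : is_ncderive z (fun=> F) 0.
Proof. by move=> w; exact: is_cderive_cst. Qed.

Definition kz_form z : series := z^-1 *: ncX + (1 - z)^-1 *: ncY.

Lemma kz_form_nil z (F : series) : (kz_form z * F) [::] = 0.
Proof. by rewrite nc_mul_nil /kz_form nc_addE !nc_scaleE /nc_letter /= !mulr0 addr0 mul0r. Qed.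

Lemma kz_form_cons z (F : series) b w :
  (kz_form z * F) (b :: w) = (if b then (1 - z)^-1 else z^-1) * F w.
Proof.
rewrite /kz_form mulrDl -!scalerAl nc_addE !nc_scaleE !nc_mul_letter.
by case: b; rewrite /= mul1r mul0r mulr0 ?addr0 ?add0r.
Qed.

Definition kz_on (S : set C) (G : C -> series) :=
  forall z, S z -> is_ncderive z G (kz_form z * G z).

Lemma kz_onMr S (G : C -> series) (k : series) : kz_on S G ->
  kz_on S (fun z => G z * k).
Proof.
move=> dG z Sz; have := is_ncderiveM (dG z Sz) (is_ncderive_cst z k).
by rewrite mulr0 addr0 mulrA.
Qed.

Lemma kz_onB S (G F : C -> series) : kz_on S G -> kz_on S F ->
  kz_on S (fun z => G z - F z).
Proof.
move=> dG dF z Sz w; rewrite mulrBr.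
exact: is_cderiveB (dG z Sz w) (dF z Sz w).
Qed.

(** The system is triangular in the length of words: where all shorter coefficients vanish, a
    coefficient has zero derivative. What remains is to show that the resulting constant is 0, by
    whatever boundary condition is at hand. *)
Lemma kz_zero (S : set C) (a : C) (G : C -> series) :
  (forall z (t : R), S z -> 0 <= t <= 1 -> S (a + t%:C * (z - a))) ->
  kz_on S G ->
  (forall w, (forall v z, (size v < size w)%N -> S z -> G z v = 0) ->
    (forall z, S z -> G z w = G a w) -> G a w = 0) ->
  forall z, S z -> G z = 0.
Proof.
move=> starS dG G0 z Sz; apply/funext => w.
suff : forall n v y, (size v < n)%N -> S y -> G y v = 0.
  by move=> /(_ (size w).+1 w z (ltnSn _) Sz).
elim=> // n IH v y; rewrite ltnS => vn Sy.
have IHv u x : (size u < size v)%N -> S x -> G x u = 0.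
  by move=> uv; apply: IH; exact: leq_trans vn.
have cst x : S x -> G x v = G a v.
  apply: (@is_cderive0_star R S a (fun t => G t v)) => // t St.
  apply: is_cderive_eq (dG t St v) _; case: (v) IHv => [|b u] IHv.
    by rewrite kz_form_nil.
  by rewrite kz_form_cons IHv ?mulr0 /=.
by rewrite cst//; exact: G0.
Qed.

Lemma kz_uniq (S : set C) (a : C) (G F : C -> series) :
  (forall z (t : R), S z -> 0 <= t <= 1 -> S (a + t%:C * (z - a))) ->
  kz_on S G -> kz_on S F -> G a = F a -> forall z, S z -> G z = F z.
Proof.
move=> starS dG dF GFa z Sz; apply/eqP; rewrite -subr_eq0; apply/eqP.
apply: (kz_zero starS (kz_onB dG dF) _ Sz) => w _ _.
by rewrite GFa subrr.
Qed.

Lemma nc_exp_letter_derive z (b : bool) (f : C -> C) (d : C) : is_cderive z f d ->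
  is_ncderive z (fun t => nc_exp (f t *: nc_letter C b))
    (d *: (nc_letter C b * nc_exp (f z *: nc_letter C b))).
Proof.
move=> df [|a w].
  rewrite nc_scaleE nc_mul_letter_nil mulr0.
  suff -> : (fun t => nc_exp (f t *: nc_letter C b) [::]) = fun=> 1.
    exact: is_cderive_cst.
  by apply/funext => t; rewrite nc_exp_letter /= expr0 divr1 mulr1.
rewrite nc_scaleE nc_mul_letter nc_exp_letter.
pose k := (b == a)%:R * (w == nseq (size w) b)%:R : C.
have -> : (fun t => nc_exp (f t *: nc_letter C b) (a :: w)) =
    (fun t => k / (size w).+1`!%:R * f t ^+ (size w).+1).
  apply/funext => t; rewrite nc_exp_letter /= eqseq_cons -mulnb natrM [a == b]eq_sym.
  by rewrite /k mulrA mulrAC.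
have dX n : is_cderive z (fun t => f t ^+ n) (n%:R * f z ^+ n.-1 * d).
  elim: n => [|n IH].
    rewrite !mul0r; have -> : (fun t => f t ^+ 0) = fun=> 1.
      by apply/funext => t; rewrite expr0.
    exact: is_cderive_cst.
  have -> : (fun t => f t ^+ n.+1) = (fun t => f t * f t ^+ n).
    by apply/funext => t; rewrite exprS.
  apply: is_cderive_eq (is_cderiveM df IH) _.
  case: n {IH} => [|n]; first by rewrite !expr0; ring.
  by rewrite /= !exprS -!natr1; ring.
apply: is_cderive_eq (is_cderiveZ _ (dX _)) _.
rewrite factS natrM /k /=.
have n1 : ((size w).+1%:R : C) != 0 by rewrite pnatr_eq0.
have f1 : ((size w)`!%:R : C) != 0 by rewrite pnatr_eq0 -lt0n fact_gt0.
move: (f z ^+ _) n1 f1 => y n1 f1.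
move: (_.+1%:R : C) (_`!%:R : C) n1 f1 => p q p0 q0.
by field; rewrite q0 p0.
Qed.

(* The Taylor coefficients of H, where G_0 = H z^X with H holomorphic at 0, that
   is z H' = (X + z / (1 - z) Y) H - H X. *)
Fixpoint hcoef (m : nat) (w : word) (n : nat) : C :=
  if m is m'.+1 then
    if w is b :: v then
      ((if b then \sum_(j < n) hcoef m' v j else hcoef m' v n) -
       (if last b v then 0 else hcoef m' (belast b v) n)) / n%:R
    else 0
  else (n == 0%N)%:R.

Definition Hcoef w := hcoef (size w) w.

Lemma Hcoef_nil n : Hcoef [::] n = (n == 0%N)%:R.
Proof. by []. Qed.

(** The convention x / 0 = 0 gives the normalization H(0) = 1. *)
Lemma Hcoef0 w : Hcoef w 0 = (w == [::])%:R.
Proof. by case: w => [|b v] //; rewrite /Hcoef /= invr0 mulr0. Qed.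

Lemma Hcoef_cons b v n : n%:R * Hcoef (b :: v) n =
  (if b then \sum_(j < n) Hcoef v j else Hcoef v n) -
  (if last b v then 0 else Hcoef (belast b v) n).
Proof.
case: n => [|n]; last first.
  by rewrite /Hcoef size_belast /= mulrC divfK// pnatr_eq0.
(* At n = 0 the recursion says that X commutes with H(0) = 1. *)
rewrite mul0r big_ord0 !Hcoef0.
by case: b v => -[|c v] /=; rewrite ?subrr ?subr0 ?if_same ?subr0.
Qed.

(** The recursion for n times the coefficient has two terms, each at most n times the bound for the
    shorter words; only one factor 2 is lost per letter. *)
Lemma modc_Hcoef w n : modc (Hcoef w n) <= 2 ^+ size w.
Proof.
have [k wk] := ubnP (size w); elim: k w wk n => // k IH [|b v] wk n.
  by rewrite Hcoef_nil modc_nat expr0; case: eqP.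
case: n => [|n]; first by rewrite Hcoef0 modc0 exprn_ge0.
have vk : (size v < k)%N by [].
have n0 : 0 < n.+1%:R :> R by rewrite ltr0n.
rewrite -(ler_pM2l n0) -[n.+1%:R in leLHS](modc_nat R) -modcM Hcoef_cons.
apply: le_trans (modcB _ _) _.
have -> : n.+1%:R * 2 ^+ size (b :: v) =
    n.+1%:R * 2 ^+ size v + n.+1%:R * 2 ^+ size v :> R by rewrite exprS; ring.
have p0 : 0 <= 2 ^+ size v :> R by rewrite exprn_ge0.
have le1 : 2 ^+ size v <= n.+1%:R * 2 ^+ size v :> R by rewrite ler_peMl// ler1n.
apply: lerD.
  case: b {wk}; last by apply: le_trans (IH _ vk _) le1.
  apply: le_trans (modc_sum _ _ _) _; rewrite mulr_natl -[n.+1 in leRHS]card_ord.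
  by rewrite -sumr_const; apply: ler_sum => i _; exact: IH.
case: (last b v); first by rewrite modc0 mulr_ge0.
by apply: le_trans le1; rewrite -(size_belast b v); apply: IH; rewrite size_belast.
Qed.

Lemma geom_Hcoef w : geom 1 (Hcoef w).
Proof.
move=> s /andP[s0 s1]; exists (2 ^+ size w) => n.
rewrite -[leRHS]mulr1 ler_pM ?modc_ge0 ?exprn_ge0 ?(ltW s0)//.
  exact: modc_Hcoef.
by rewrite exprn_ile1 ?ltW.
Qed.

Definition Hloc : word -> C -> C := projT1 (choice (fun w => pseries_ex (geom_Hcoef w))).

Lemma HlocP w : pseries 1 (Hcoef w) (Hloc w).
Proof. exact: (projT2 (choice (fun w => pseries_ex (geom_Hcoef w))) w). Qed.

Lemma Hloc_nil z : modc z < 1 -> Hloc [::] z = 1.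
Proof.
move=> z1; apply: (pseries_uniq (HlocP [::]) _ z1 (g := fun=> 1)).
suff -> : Hcoef [::] = cstc 1 by exact: pseries_cst.
by apply/funext => -[|n].
Qed.

Lemma Hloc0 w : Hloc w 0 = (w == [::])%:R.
Proof. by rewrite (pseries0 ltr01 (HlocP w)) Hcoef0. Qed.

Lemma Hloc_derive b v z : z != 0 -> modc z < 1 ->
  is_cderive z (Hloc (b :: v)) ((if b then (1 - z)^-1 else z^-1) * Hloc v z -
    (if last b v then 0 else z^-1 * Hloc (belast b v) z)).
Proof.
move=> z0 z1; have [g gP] := pseries_ex (geom_derc (geom_Hcoef (b :: v))).
apply: is_cderive_eq (pseries_derive (HlocP _) gP z1) _.
(* After multiplication by z both sides are power series at 0, compared coefficient by coefficient
   through [Hcoef_cons]. *)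
apply: (mulfI z0).
have zg := pseries_mulz gP.
have zgE : shiftc (derc (Hcoef (b :: v))) = fun n =>
    (if b then shiftc (fun n => \sum_(j < n.+1) Hcoef v j) n else Hcoef v n) +
    (if last b v then 0 else -1) * Hcoef (belast b v) n.
  apply/funext => n; transitivity (n%:R * Hcoef (b :: v) n).
    by case: n => [|n] //; rewrite mul0r.
  rewrite Hcoef_cons; congr (_ + _); first by case: (b) => //; case: n => [|n] //; rewrite big_ord0.
  by case: ifP => _; rewrite ?mul0r ?oppr0// mulN1r.
rewrite zgE in zg.
pose F y : C := (if b then y * (Hloc v y / (1 - y)) else Hloc v y) +
  (if last b v then 0 else -1) * Hloc (belast b v) y.
have FP : pseries 1 (fun n =>
    (if b then shiftc (fun n => \sum_(j < n.+1) Hcoef v j) n else Hcoef v n) +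
    (if last b v then 0 else -1) * Hcoef (belast b v) n) F.
  apply: pseriesD; last by apply: pseriesZ; exact: HlocP.
  case: (b); last exact: HlocP.
  apply: pseries_mulz; apply: pseries_div (HlocP v); first by rewrite ltr01 modc1 lexx.
  by case=> [|n]; rewrite mul1r; [rewrite big_ord1 /= addr0|rewrite [LHS]big_ord_recr [LHS]addrC].
rewrite (pseries_uniq zg FP z1) /F mulrBr; congr (_ + _).
  by case: (b); [rewrite [_^-1 * _]mulrC|rewrite mulrA divff// mul1r].
by case: ifP => _; rewrite ?mul0r ?mulr0 ?oppr0// mulrA divff// mul1r mulN1r.
Qed.

Definition Hser z : series := fun w => Hloc w z.

Lemma Hser_derive z : z != 0 -> modc z < 1 ->
  is_ncderive z Hser (kz_form z * Hser z - z^-1 *: (Hser z * ncX)).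
Proof.
move=> z0 z1 [|b v].
  rewrite nc_addE nc_oppE kz_form_nil nc_scaleE nc_mul_nil /= mulr0 mulr0 subr0.
  apply: is_cderive_near (is_cderive_cst z 1).
  have [r /andP[r0 r1]] : exists r : R, modc z < r < 1.
    by exists ((modc z + 1) / 2); apply/andP; split; lra.
  apply/nbhs_modcP; exists (r - modc z); first by rewrite subr_gt0.
  move=> w wz; rewrite /Hser Hloc_nil//; have := modcD (w - z) z.
  by rewrite subrK; lra.
apply: is_cderive_eq (Hloc_derive b v z0 z1) _.
rewrite nc_addE nc_oppE kz_form_cons nc_scaleE; congr (_ - _).
have -> : (Hser z * ncX) (b :: v) = (last b v == lx)%:R * Hser z (belast b v).
  rewrite lastI nc_mulE size_rcons big_ord_recr /= drop_oversize ?size_rcons// mulr0 addr0.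
  rewrite big_ord_recr /= big1 => [|i _].
    by rewrite add0r -cats1 take_size_cat// drop_size_cat// /nc_letter eqseq_cons andbT mulrC.
  rewrite -cats1 drop_cat ltn_ord /nc_letter.
  have := size_drop i (belast b v); case: (drop i _) => [/eqP|c s _].
    by rewrite eq_sym subn_eq0 leqNgt ltn_ord.
  by rewrite /= eqseq_cons; case: s => [|? ?] /=; rewrite andbF mulr0.
by case: (last b v); rewrite /= ?mul0r ?mulr0// mul1r.
Qed.

Definition Gloc z : series := Hser z * nc_pow z ncX.

Definition unit_slit : set C := [set z | slit_plane z /\ modc z < 1].

Lemma Gloc_kz : kz_on unit_slit Gloc.
Proof.
move=> z [zs z1]; have z0 := slit_neq0 zs.
have dP := nc_exp_letter_derive lx (is_cderive_Log (slit_cut zs)).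
have := is_ncderiveM (Hser_derive z0 z1) dP.
rewrite -/(nc_pow z ncX); suff -> : (kz_form z * Hser z - z^-1 *: (Hser z * ncX)) *
   nc_pow z ncX + Hser z * (z^-1 *: (ncX * nc_pow z ncX)) = kz_form z * Gloc z by [].
by rewrite mulrBl /Gloc mulrA -scalerAl -scalerAr mulrA subrK.
Qed.

End FormalKZ.

(** * Continuation to the slit plane through the unit disc *)

Section DiscCoordinate.
Local Open Scope classical_set_scope.
Local Open Scope ring_scope.
Variable R : realType.
Notation C := CC[R].
Notation series := (ncseries C bool).
Implicit Types (z t : C) (w v : word) (f g : C -> C).

(* The Riemann map z = (1 + t)^2 / (2 (1 + t^2)) of the unit disc onto the slit
   plane pulls dz / z and dz / (1 - z) back to [disc_form false] and
   [disc_form true]. *)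
Definition disc_form (b : bool) t : C :=
  if b then 2 * (1 + t) / ((1 - t) * (1 + t ^+ 2))
  else 2 * (1 - t) / ((1 + t) * (1 + t ^+ 2)).

Definition disc_analytic f := exists a, pseries 1 a f.

Lemma disc_analytic_ext f g : (forall t, modc t < 1 -> f t = g t) ->
  disc_analytic f -> disc_analytic g.
Proof.
by move=> fg [a fa]; exists a; apply: pseries_ext fg fa.
Qed.

Lemma disc_analyticD f g : disc_analytic f -> disc_analytic g ->
  disc_analytic (fun t => f t + g t).
Proof. by move=> [a fa] [b gb]; exists (fun n => a n + b n); exact (pseriesD fa gb). Qed.

Lemma disc_analyticZ (k : C) f : disc_analytic f -> disc_analytic (fun t => k * f t).
Proof. by move=> [a fa]; exists (fun n => k * a n); exact (pseriesZ k fa). Qed.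

Lemma disc_analytic_mulz f : disc_analytic f -> disc_analytic (fun t => t * f t).
Proof. by move=> [a fa]; exists (shiftc a); exact (pseries_mulz fa). Qed.

Lemma disc_analytic_div (al : C) f : modc al = 1 -> disc_analytic f ->
  disc_analytic (fun t => f t / (al - t)).
Proof.
move=> al1 [a fa]; exists (divc al a); apply: pseries_div fa.
  by rewrite al1 ltr01 lexx.
by move=> n; rewrite divcE// -modc_eq0 al1 oner_eq0.
Qed.

Lemma disc_analytic_cst (k : C) : disc_analytic (fun=> k).
Proof. by exists (cstc k); exact: pseries_cst. Qed.

Lemma sub_disc_neq0 (al t : C) : modc al = 1 -> modc t < 1 -> al - t != 0.
Proof.
by move=> al1 t1; apply/eqP => /subr0_eq alt; move: t1; rewrite -alt al1 ltxx.
Qed.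

Lemma modc_i : modc ('i%C : C) = 1.
Proof. by rewrite modc_def /= expr0n expr1n add0r sqrtr1. Qed.

(** The poles of both forms are among 1, -1, i and -i, all on the unit circle, so each division
    preserves the radius 1. *)
Lemma disc_analytic_form (b : bool) f : disc_analytic f ->
  disc_analytic (fun t => disc_form b t * f t).
Proof.
move=> fa; pose e : C := if b then 1 else -1.
have e1 : modc e = 1 by rewrite /e; case: (b); rewrite ?modcN modc1.
pose h t := e * ((2 * f t + e * (t * (2 * f t))) / (e - t) / ('i%C - t) / (- 'i%C - t)).
apply: (@disc_analytic_ext h) => [t t1|].
  have i2 : ('i%C : C) ^+ 2 = -1 by rewrite sqr_i.
  have ni := sub_disc_neq0 modc_i t1.
  have nNi : - 'i%C - t != 0 by apply: sub_disc_neq0 => //; rewrite modcN modc_i.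
  have ne := sub_disc_neq0 e1 t1.
  have E : 1 + t ^+ 2 = ('i%C - t) * (- 'i%C - t) by rewrite -[1]opprK -i2; ring.
  rewrite /h /disc_form E; move: ni nNi ne; rewrite /e.
  case: (b); move: ('i%C - t) (- 'i%C - t) => p q p0 q0 ne.
    by field; rewrite p0 q0.
  have ne' : 1 + t != 0 by rewrite -oppr_eq0 opprD.
  by field; rewrite p0 q0 ne'.
have iN : modc (- 'i%C : C) = 1 by rewrite modcN modc_i.
have f2 := disc_analyticZ 2 fa.
have fe := disc_analyticZ e (disc_analytic_mulz f2).
exact (disc_analyticZ e (disc_analytic_div iN (disc_analytic_div modc_i
  (disc_analytic_div e1 (disc_analyticD f2 fe))))).
Qed.

Lemma disc_step (b : bool) (k : C) (f : {f | disc_analytic f}) :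
  exists g : {g | disc_analytic g}, sval g 0 = k /\
    forall t, modc t < 1 -> is_cderive t (sval g) (disc_form b t * sval f t).
Proof.
have [a fa] := disc_analytic_form b (svalP f).
have [g [gP g0 dg]] := pseries_prim ltr01 fa.
have gk : disc_analytic (fun t => g t + k).
  by apply: disc_analyticD; [exists (primc a)|exact: disc_analytic_cst].
exists (exist _ _ gk); split=> [|t t1] /=; first by rewrite g0 add0r.
apply: is_cderive_eq (is_cderiveD (dg t t1) (is_cderive_cst t k)) _.
by rewrite addr0.
Qed.

(** Iterated primitives with the values [c] at the centre. The subtype carries the analyticity from
    which the next primitive is built. *)
Fixpoint disc_sol (c : series) (w : word) : {f | disc_analytic f} :=
  if w is b :: v then sval (cid (disc_step b (c w) (disc_sol c v)))
  else exist _ _ (disc_analytic_cst (c [::])).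

Lemma disc_sol0 c w : sval (disc_sol c w) 0 = c w.
Proof. by case: w => [|b v] //=; case: (svalP (cid (disc_step b (c (b :: v)) (disc_sol c v)))). Qed.

Lemma disc_sol_derive c b v t : modc t < 1 ->
  is_cderive t (sval (disc_sol c (b :: v))) (disc_form b t * sval (disc_sol c v) t).
Proof.
move=> t1 /=.
by case: (svalP (cid (disc_step b (c (b :: v)) (disc_sol c v)))) => _; exact.
Qed.

(** The square root of z / (1 - z) in the right half plane, which the Cayley transform [disc_coord]
    sends to the unit disc. *)
Definition disc_root z : C := cexp (2^-1 * (Log z - Log (1 - z))).
Definition disc_coord z : C := (disc_root z - 1) / (disc_root z + 1).

Lemma disc_root_sqr z : slit_plane z -> disc_root z ^+ 2 = z / (1 - z).
Proof.
move=> zs; rewrite expr2 -cexpD -mulrDl.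
have -> : 2^-1 + 2^-1 = 1 :> C by field.
rewrite mul1r cexpD cexpN !LogK//; [exact: slit_neq1|exact: slit_neq0].
Qed.

Lemma Re_disc_root z : slit_plane z -> 0 < complex.Re (disc_root z).
Proof.
move=> zs; rewrite /disc_root -Log_div1B// cexpE.
have -> : complex.Im (2^-1 * Log (z / (1 - z))) = 2^-1 * Arg (z / (1 - z)).
  by rewrite half_real ImM /= mul0r addr0.
have /andP[h1 h2] := Arg_cut (slit_div_cut zs).
apply: mulr_gt0; first exact: expR_gt0.
by apply: cos_gt0_pihalf; apply/andP; split; lra.
Qed.

Lemma disc_root_neq0 z : disc_root z != 0.
Proof. exact: cexp_neq0. Qed.

Lemma disc_root1 z : slit_plane z -> disc_root z + 1 != 0.
Proof.
move=> zs; have r0 := Re_disc_root zs.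
by apply: contraTneq r0 => /eqP; rewrite addr_eq0 => /eqP ->; rewrite -leNgt /=; lra.
Qed.

Lemma modc_disc_coord z : slit_plane z -> modc (disc_coord z) < 1.
Proof.
move=> zs; rewrite modcM modcV.
have r1 : 0 < modc (disc_root z + 1) by rewrite modc_gt0 disc_root1.
rewrite ltr_pdivrMr// mul1r !modc_def ReB ImB ReD ImD.
have := Re_disc_root zs; set x := complex.Re _; set y := complex.Im _ => x0.
rewrite [complex.Re 1]/= [complex.Im 1]/= subr0 addr0.
rewrite ltr_sqrt; first by rewrite ltrD2r !expr2; lra.
by rewrite ltr_pwDl ?sqr_ge0// exprn_gt0//; lra.
Qed.

Lemma disc_coord_derive (b : bool) z : slit_plane z -> exists2 d,
  is_cderive z disc_coord d &
  disc_form b (disc_coord z) * d = if b then (1 - z)^-1 else z^-1.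
Proof.
move=> zs; have z0 := slit_neq0 zs; have z1 := slit_neq1 zs.
have dl := is_cderiveZ 2^-1 (is_cderiveB (is_cderive_Log (slit_cut zs)) (is_cderive_Log1B zs)).
have dr := is_cderive_comp dl (is_cderive_cexp _).
have dr' : is_cderive z disc_root
    (disc_root z * (2^-1 * (z^-1 - - (1 - z)^-1))) by exact: dr.
have r1 := disc_root1 zs; have r0 := disc_root_neq0 z; have r2 := disc_root_sqr zs.
have dn := is_cderiveB dr' (is_cderive_cst z 1).
have dd := is_cderiveD dr' (is_cderive_cst z 1).
have dV := @is_cderiveV R z (fun t => disc_root t + 1) _ r1 dd.
have dt := is_cderiveM dn dV.
eexists; first exact: dt.
(* Everything is rational in the square root r, since z = r^2 / (1 + r^2). *)
rewrite /disc_form /disc_coord; move: r1 r0 r2; move: (disc_root z) => r r1 r0 r2.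
have s0 : 1 + r ^+ 2 != 0.
  by rewrite r2 (_ : 1 + z / (1 - z) = (1 - z)^-1) ?invr_neq0//; field.
have zE : z = r ^+ 2 / (1 + r ^+ 2) by rewrite r2; field; rewrite z1 subrK oner_neq0.
have z1E : 1 - z = (1 + r ^+ 2)^-1 by rewrite zE; field.
have s0' : r ^+ 2 + 1 != 0 by rewrite addrC.
have n2 : (2 : C) != 0 by rewrite pnatr_eq0.
have t1 : 1 + (r - 1) / (r + 1) = 2 * r / (r + 1) by field.
have t2 : 1 - (r - 1) / (r + 1) = 2 / (r + 1) by field.
have t3 : 1 + ((r - 1) / (r + 1)) ^+ 2 = 2 * (1 + r ^+ 2) / (r + 1) ^+ 2 by field.
rewrite z1E zE t1 t2 t3.
by case: b; field; rewrite ?r0 ?r1 ?s0 ?s0' ?n2.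
Qed.

(** The disc coordinate of 1/2 is 0, so prescribing the value of [Gloc] there glues this solution to
    the local one. *)
Definition Gsol z : series := fun w => sval (disc_sol (Gloc 2^-1) w) (disc_coord z).

Lemma Gsol_kz : kz_on (@slit_plane R) Gsol.
Proof.
move=> z zs [|b v]; first by rewrite kz_form_nil; exact: is_cderive_cst.
have [d dd dE] := disc_coord_derive b zs.
have := is_cderive_comp dd (disc_sol_derive (Gloc 2^-1) b v (modc_disc_coord zs)).
by rewrite mulrAC dE kz_form_cons.
Qed.

Lemma Gsol_half : Gsol 2^-1 = Gloc 2^-1.
Proof.
apply/funext => w; rewrite /Gsol /disc_coord /disc_root.
have -> : 1 - 2^-1 = 2^-1 :> C by field.
by rewrite subrr mulr0 cexp0 subrr mul0r disc_sol0.
Qed.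

Lemma unit_slit_star z (t : R) : unit_slit z -> 0 <= t <= 1 ->
  unit_slit (2^-1 + t%:C * (z - 2^-1)).
Proof.
move=> [zs z1] t01; split; first exact: slit_star.
have -> : 2^-1 + t%:C * (z - 2^-1) = ((1 - t) / 2)%:C + t%:C * z.
  by rewrite rmorphM fmorphV rmorphB rmorph1 rmorph_nat /=; field.
move: t01 => /andP[t0 t1]; apply: le_lt_trans (modcD _ _) _.
rewrite modcM !modc_real !ger0_norm//; last by rewrite divr_ge0// subr_ge0.
have [->|tn0] := eqVneq t 0; first by rewrite mul0r; lra.
have : t * modc z < t * 1 by rewrite ltr_pM2l// lt0r tn0.
by lra.
Qed.

Lemma unit_slit_half : unit_slit (2^-1 : C).
Proof.
split; first exact: slit_half.
by rewrite half_real modc_real ger0_norm ?invr_ge0//; lra.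
Qed.

Lemma Gsol_loc z : slit_plane z -> modc z < 1 -> Gsol z = Gloc z.
Proof.
move=> zs z1; apply: (kz_uniq unit_slit_star _ (@Gloc_kz R) Gsol_half) => //.
by move=> y [ys _]; exact: Gsol_kz.
Qed.

End DiscCoordinate.

(** * Identification with the continued polylogarithm series *)

Section Polylogarithms.
Local Open Scope classical_set_scope.
Local Open Scope ring_scope.
Variable R : realType.
Notation C := CC[R].
Notation ncs := (ncseries C bool).
Implicit Types (z : C) (w v u : word).

Lemma h1_wordP w : h1_word w -> w = [::] \/
  exists k v, [/\ h1_word v, w = nseq k lx ++ ly :: v & (size v < size w)%N].
Proof.
elim: w => [|[] w IH] hw; first by left.
  by right; exists 0%N, w; split=> //; case: (w) hw.
right; case: w hw IH => // b w hw [//|//|[k [v [hv -> sv]]]].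
by exists k.+1, v; split=> //; exact: leqW sv.
Qed.

Lemma index_from_nseq j k v :
  index_from j (nseq k lx ++ ly :: v) = (j + k).+1 :: index_of v.
Proof. by elim: k j => [|k IH] j /=; rewrite ?addn0// IH addSnnS. Qed.

Lemma last_h1_cons b v : h1_word (b :: v) -> last b v = ly.
Proof. by rewrite /h1_word /= => /eqP. Qed.

Lemma h1_nseq k v : h1_word v -> h1_word (nseq k lx ++ ly :: v).
Proof. by rewrite /h1_word last_cat. Qed.

(** A word of h^1 ends in y, so the term H X drops out of the recursion and nested sums remain. The
    condition [0 < n] concerns the empty word, whose [Li_sum] is 1 even at n = 0. *)
Lemma Li_sumE w z n : h1_word w -> (0 < n)%N ->
  psum (Hcoef R w) z n = Li_sum z (index_of w) n.
Proof.
have [m wm] := ubnP (size w); elim: m w wm z n => // m IH w wm z n hw n0.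
have [->|[k [v [hv wE sv]]]] := h1_wordP hw.
  rewrite /psum; case: n n0 => // n _.
  by rewrite big_ord_recl expr0 mulr1 big1 ?addr0// => i _; rewrite mul0r.
have coef j i : (0 < i)%N ->
    Hcoef R (nseq j lx ++ ly :: v) i = Li_sum 1 (index_of v) i / i%:R ^+ j.+1.
  move=> i0; have i1 : (i%:R : C) != 0 by rewrite pnatr_eq0 -lt0n.
  elim: j => [|j IHj].
    apply: (mulfI i1); rewrite Hcoef_cons last_h1_cons ?subr0; last exact: (@h1_nseq 0).
    rewrite expr1 mulrC divfK// -IH//; last exact: leq_trans sv wm.
    by apply: eq_bigr => a _; rewrite expr1n mulr1.
  apply: (mulfI i1); rewrite /= Hcoef_cons last_h1_cons ?subr0; last exact: (@h1_nseq j.+1).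
  have p0 : (i%:R : C) ^+ j.+1 != 0 by rewrite expf_neq0.
  rewrite IHj [_ ^+ j.+2]exprS; move: (_ ^+ j.+1) p0 => p p0.
  by field; rewrite p0 i1.
rewrite wE /index_of index_from_nseq add0n /psum /=.
case: n n0 => // n _; rewrite big_ord_recl Hcoef0 expr0 mulr1 /=.
have -> : (nseq k lx ++ ly :: v == [::]) = false by case: (k).
rewrite add0r big_add1 /= big_mkord; apply: eq_bigr => i _.
by rewrite coef// /bump add1n; ring.
Qed.

Lemma Li_sum_cvg w z : h1_word w -> modc z < 1 ->
  Li_sum z (index_of w) @ \oo --> Hloc w z.
Proof.
move=> hw z1; apply/cvg_succ; have := (HlocP R w).2 z z1 => /(cvg_succ (psum _ _)).
have -> // : (fun n => psum (Hcoef R w) z n.+1) = (fun n => Li_sum z (index_of w) n.+1).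
by apply/funext => n; rewrite Li_sumE.
Qed.

(** Only suffixes x^n have a nonzero coefficient in z^X, and a word ending in y has just the empty
    one. *)
Lemma Gloc_h1 w z : h1_word w -> slit_plane z -> modc z < 1 -> Gloc z w = Hloc w z.
Proof.
move=> hw zs z1; rewrite /Gloc /nc_pow nc_mulE big_ord_recr /= take_size drop_size.
rewrite nc_exp_letter /= expr0 divr1 !mulr1 big1 ?add0r// => i _.
rewrite nc_exp_letter; case: eqP => [dE|_]; last by rewrite mul0r mulr0.
have : last ly (take i w ++ drop i w) == ly by rewrite cat_take_drop.
rewrite last_cat dE; have : (0 < size (drop i w))%N by rewrite size_drop subn_gt0.
by case: (size _) => // s _ /=; have -> : last lx (nseq s lx) = lx by elim: s.
Qed.

Lemma kz_cst (G : C -> ncs) (S : set C) (a : C) :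
  (forall z (t : R), S z -> 0 <= t <= 1 -> S (a + t%:C * (z - a))) ->
  kz_on S G -> forall z, S z -> G z [::] = G a [::].
Proof.
move=> starS dG; apply: (is_cderive0_star starS) => z Sz.
by have := dG z Sz [::]; rewrite kz_form_nil.
Qed.

(** Induction on the word: the derivative is a power series at [z0], and the coefficient differs
    from the primitive of that series by a constant. *)
Lemma kz_pseries (G : C -> ncs) z0 : slit_plane z0 -> kz_on (@slit_plane R) G ->
  exists2 r : R, 0 < r & forall w, exists a, pseries r a (fun h => G (z0 + h) w).
Proof.
move=> zs dG; have /nbhs_modcP [d d0 dP] := slit_open zs.
have z00 : 0 < modc z0 by rewrite modc_gt0 slit_neq0.
have z01 : 0 < modc (1 - z0) by rewrite modc_gt0 slit_neq1.
pose r := Num.min d (Num.min (modc z0) (modc (1 - z0))).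
have r0 : 0 < r by rewrite !lt_min d0 z00 z01.
have rd : r <= d by rewrite ge_min lexx.
have rz : r <= modc z0 by rewrite !ge_min lexx orbT.
have rz1 : r <= modc (1 - z0) by rewrite !ge_min lexx !orbT.
exists r => // w.
have hs h : modc h < r -> slit_plane (z0 + h).
  by move=> hr; apply: dP; rewrite addrC addKr; exact: lt_le_trans rd.
have star h (t : R) : modc h < r -> 0 <= t <= 1 -> modc (0 + t%:C * (h - 0)) < r.
  move=> hr /andP[t0 t1]; rewrite add0r subr0 modcM modc_real ger0_norm//.
  by apply: le_lt_trans hr; rewrite ler_piMl ?modc_ge0.
have dsh f k h : is_cderive (z0 + h) f k -> is_cderive h (fun x => f (z0 + x)) k.
  move=> df; have := is_cderive_comp
    (is_cderiveD (is_cderive_cst h z0) (is_cderive_id h)) df.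
  by rewrite add0r mulr1.
elim: w => [|b v [a fa]].
  exists (cstc (G z0 [::])).
  apply: (pseries_ext (f := fun=> G z0 [::])); last exact: pseries_cst.
  move=> h hr; apply/esym.
  have -> : G z0 [::] = (fun h => G (z0 + h) [::]) 0 by rewrite addr0.
  apply: (@is_cderive0_star R [set h | modc h < r] 0 (fun h => G (z0 + h) [::]) star _
    h hr) => x xr; apply: (dsh (fun y => G y [::])).
  by have := dG _ (hs x xr) [::]; rewrite kz_form_nil.
have [c fc] : exists c, pseries r c
    (fun h => (if b then (1 - (z0 + h))^-1 else (z0 + h)^-1) * G (z0 + h) v).
  case: b.
    exists (divc (1 - z0) a).
    apply: (pseries_ext (f := fun h => G (z0 + h) v / ((1 - z0) - h))).
      by move=> h _; rewrite mulrC opprD addrA.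
    apply: pseries_div fa; first by rewrite r0.
    by move=> n; rewrite divcE// -modc_gt0.
  exists (fun n => -1 * divc (- z0) a n).
  apply: (pseries_ext (f := fun h => -1 * (G (z0 + h) v / (- z0 - h)))).
    by move=> h _; rewrite -opprD invrN mulrN mulN1r opprK mulrC.
  apply: pseriesZ; apply: pseries_div fa; first by rewrite r0 modcN.
  by move=> n; rewrite divcE// oppr_eq0 -modc_gt0.
have [g [gP _ dg]] := pseries_prim r0 fc.
pose k := G z0 (b :: v) - g 0.
exists (fun n => primc c n + cstc k n).
apply: (pseries_ext (f := fun h => g h + k)); last first.
  exact: pseriesD gP (pseries_cst _ _).
move=> h hr; pose f x := G (z0 + x) (b :: v) - g x.
have fk : f h = k.
  have -> : k = f 0 by rewrite /f addr0.
  apply: (@is_cderive0_star R [set h | modc h < r] 0 f star _ h hr) => x xr.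
  rewrite -(subrr ((if b then (1 - (z0 + x))^-1 else (z0 + x)^-1) * G (z0 + x) v)).
  apply: is_cderiveB (dg x xr); apply: (dsh (fun y => G y (b :: v))).
  by have := dG _ (hs x xr) (b :: v); rewrite kz_form_cons.
by rewrite -fk /f addrC subrK.
Qed.

Lemma kz_analytic (G : C -> ncs) z0 w : slit_plane z0 ->
  kz_on (@slit_plane R) G -> analytic_at (fun z => G z w) z0.
Proof.
move=> zs dG; have [r r0 /(_ w)[a [ga fa]]] := kz_pseries zs dG.
exists a; apply/nbhs_modcP; exists r => // z zr.
have := fa (z - z0) zr; rewrite addrCA subrr addr0 psumE; exact.
Qed.

Lemma analytic_pseries (f : C -> C) z0 : analytic_at f z0 ->
  exists2 r : R, 0 < r & exists a, pseries r a (fun h => f (z0 + h)).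
Proof.
move=> [a /nbhs_modcP [r r0 fa]].
have fh h : modc h < r -> psum a h @ \oo --> f (z0 + h).
  move=> hr; have := fa (z0 + h); rewrite [z0 + h - _]addrAC subrr add0r -psumE.
  by apply.
have [r' /andP[r'0 _] gP] := @psum_geom R a (fun h => f (z0 + h)) r r0 fh.
by exists r'; [exact: r'0|exists a].
Qed.

(** Vanishing near a point is propagated along the segment from 1/2 to z: it is an open condition,
    and closed by [pseries_zeros]. *)
Lemma analytic_zero (f : C -> C) : (forall z, slit_plane z -> analytic_at f z) ->
  (\forall z \near (2^-1 : C), f z = 0) -> forall z, slit_plane z -> f z = 0.
Proof.
move=> fan fh z zs.
have [->|zh] := eqVneq z 2^-1; first exact: nbhs_singleton fh.
pose ga (t : R) : C := 2^-1 + t%:C * (z - 2^-1).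
pose P t := \forall y \near ga t, f y = 0.
have gas t : 0 <= t <= 1 -> slit_plane (ga t) by exact: slit_star.
have m0 : 0 < modc (z - 2^-1) by rewrite modc_gt0 subr_eq0.
have gaB s t : modc (ga s - ga t) = `|s - t| * modc (z - 2^-1).
  have -> : ga s - ga t = (s - t)%:C * (z - 2^-1) by rewrite /ga rmorphB /=; ring.
  by rewrite modcM modc_real.
have Popen t : P t -> exists2 e : R, 0 < e & forall s, `|s - t| < e -> P s.
  move=> /nbhs_modcP [d d0 dP]; exists (d / 2 / modc (z - 2^-1)) => [|s].
    by rewrite !divr_gt0.
  rewrite (ltr_pdivlMr _ _ m0) => sd; apply/nbhs_modcP; exists (d / 2); first by rewrite divr_gt0.
  move=> y yd; apply: dP; rewrite -(subrKA (ga s)).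
  by apply: le_lt_trans (modcD _ _) _; rewrite gaB; lra.
have Pclosed t : 0 <= t <= 1 ->
    (forall e : R, 0 < e -> exists2 s, 0 < `|s - t| < e & P s) -> P t.
  move=> t01 tP; have [r r0 [a fa]] := analytic_pseries (fan _ (gas t t01)).
  have a0 : forall n, a n = 0.
    apply: (pseries_zeros r0 fa) => e e0.
    have [s /andP[s0 se] /nbhs_singleton Ps] := tP _ (divr_gt0 e0 m0).
    exists (ga s - ga t); last by rewrite addrCA subrr addr0.
    by rewrite gaB mulr_gt0//= -ltr_pdivlMr.
  apply/nbhs_modcP; exists r => // y yr.
  have := (fa.2 (y - ga t) yr); rewrite addrCA subrr addr0.
  move=> /cvgC_unique; apply; apply/cvg_psumP => e e0; exists 0%N => n _.
  by rewrite /psum big1 ?subrr ?modc0// => i _; rewrite a0 mul0r.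
(* Whole initial intervals are required, so that every parameter below the supremum satisfies
   [P]. *)
pose T : set R := [set t | 0 <= t <= 1 /\ forall s, 0 <= s <= t -> P s].
have P0 : P 0 by rewrite /P /ga mul0r addr0.
have T0 : T 0 by split; [rewrite lexx ler01|move=> s /le_anti <-].
have supT : has_sup T by split; [exists 0|exists 1 => t [/andP[]]].
pose tau := sup T.
have tau0 : 0 <= tau by apply: sup_ubound => //; case: supT.
have tau1 : tau <= 1 by apply: sup_le_ub; [exists 0|move=> t [/andP[]]].
have below s : 0 <= s -> s < tau -> P s.
  move=> s0 st; have [t [_ tP] st'] := sup_gt (ex_intro _ 0 T0) st.
  by apply: tP; rewrite s0 ltW.
have Ptau : P tau.
  have [->|tn0] := eqVneq tau 0; first exact: P0.
  have tp : 0 < tau by rewrite lt0r tn0.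
  apply: Pclosed => [|e e0]; first by rewrite tau0.
  pose s := Num.max (tau / 2) (tau - e / 2).
  have st : s < tau by rewrite gt_max; apply/andP; split; lra.
  have s0 : 0 <= s by rewrite le_max; apply/orP; left; lra.
  exists s; last exact: below.
  rewrite ltr0_norm ?subr_lt0//; apply/andP; split; first by lra.
  have : tau - e / 2 <= s by rewrite le_max lexx orbT.
  by lra.
suff tE : tau = 1.
  have := nbhs_singleton Ptau; rewrite tE /ga mul1r addrCA subrr addr0; exact.
apply/eqP; rewrite eq_le tau1 leNgt /=; apply/negP => t1.
have [e e0 eP] := Popen _ Ptau.
pose s := Num.min 1 (tau + e / 2).
have ts : tau < s by rewrite lt_min t1; lra.
suff : T s by move=> /(sup_ubound supT.2); rewrite leNgt ts.
split; first by rewrite (le_trans tau0 (ltW ts)) ge_min lexx.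
move=> x /andP[x0 xs]; have [xt|tx] := ltP x tau; first exact: below.
apply: eP; rewrite ger0_norm ?subr_ge0//.
have : s <= tau + e / 2 by rewrite ge_min lexx orbT.
by lra.
Qed.

Lemma analytic_sub (f g : C -> C) z : analytic_at f z -> analytic_at g z ->
  analytic_at (fun y => f y - g y) z.
Proof.
move=> [a fa] [b gb]; exists (fun n => a n - b n).
apply: filterS2 fa gb => y fy gy.
have -> : series (fun n => (a n - b n) * (y - z) ^+ n) =
    (fun N => series (fun n => a n * (y - z) ^+ n) N -
              series (fun n => b n * (y - z) ^+ n) N).
  apply/funext => N; rewrite /series /= -sumrB; apply: eq_bigr => n _; exact: mulrBl.
exact: cvgB fy gy.
Qed.

(** [Gsol] meets the description, so the chosen function meets it too; both have the same series
    near 1/2 and agree by the identity theorem. *)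
Lemma Li_h1E w z : h1_word w -> slit_plane z -> Li_h1 w z = Gsol z w.
Proof.
move=> hw zs; rewrite /Li_h1; set P := (X in xget _ X).
have PG : P (fun z => Gsol z w).
  split=> [y ys|y ys]; first exact: kz_analytic ys (@Gsol_kz R).
  rewrite normE -[1]/(1%:C) ltcR => y1; rewrite Gsol_loc// Gloc_h1//.
  exact: Li_sum_cvg.
have [fan fs] := xgetPex (fun=> 0) (ex_intro _ _ PG).
set f := xget _ P in fan fs *.
apply/eqP; rewrite -subr_eq0; apply/eqP.
apply: (@analytic_zero (fun y => f y - Gsol y w) _ _ z zs) => [y ys|].
  apply: analytic_sub; [exact: fan|exact: kz_analytic ys (@Gsol_kz R)].
have [h1 h2] := @unit_slit_half R.
have half1 : 0 < 1 - modc (2^-1 : C) by rewrite subr_gt0.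
apply: filterS2 (slit_open h1) (near_modc_lt 2^-1 half1) => y ys yh.
have y1 : modc y < 1.
  by have := modc_dist y 2^-1; lra.
apply/eqP; rewrite subr_eq0 Gsol_loc// Gloc_h1//; apply/eqP.
apply: cvgC_unique (fs y ys _) (Li_sum_cvg hw y1).
by rewrite normE -[1]/(1%:C) ltcR.
Qed.

End Polylogarithms.

(** * Expansions at 0 in powers of the logarithm *)

Section Asymptotics.
Local Open Scope classical_set_scope.
Local Open Scope ring_scope.
Variable R : realType.
Notation C := CC[R].
Implicit Types (z : C) (w v u : word) (f g : C -> C) (p q : {poly C}).

Definition to0 : set_system C := within (@slit_plane R) (nbhs (0 : C)).

Lemma to0P (P : set C) : to0 P <->
  exists2 e : R, 0 < e & forall z, slit_plane z -> modc z < e -> P z.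
Proof.
split=> [/nbhs_modcP [e e0 eP]|[e e0 eP]].
  by exists e => // z zs ze; apply: eP => //; rewrite subr0.
apply/nbhs_modcP; exists e => // z ze zs; apply: eP => //; by rewrite subr0 in ze.
Qed.

Global Instance to0_filter : ProperFilter to0.
Proof.
split; last exact: within_filter.
move=> /to0P [e e0 eP].
pose x := Num.min (e / 2) (1 / 2).
have x0 : 0 < x by rewrite lt_min !divr_gt0.
have xe : x <= e / 2 by rewrite ge_min lexx.
have x1 : x <= 1 / 2 by rewrite ge_min lexx orbT.
apply: (eP (x%:C : C)); first by move=> [_ /=] [|]; lra.
by rewrite modc_real gtr0_norm//; lra.
Qed.

Lemma cvg_to0P f (l : C) : f @ to0 --> l <-> forall e, 0 < e ->
  exists2 d : R, 0 < d & forall z, slit_plane z -> modc z < d -> modc (f z - l) < e.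
Proof.
split=> [/cvg_modcP fl e /fl /to0P //|fl].
by apply/cvg_modcP => e /fl /to0P.
Qed.

(* Negligible against all powers of the logarithm at 0. *)
Definition flat f := forall k, (fun z => f z * Log z ^+ k) @ to0 --> (0 : C).

Lemma cvg_to0_eq f g (l l' : C) : f =1 g -> l = l' -> f @ to0 --> l -> g @ to0 --> l'.
Proof. by move=> /funext -> ->. Qed.

Lemma flat_cvg f : flat f -> f @ to0 --> (0 : C).
Proof.
move=> f0; apply: (@cvg_to0_eq _ _ _ _ _ (erefl _) (f0 0%N)) => z.
by rewrite expr0 mulr1.
Qed.

Lemma flat_ext f g (e : R) : 0 < e ->
  (forall z, slit_plane z -> modc z < e -> f z = g z) -> flat f -> flat g.
Proof.
move=> e0 fg f0 k; apply/cvg_to0P => d /((cvg_to0P _ _).1 (f0 k)) [r r0 rP].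
exists (Num.min e r) => [|z zs]; first by rewrite lt_min e0.
by rewrite lt_min => /andP[ze zr]; rewrite -fg//; exact: rP.
Qed.

Lemma flatD f g : flat f -> flat g -> flat (fun z => f z + g z).
Proof.
move=> f0 g0 k; apply: (@cvg_to0_eq _ _ _ _ _ (addr0 0) (cvgD (f0 k) (g0 k))) => z.
by rewrite [RHS]mulrDl.
Qed.

Lemma flatZ (c : C) f : flat f -> flat (fun z => c * f z).
Proof.
move=> f0 k; apply: (@cvg_to0_eq _ _ _ _ _ (mulr0 c) (cvgM (cvg_cst c) (f0 k))) => z.
exact: mulrA.
Qed.

Lemma flat_mulLog n f : flat f -> flat (fun z => f z * Log z ^+ n).
Proof.
move=> f0 k; apply: (@cvg_to0_eq _ _ _ _ _ (erefl _) (f0 (n + k)%N)) => z.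
by rewrite exprD mulrA.
Qed.

Lemma flatM f g : flat f -> flat g -> flat (fun z => f z * g z).
Proof.
move=> f0 g0 k; apply: (@cvg_to0_eq _ _ _ _ _ (mulr0 0) (cvgM (flat_cvg f0) (g0 k))) => z.
by rewrite -[RHS]mulrA.
Qed.

Lemma flat0 : flat (fun=> 0).
Proof.
move=> k; apply/cvg_to0P => e e0; exists 1 => // z _ _.
by rewrite mul0r subrr modc0.
Qed.

Lemma flat_sum (I : Type) (r : seq I) (F : I -> C -> C) :
  (forall i, flat (F i)) -> flat (fun z => \sum_(i <- r) F i z).
Proof.
move=> F0; elim: r => [|i r IH].
  by apply: (@flat_ext (fun=> 0) _ 1) => [//|z _ _|]; [rewrite big_nil|exact: flat0].
apply: (@flat_ext (fun z => F i z + \sum_(j <- r) F j z) _ 1) => [//|z _ _|].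
  by rewrite big_cons.
exact: flatD.
Qed.

Lemma flat_poly p f : flat f -> flat (fun z => f z * p.[Log z]).
Proof.
move=> f0; apply: (@flat_ext
    (fun z => \sum_(i < size p) p`_i * (f z * Log z ^+ i)) _ 1) => [//|z _ _|].
  by rewrite horner_coef big_distrr; apply: eq_bigr => i _ /=; rewrite mulrCA.
by apply: flat_sum => i; apply: flatZ; exact: flat_mulLog.
Qed.

Lemma exprn_le_expR (y : R) n : 0 <= y -> y ^+ n.+1 <= n.+1`!%:R * expR y.
Proof.
move=> y0; rewrite mulrC -ler_pdivrMr ?ltr0n ?fact_gt0//.
by have := expR_ge1Dxn n y0; lra.
Qed.

Lemma flat_id : flat id.
Proof.
move=> k; apply/cvg_to0P => e e0.
(* With y = - ln |z| one has |Log z| <= y + pi and (y + pi)^(k+1) <= K exp y, so |z| |Log z|^k is at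
   most K / (y + pi); the radius d forces y > K / e. *)
pose K : R := k.+1`!%:R * expR pi.
have K0 : 0 < K by rewrite mulr_gt0 ?expR_gt0// ltr0n fact_gt0.
pose d := expR (- (K / e)).
exists (Num.min 1 d) => [|z zs]; first by rewrite lt_min ltr01 expR_gt0.
rewrite lt_min => /andP[z1 zd]; have z0 := slit_neq0 zs.
have m0 : 0 < modc z by rewrite modc_gt0.
pose y := - ln (modc z).
have yK : K / e < y by rewrite ltrNr -ltr_expR lnK.
have y0 : 0 < y by apply: lt_trans yK; rewrite divr_gt0.
have Y0 : 0 < y + pi by rewrite addr_gt0// pi_gt0.
rewrite subr0 modcM modcX.
have LY : modc (Log z) <= y + pi.
  apply: le_trans (modc_Log z0) _; rewrite lerD2r ltr0_norm//.
  by rewrite -oppr_gt0.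
have zE : modc z = (expR y)^-1 by rewrite -expRN opprK lnK.
apply: (@le_lt_trans _ _ ((expR y)^-1 * (y + pi) ^+ k)).
  by rewrite -zE ler_pM2l// lerXn2r ?nnegrE ?modc_ge0// ltW.
have := exprn_le_expR k (ltW Y0); rewrite expRD exprS => le1.
have le2 : (y + pi) * ((expR y)^-1 * (y + pi) ^+ k) <= K.
  have E0 : 0 < expR y by exact: expR_gt0.
  rewrite mulrCA mulrC ler_pdivrMr//; apply: le_trans le1 _.
  by rewrite /K -mulrA [expR y * _]mulrC.
rewrite -(ltr_pM2l Y0); apply: le_lt_trans le2 _.
rewrite -ltr_pdivrMr//; apply: lt_trans yK _; by rewrite ltrDl pi_gt0.
Qed.

Lemma flat_dom f (M d : R) : 0 < d ->
  (forall z, slit_plane z -> modc z < d -> modc (f z) <= M * modc z) -> flat f.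
Proof.
move=> d0 fM k; apply/cvg_to0P => e e0.
have M0 : 0 < `|M| + 1 by rewrite ltr_wpDl.
have [r r0 rP] := (cvg_to0P _ _).1 (flat_id k) _ (divr_gt0 e0 M0).
exists (Num.min d r) => [|z zs]; first by rewrite lt_min d0.
rewrite lt_min => /andP[zd zr]; have := rP z zs zr; rewrite !subr0 !modcM.
rewrite ltr_pdivlMr// => lt1; apply: le_lt_trans lt1.
have z0 := modc_ge0 z; rewrite [leRHS]mulrAC ler_wpM2r ?modc_ge0//.
apply: le_trans (fM z zs zd) _; rewrite mulrC ler_wpM2l//.
by have := ler_norm M; lra.
Qed.

Lemma Log_inv_cvg0 : (fun z => (Log z)^-1) @ to0 --> (0 : C).
Proof.
apply/cvg_to0P => e e0; exists (Num.min 1 (expR (- e^-1))).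
  by rewrite lt_min ltr01 expR_gt0.
move=> z zs; rewrite lt_min => /andP[z1 ze].
have m0 : 0 < modc z by rewrite modc_gt0 slit_neq0.
have l1 : e^-1 < - ln (modc z) by rewrite ltrNr -ltr_expR lnK.
have L1 : e^-1 < modc (Log z).
  apply: lt_le_trans l1 _; apply: le_trans (modc_Re _).
  by rewrite [complex.Re _]/= -/(modc z) -normrN ler_norm.
have e1 : 0 < e^-1 by rewrite invr_gt0.
by rewrite subr0 modcV -[e]invrK ltf_pV2// posrE//; exact: lt_trans L1.
Qed.

Lemma Log_neq0_near : \forall z \near to0, Log z != 0.
Proof.
apply/to0P; exists 1 => // z zs z1; apply/eqP => /(congr1 (@complex.Re R)) /=.
rewrite -/(modc z) => /eqP; rewrite ln_eq0 ?modc_gt0 ?slit_neq0//.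
by rewrite lt_eqF.
Qed.

(** Dividing by g, which tends to infinity, shows that p without its constant term, divided by X,
    also tends to 0. The filter is arbitrary because the lemma serves at 0 and along a sequence. *)
Lemma poly_cvg0 (T : Type) (F : set_system T) (FF : ProperFilter F) (g : T -> C) p :
  (fun t => (g t)^-1) @ F --> (0 : C) -> (\forall t \near F, g t != 0) ->
  (fun t => p.[g t]) @ F --> (0 : C) -> p = 0.
Proof.
move=> gV g0; elim/poly_ind: p => // p c IH pc.
have p0 : p = 0.
  have H : (fun t => (p * 'X + c%:P).[g t] * (g t)^-1 - c * (g t)^-1) @ F
      --> (0 * 0 - c * 0 : C).
    exact: (cvgB (cvgM pc gV) (cvgM (cvg_cst c) gV)).
  rewrite !mulr0 subr0 in H.
  apply: IH; apply/cvg_modcP => e e0.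
  apply: filterS2 ((cvg_modcP _ _ _).1 H e e0) g0 => t lt_e gt0.
  move: lt_e; rewrite !hornerE.
  by have -> : (p.[g t] * g t + c) / g t - c / g t = p.[g t] by field.
rewrite p0 mul0r add0r in pc *; suff -> : c = 0 by rewrite polyC0.
have cc : (fun=> c) @ F --> (0 : C).
  have <- : (fun t => (c%:P).[g t]) = (fun=> c) by apply/funext => t; rewrite hornerC.
  exact: pc.
exact: cvgC_unique (cvg_cst c) cc.
Qed.

Lemma poly_Log_cvg0 p : (fun z => p.[Log z]) @ to0 --> (0 : C) -> p = 0.
Proof. exact: poly_cvg0 Log_inv_cvg0 Log_neq0_near. Qed.

(** Asymptotic expansion in C[log z]. Such functions form an algebra, and [polyflat_uniq] makes p
    well defined, so p(0) can replace a limit that does not exist. *)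
Definition polyflat p f := flat (fun z => f z - p.[Log z]).

Lemma polyflatD p q f g : polyflat p f -> polyflat q g ->
  polyflat (p + q) (fun z => f z + g z).
Proof.
move=> fp gq; apply: (@flat_ext (fun z => (f z - p.[Log z]) + (g z - q.[Log z])) _ 1)
  => [//|z _ _|]; last exact: flatD.
by rewrite hornerD opprD addrACA.
Qed.

Lemma polyflatM p q f g : polyflat p f -> polyflat q g ->
  polyflat (p * q) (fun z => f z * g z).
Proof.
move=> fp gq; apply: (@flat_ext (fun z =>
    ((f z - p.[Log z]) * q.[Log z] + (g z - q.[Log z]) * p.[Log z]) +
    (f z - p.[Log z]) * (g z - q.[Log z])) _ 1) => [//|z _ _|].
  by rewrite hornerM; ring.
by apply: flatD; [apply: flatD; exact: flat_poly|exact: flatM].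
Qed.

Lemma polyflat_cst (c : C) : polyflat c%:P (fun=> c).
Proof.
apply: (@flat_ext (fun=> 0) _ 1) => [//|z _ _|]; last exact: flat0.
by rewrite hornerC subrr.
Qed.

Lemma polyflat_Log : polyflat 'X (fun z => Log z).
Proof.
apply: (@flat_ext (fun=> 0) _ 1) => [//|z _ _|]; last exact: flat0.
by rewrite hornerX subrr.
Qed.

Lemma polyflat_flat f : flat f -> polyflat 0 f.
Proof.
move=> f0; apply: (@flat_ext f _ 1) => [//|z _ _|//].
by rewrite horner0 subr0.
Qed.

Lemma polyflatZ (c : C) p f : polyflat p f -> polyflat (c *: p) (fun z => c * f z).
Proof. by rewrite -mul_polyC; apply: polyflatM; exact: polyflat_cst. Qed.

Lemma polyflat_ext p f g (e : R) : 0 < e ->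
  (forall z, slit_plane z -> modc z < e -> f z = g z) -> polyflat p f -> polyflat p g.
Proof. by move=> e0 fg; apply: (flat_ext e0) => z zs ze; rewrite fg. Qed.

Lemma polyflatX p f n : polyflat p f -> polyflat (p ^+ n) (fun z => f z ^+ n).
Proof.
move=> fp; elim: n => [|n IH].
  rewrite expr0 -polyC1; apply: (@polyflat_ext _ (fun=> 1) _ 1) => [//|z _ _|].
    by rewrite expr0.
  exact: polyflat_cst.
rewrite exprS; apply: (@polyflat_ext _ (fun z => f z * f z ^+ n) _ 1) => [//|z _ _|].
  by rewrite exprS.
exact: polyflatM.
Qed.

Lemma polyflat_sum (I : Type) (r : seq I) (F : I -> C -> C) (P : I -> {poly C}) :
  (forall i, polyflat (P i) (F i)) ->
  polyflat (\sum_(i <- r) P i) (fun z => \sum_(i <- r) F i z).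
Proof.
move=> FP; elim: r => [|i r IH].
  rewrite big_nil -polyC0; apply: (@polyflat_ext _ (fun=> 0) _ 1) => [//|z _ _|].
    by rewrite big_nil.
  exact: polyflat_cst.
rewrite big_cons; apply: (@polyflat_ext _
  (fun z => F i z + \sum_(j <- r) F j z) _ 1) => [//|z _ _|].
  by rewrite big_cons.
exact: polyflatD.
Qed.

Lemma polyflat_uniq p q f : polyflat p f -> polyflat q f -> p = q.
Proof.
move=> fp fq; apply/eqP; rewrite -subr_eq0; apply/eqP; apply: poly_Log_cvg0.
have z0 : 0 - 0 = 0 :> C by rewrite subrr.
apply: (@cvg_to0_eq _ _ _ _ _ z0 (cvgB (flat_cvg fq) (flat_cvg fp))) => z.
rewrite hornerD hornerN.
by rewrite -[LHS]/((f z - q.[Log z]) - (f z - p.[Log z])) opprB addrC addrA subrK.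
Qed.

Lemma polyflat_cvg p f (l : C) : polyflat p f -> f @ to0 --> l -> p = l%:P.
Proof.
move=> fp fl; apply/eqP; rewrite -subr_eq0; apply/eqP; apply: poly_Log_cvg0.
have l0 : l - 0 - l = 0 by rewrite subr0 subrr.
apply: (@cvg_to0_eq _ _ _ _ _ l0 (cvgB (cvgB fl (flat_cvg fp)) (cvg_cst l))) => z.
rewrite hornerD hornerN hornerC.
by rewrite -[LHS]/(f z - (f z - p.[Log z]) - l) opprB addrCA subrr addr0.
Qed.

Lemma Hloc_flat b w : flat (Hloc (b :: w)).
Proof.
have [g gP gE] := pseries_drop ltr01 (HlocP R (b :: w)) (Hcoef0 R (b :: w)).
have /(cvg_modcP (nbhs_filter (0 : C)))/(_ 1 ltr01)/nbhs_modcP[d d0 dP] :=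
  pseries_cont0 ltr01 gP.
apply: (@flat_dom _ (modc (g 0) + 1) (Num.min 1 d)).
  by rewrite lt_min ltr01.
move=> z zs; rewrite lt_min => /andP[z1 zd]; rewrite gE// modcM mulrC.
apply: ler_wpM2r; first exact: modc_ge0.
have := dP z; rewrite subr0 => /(_ zd); have := modc_dist (g z) (g 0); lra.
Qed.

(** The coefficient of w in z^X, as a polynomial in log z. *)
Definition log_poly w : {poly C} :=
  (inv_fact R w * (w == nseq (size w) lx)%:R) *: 'X ^+ (size w).

(** In H z^X every coefficient of H on a nonempty word vanishes at 0 and is flat, so z^X alone
    contributes to the expansion. *)
Lemma Gsol_polyflat w : polyflat (log_poly w) (fun z => Gsol z w).
Proof.
apply: (@polyflat_ext _ (fun z => Gloc z w) _ 1) => // [z zs z1|].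
  by rewrite Gsol_loc.
pose F i z := Hloc (take i w) z * nc_pow z (nc_letter C lx) (drop i w).
have PF v z : nc_pow z (nc_letter C lx) v = (log_poly v).[Log z].
  rewrite /nc_pow nc_exp_letter /log_poly hornerZ hornerXn /inv_fact.
  by rewrite mulrCA mulrC -mulrA mulrCA mulrA.
apply: (@polyflat_ext _ (fun z => (log_poly w).[Log z] +
    \sum_(i < size w) F i.+1 z) _ 1) => // [z zs z1|].
  rewrite /Gloc nc_mulE big_ord_recl take0 drop0 /= /Hser Hloc_nil// mul1r.
  by rewrite PF.
rewrite -[X in polyflat X _]addr0; apply: polyflatD.
  apply: (@flat_ext (fun=> 0) _ 1) => [//|z _ _|]; last exact: flat0.
  by rewrite subrr.
apply: polyflat_flat; apply: flat_sum => i; rewrite /F.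
apply: (@flat_ext (fun z => Hloc (take i.+1 w) z *
  (log_poly (drop i.+1 w)).[Log z]) _ 1) => [//|z _ _|].
  by rewrite PF.
apply: flat_poly; case: (w) i => [|b v] i; first by case: i.
exact: Hloc_flat.
Qed.

End Asymptotics.

(** * Shuffle relations of the solution; identification of G_0 *)

Section ShuffleRelations.
Local Open Scope classical_set_scope.
Local Open Scope ring_scope.
Variable R : realType.
Notation C := CC[R].
Implicit Types (z : C) (w v u : word).

Lemma eq_nseq_all b (w : word) : (w == nseq (size w) b) = all (pred1 b) w.
Proof. by apply/eqP/all_pred1P. Qed.

Lemma all_shuffles (a : pred bool) u v w : w \in shuffles u v ->
  all a w = all a u && all a v.
Proof.
elim: u v w => [|x u IHu] v w; first by rewrite inE => /eqP ->.
elim: v w => [|y v IHv] w; first by rewrite inE => /eqP ->; rewrite andbT.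
rewrite shuffles_cons mem_cat => /orP[|] /mapP [t ts ->] /=.
  by rewrite (IHu _ _ ts) /= andbA.
by rewrite (IHv _ ts) /= andbCA.
Qed.

Lemma log_poly_character u v :
  shsum (log_poly R) u v = log_poly R u * log_poly R v.
Proof.
rewrite /log_poly !eq_nseq_all -scalerAl -scalerAr scalerA -exprD.
rewrite mulrACA -(@inv_fact_character R) -natrM mulnb /shsum big_distrl scaler_suml.
rewrite big_seq [RHS]big_seq; apply: eq_bigr => w ws.
by rewrite eq_nseq_all (all_shuffles _ ws) (size_shuffles ws).
Qed.

Lemma Gsol_nil z : slit_plane z -> Gsol z [::] = 1.
Proof.
move=> zs; rewrite (kz_cst (@slit_star R) (@Gsol_kz R) zs).
have [h1 h2] := @unit_slit_half R.
by rewrite Gsol_loc// Gloc_h1// Hloc_nil.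
Qed.

Lemma cst_flat0 (f : C -> C) (p : {poly C}) : (forall z, slit_plane z -> is_cderive z f 0) ->
  polyflat p f -> forall z, slit_plane z -> f z = p`_0.
Proof.
move=> df fp z zs; have fc := is_cderive0_star (@slit_star R) df.
rewrite (fc z zs) (@polyflat_cvg R p f (f 2^-1) fp) ?coefC//.
by apply/cvg_to0P => e e0; exists 1 => // y ys _; rewrite (fc y ys) subrr modc0.
Qed.

Lemma shsum_derive (G : C -> word -> C) (k z : C) u v (a : bool) :
  (forall w, is_cderive z (fun t => G t (a :: w)) (k * G z w)) ->
  is_cderive z (fun t => shsum (G t \o cons a) u v) (k * shsum (G z) u v).
Proof. by move=> dG; rewrite big_distrr; apply: is_cderive_sum => w; apply: dG. Qed.

(** By induction on the lengths the difference of the two sides has zero derivative. Its constant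
    value is read off from its expansion, which is 0 because z^X itself satisfies the shuffle
    relations. *)
Lemma Gsol_character z u v : slit_plane z ->
  shsum (Gsol z) u v = Gsol z u * Gsol z v.
Proof.
move=> zs; have [n] := ubnP (size u + size v); elim: n u v z zs => // n IH u v z zs.
case: u => [_|a u]; first by rewrite shsum0w Gsol_nil// mul1r.
case: v => [_|b v]; first by rewrite shsumw0 Gsol_nil// mulr1.
rewrite ltnS => sz; apply/eqP; rewrite -subr_eq0; apply/eqP.
pose f (t : C) := shsum (Gsol t) (a :: u) (b :: v) - Gsol t (a :: u) * Gsol t (b :: v).
pose p := shsum (log_poly R) (a :: u) (b :: v) - log_poly R (a :: u) * log_poly R (b :: v).
have fp : polyflat p f.
  apply: (@polyflat_ext _ _ (fun t : C => shsum (Gsol t) (a :: u) (b :: v) +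
    -1 * (Gsol t (a :: u) * Gsol t (b :: v))) _ 1) => [//|t _ _|].
    by rewrite mulN1r.
  rewrite /p -scaleN1r; apply: polyflatD.
    by apply: polyflat_sum => w; exact: Gsol_polyflat.
  by apply: polyflatZ; apply: polyflatM; exact: Gsol_polyflat.
rewrite -[LHS]/(f z) (@cst_flat0 f p) //.
  by rewrite /p log_poly_character subrr coef0.
move=> y ys; pose k (c : bool) : C := if c then (1 - y)^-1 else y^-1.
have dG c w : is_cderive y (fun t : C => Gsol t (c :: w)) (k c * Gsol y w).
  by have := Gsol_kz ys (c :: w); rewrite kz_form_cons.
have d1 := is_cderiveD (shsum_derive u (b :: v) (dG a)) (shsum_derive (a :: u) v (dG b)).
have d2 := is_cderiveM (dG a u) (dG b v).
have -> : f = fun t : C => (shsum (Gsol t \o cons a) u (b :: v) +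
    shsum (Gsol t \o cons b) (a :: u) v) - Gsol t (a :: u) * Gsol t (b :: v).
  by apply/funext => t; rewrite /f shsum_cons.
apply: is_cderive_eq (is_cderiveB d1 d2) _.
rewrite !IH//; last by rewrite /= addnS in sz.
by ring.
Qed.

Lemma Gsol_x z : slit_plane z -> Gsol z [:: lx] = Log z.
Proof.
move=> zs; apply/eqP; rewrite -subr_eq0; apply/eqP.
rewrite (@cst_flat0 (fun z : C => Gsol z [:: lx] - Log z) (log_poly R [:: lx] - 'X)) //.
- by rewrite /log_poly /inv_fact /= expr1 invr1 mul1r scale1r subrr coef0.
- move=> y ys; have := is_cderiveB (Gsol_kz ys [:: lx]) (is_cderive_Log (slit_cut ys)).
  by rewrite kz_form_cons Gsol_nil// mulr1 subrr.
- apply: (@polyflat_ext _ _ (fun t : C => Gsol t [:: lx] + -1 * Log t) _ 1) => [//|t _ _|].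
    by rewrite mulN1r.
  rewrite -scaleN1r; apply: polyflatD; first exact: Gsol_polyflat.
  by apply: polyflatZ; exact: polyflat_Log.
Qed.

Lemma Log1B_flat : flat (fun z : C => Log (1 - z)).
Proof.
have c1 : cut_plane (1 : C) by move=> [_ /=]; rewrite lt_geF.
have [r r0 rP] := is_cderive_Log c1 ltr01.
apply: (@flat_dom _ _ 2 r r0) => z zs zr.
have := rP (- z); rewrite modcN Log1 subr0 invr1 mul1r mul1r => /(_ zr) h.
have := modc_dist (Log (1 - z)) (- z); rewrite modcN.
lra.
Qed.

Lemma Gsol_y z : slit_plane z -> Gsol z [:: ly] = - Log (1 - z).
Proof.
move=> zs; apply/eqP; rewrite -addr_eq0; apply/eqP.
rewrite (@cst_flat0 (fun z : C => Gsol z [:: ly] + Log (1 - z)) (log_poly R [:: ly] + 0)) //.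
- by rewrite addr0 /log_poly mulr0 scale0r coef0.
- move=> y ys; have := is_cderiveD (Gsol_kz ys [:: ly]) (is_cderive_Log1B ys).
  by rewrite kz_form_cons Gsol_nil// mulr1 subrr.
- apply: polyflatD; first exact: Gsol_polyflat.
  by apply: polyflat_flat; exact: Log1B_flat.
Qed.

Lemma lift_shuffle (c : word -> C) (L := fglift (c : word -> C^o) : hspace R -> C^o) :
  (forall u v, shsum c u v = c u * c v) ->
  forall p q, L (shuffle p q) = L p * L q.
Proof.
move=> cM; have lL : linear L by exact: fglift_is_linear.
have LU u : L << u >> = c u by exact: fglift1.
move=> p q.
have lmul (k : C) : linear (fun p => L p * k : C^o).
  by move=> a x y; rewrite lL mulrDl -[a *: L x]/(a * L x) -mulrA.
move: p; apply: (@linear_freeg_ext _ _ C^o (fun p => L (shuffle p q)) (fun p => L p * L q)).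
+ by move=> a x y; rewrite (shuffle_linearl q a x y) lL.
+ exact: lmul.
move=> u; move: q; apply: (@linear_freeg_ext _ _ C^o
  (fun q => L (shuffle << u >> q)) (fun q => L << u >> * L q)).
+ by move=> a x y; rewrite (shuffle_linearr << u >> a x y) lL.
+ move=> a x y; rewrite lL mulrDr; congr (_ + _).
  by rewrite -[a *: L x]/(a * L x) mulrCA.
move=> v; rewrite shuffleU !LU -cM (linear_map_sum lL).
by apply: eq_bigr => x _; rewrite LU.
Qed.

(** The shuffle relations make [Gsol] an admissible choice for [Li]; any other agrees with it on h^1
    and at x, hence everywhere by [trailing_ext]. *)
Lemma Li_Gsol z w : slit_plane z -> Li z << w >> = Gsol z w.
Proof.
move=> zs; rewrite /Li; set P := (X in xget _ X).
have PG : P (fglift (Gsol z : word -> C^o)).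
  split.
  - exact: fglift_is_linear.
  - by apply: lift_shuffle => u v; exact: Gsol_character.
  - by move=> v hv; rewrite fglift1 Li_h1E.
  - by rewrite fglift1 Gsol_x.
have [lL LM Lh1 Lx] := xgetPex (fun=> 0) (ex_intro _ _ PG).
set L := xget _ P in lL LM Lh1 Lx *.
apply: (@trailing_ext _ (fun w => L << w >>) (Gsol z)) => [v|v||v hv].
- by rewrite -LM shuffleU (linear_map_sum lL).
- exact: Gsol_character.
- by rewrite Lx Gsol_x.
- by rewrite Lh1// Li_h1E.
Qed.

Lemma G0_Gsol z : slit_plane z -> G0 z = Gsol z.
Proof. by move=> zs; apply/funext => w; exact: Li_Gsol. Qed.

End ShuffleRelations.

(** * The solution normalized at 1 *)

Section Reflection.
Local Open Scope classical_set_scope.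
Local Open Scope ring_scope.
Variable R : realType.
Notation C := CC[R].
Notation ncs := (ncseries C bool).
Notation ncX := (nc_letter C lx).
Notation ncY := (nc_letter C ly).
Implicit Types (z u : C) (w v : word) (f g : ncs).

(* f(X, Y) becomes f(-Y, -X). *)
Definition flip f : ncs := fun w => (-1) ^+ size w * f (map negb w).

Lemma flipM f g : flip (f * g) = flip f * flip g.
Proof.
apply/funext => w; rewrite /flip !nc_mulE size_map big_distrr.
apply: eq_bigr => i _ /=; rewrite map_take map_drop mulrACA -exprD.
by rewrite -size_cat cat_take_drop.
Qed.

Lemma flip_exp (a : C) : flip (nc_exp (a *: ncX)) = nc_exp ((- a) *: ncY).
Proof.
apply/funext => w; rewrite /flip !nc_exp_letter size_map.
have -> : (map negb w == nseq (size w) lx) = (w == nseq (size w) ly).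
  have -> : nseq (size w) lx = map negb (nseq (size w) ly) by rewrite map_nseq.
  by rewrite inj_eq//; apply: inj_map; exact: negb_inj.
by rewrite [(- a) ^+ _]exprNn; ring.
Qed.

Definition Grefl z : ncs := flip (Gsol (1 - z)).

Lemma Grefl_kz : kz_on (@slit_plane R) Grefl.
Proof.
move=> z zs [|b w].
  rewrite kz_form_nil; have := @Gsol_kz R _ (slit_subr zs) [::].
  rewrite kz_form_nil => d0.
  have d1 := is_cderiveB (is_cderive_cst z 1) (is_cderive_id z).
  apply: is_cderive_eq (is_cderiveZ ((-1) ^+ 0) (is_cderive_comp d1 d0)) _.
  by rewrite mul0r mulr0.
have := @Gsol_kz R _ (slit_subr zs) (~~ b :: map negb w).
rewrite !kz_form_cons => d0.
have d1 := is_cderiveB (is_cderive_cst z 1) (is_cderive_id z).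
apply: is_cderive_eq (is_cderiveZ ((-1) ^+ (size w).+1) (is_cderive_comp d1 d0)) _.
rewrite /Grefl /flip subKr exprS sub0r.
by case: b {d0} => /=; ring.
Qed.

Lemma Hser_cvg w : (fun z => Hser z w) @ (0 : C) --> ((w == [::])%:R : C).
Proof.
by rewrite -(Hloc0 R w); apply: pseries_cont0 ltr01 (HlocP R w).
Qed.

Lemma Grefl_cvg w : (fun z => (Grefl z * nc_pow (1 - z) ncY) w : C) @
  within (@slit_plane R) (nbhs (1 : C)) --> ((1 : ncs) w : C).
Proof.
apply/cvg_modcP => e e0.
have m0 : 0 < modc ((-1) ^+ size w : C) by rewrite modcX modcN modc1 expr1n.
have /(cvg_modcP (nbhs_filter (0 : C)))/(_ e e0)/nbhs_modcP[d d0 dP] :=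
  @Hser_cvg (map negb w).
apply/nbhs_modcP; exists (Num.min 1 d) => [|z]; first by rewrite lt_min ltr01.
rewrite modc_sub lt_min => /andP[z1 zd] zs.
(* [flip] sends (1 - z)^X to (1 - z)^(-Y), which cancels against (1 - z)^Y and leaves the
   holomorphic factor. *)
have -> : Grefl z * nc_pow (1 - z) ncY = flip (Hser (1 - z)).
  rewrite /Grefl Gsol_loc//; last exact: slit_subr.
  rewrite /nc_pow -[Log (1 - z) in LHS]opprK -flip_exp -flipM /Gloc -mulrA.
  by rewrite /nc_pow nc_exp_scaleN// mulr1.
have -> : (1 : ncs) w = (-1) ^+ size w * (map negb w == [::])%:R.
  by rewrite nc_oneE; case: (w) => [|? ?]; rewrite /= ?expr0 ?mulr1 ?mulr0.
rewrite /flip -mulrBr modcM modcX modcN modc1 expr1n mul1r.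
by apply: dP; rewrite subr0.
Qed.

Lemma KZ_solutionP (G : C -> ncs) : KZ_solution G <-> kz_on (@slit_plane R) G.
Proof. by split=> dG z zs w; apply/is_cderiveP; exact: dG. Qed.

Lemma within1_proper : ProperFilter (within (@slit_plane R) (nbhs (1 : C))).
Proof.
split; last exact: within_filter.
move=> /nbhs_modcP [e e0 eP].
have H : to0 (fun z : C => slit_plane z /\ modc z < e) by apply/to0P; exists e.
have [z [zs ze]] := filter_ex H.
apply: (eP (1 - z)); last exact: slit_subr.
by rewrite addrAC subrr add0r modcN.
Qed.

(** The difference D of two normalized solutions is 0 by [kz_zero]: where D vanishes on shorter
    words, the factor (1 - z)^Y does not change its coefficient, so the constant equals the limit
    0. *)
Lemma G1E z : slit_plane z -> G1 z = Grefl z.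
Proof.
move=> zs; rewrite /G1; set P := (X in xget _ X).
have PG : P Grefl.
  by split; [apply/KZ_solutionP; exact: Grefl_kz|exact: Grefl_cvg].
have [/KZ_solutionP dG limG] := xgetPex (fun=> 0) (ex_intro _ _ PG).
set G := xget _ P in dG limG *.
apply/eqP; rewrite -subr_eq0; apply/eqP.
apply: (kz_zero (@slit_star R) (kz_onB dG Grefl_kz) _ zs) => w E0 Ecst.
set k := (X in X = 0); have FF := within1_proper.
have lim0 : (fun z => (G z * nc_pow (1 - z) ncY) w - (Grefl z * nc_pow (1 - z) ncY) w : C)
    @ within (@slit_plane R) (nbhs (1 : C)) --> ((1 : ncs) w - (1 : ncs) w : C).
  exact: (cvgB (limG w) (@Grefl_cvg w)).
rewrite subrr in lim0.
apply: cvgC_unique lim0; apply/cvg_modcP => e e0.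
apply/nbhs_modcP; exists 1 => // y _ ys.
suff -> : (G y * nc_pow (1 - y) ncY) w - (Grefl y * nc_pow (1 - y) ncY) w = k.
  by rewrite subrr modc0.
rewrite -nc_oppE -nc_addE -mulrBl nc_mulE big_ord_recr /= take_size drop_size.
rewrite /nc_pow nc_exp_letter /= expr0 divr1 !mulr1 big1 ?add0r => [|i _]; first exact: Ecst.
by rewrite E0 ?mul0r// size_takel// ltnW.
Qed.

End Reflection.

(** * Landen's connection formula in the free algebra *)

Section Landen.
Local Open Scope classical_set_scope.
Local Open Scope ring_scope.
Variable R : realType.
Notation C := CC[R].
Notation ncs := (ncseries C bool).
Notation ncX := (nc_letter C lx).
Notation ncY := (nc_letter C ly).
Implicit Types (z u : C) (w v : word).

Lemma nc_subst_sumE (A : eqType) (c : ncs) (f g : ncseries C A) (v : seq A) : nc_subst c f g v =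
  \sum_(n < (size v).+1) \sum_(w <- words n) c w * mon f g w v.
Proof. by rewrite nc_substE; apply: eq_bigr => n _; rewrite /homp nc_sumE. Qed.

Lemma nc_subst_derive z (G : C -> ncs) (f g D : ncs) : is_ncderive z G D ->
  is_ncderive z (fun t => nc_subst (G t) f g) (nc_subst D f g).
Proof.
move=> dG v; rewrite nc_subst_sumE.
have -> : (fun t => nc_subst (G t) f g v) = (fun t =>
    \sum_(n < (size v).+1) \sum_(w <- words n) mon f g w v * G t w).
  apply/funext => t; rewrite nc_subst_sumE; apply: eq_bigr => n _.
  by apply: eq_bigr => w _; rewrite mulrC.
apply: is_cderive_sum => n.
rewrite (eq_bigr (fun w => mon f g w v * D w)) => [|w _]; last by rewrite mulrC.
by apply: is_cderive_sum => w; apply: is_cderiveZ.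
Qed.

Lemma is_ncderive_comp z (G : C -> ncs) (h : C -> C) (D : ncs) (d : C) :
  is_cderive z h d -> is_ncderive (h z) G D -> is_ncderive z (G \o h) (d *: D).
Proof.
by move=> dh dG w; rewrite nc_scaleE mulrC; exact: is_cderive_comp dh (dG w).
Qed.

(** For v = u / (u - 1), dv / v = du / u + du / (1 - u) and dv / (1 - v) = - du / (1 - u). Hence X
    dv / v + (X - Y) dv / (1 - v) is the KZ form in u. *)
Definition dual_letter : ncs := ncX - ncY.

Lemma dual_letter_nil : nilfree dual_letter.
Proof. by apply: nilfreeD => //; exact: nilfreeN. Qed.

Lemma half_opp_div (s : bool) u : half_plane s u ->
  [/\ slit_plane (u / (u - 1)), half_plane s (u / (1 - u)) &
      u / (u - 1) = - (u / (1 - u))].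
Proof.
move=> us; have u1 := slit_neq1 (half_slit us).
have E : u / (u - 1) = - (u / (1 - u)) by rewrite -[u - 1]opprB invrN mulrN.
suff h : half_plane s (u / (1 - u)).
  split=> //; rewrite E; apply: (@half_slit R (~~ s)).
  move: h; rewrite /half_plane /= ImN.
  by case: s {us} => /=; rewrite ?expr1 ?expr0 ?mulN1r ?mul1r ?opprK.
move: us; rewrite /half_plane /=.
have -> : complex.Im (u / (1 - u)) = complex.Im u / modc (1 - u) ^+ 2.
  have m2 : modc (1 - u) ^+ 2 = complex.Re (1 - u) ^+ 2 + complex.Im (1 - u) ^+ 2.
    by rewrite modc_def sqr_sqrtr// addr_ge0// sqr_ge0.
  rewrite ImM m2 ReB ImB; case: u {u1 E m2} => a b /=; rewrite -/(1 - a); ring.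
by move=> us; rewrite mulrA divr_gt0// exprn_gt0// modc_gt0.
Qed.

Definition landen (s : bool) u : ncs :=
  nc_subst (Gsol (u / (u - 1))) ncX dual_letter *
  nc_exp ((0 +i* ((-1) ^+ s * pi) : C) *: ncX).

Lemma landen_kz s : kz_on (@half_plane R s) (landen s).
Proof.
move=> u us; apply: kz_onMr us => {}u us.
have [vs _ _] := half_opp_div us.
have u0 := slit_neq0 (half_slit us); have u1 := slit_neq1 (half_slit us).
have u1' : u - 1 != 0 by rewrite -opprB oppr_eq0.
have w1 : 1 - u / (u - 1) = - (u - 1)^-1 by field.
have dual0 := dual_letter_nil.
have dsub := is_cderiveB (is_cderive_id u) (is_cderive_cst u 1).
have dv := is_cderiveM (is_cderive_id u)
  (@is_cderiveV _ u (fun t => t - 1) _ u1' dsub).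
have dG : is_ncderive (u / (u - 1)) (@Gsol R) _ := Gsol_kz vs.
have := nc_subst_derive ncX dual_letter (is_ncderive_comp dv dG).
congr is_ncderive; rewrite nc_substZ// nc_substM// /kz_form.
rewrite nc_substD// !nc_substZ// nc_subst_X// nc_subst_Y// scalerAl.
congr (_ * _); rewrite /dual_letter scalerBr scalerDr !scalerBr !scalerA addrA.
rewrite -scalerDl -scalerN; congr (_ *: _ + _).
  by rewrite w1; field; rewrite u0 u1'.
rewrite scalerN -scaleNr; congr (_ *: _).
by rewrite w1; field; rewrite u1 u1'.
Qed.

Lemma half_plane_star s z (t : R) : half_plane s z -> 0 <= t <= 1 ->
  half_plane s ((0 +i* (-1) ^+ s) + t%:C * (z - (0 +i* (-1) ^+ s)) : C).
Proof.
rewrite /half_plane /= => zs /andP[t0 t1].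
rewrite ImD ImM ImB /= mul0r addr0.
have -> : (-1) ^+ s * ((-1) ^+ s + t * (complex.Im z - (-1) ^+ s)) =
    (1 - t) * ((-1) ^+ s * (-1) ^+ s) + t * ((-1) ^+ s * complex.Im z) by ring.
rewrite -expr2 sqrr_sign mulr1.
have [->|tn0] := eqVneq t 0; first by rewrite mul0r; lra.
have : 0 < t * ((-1) ^+ s * complex.Im z) by rewrite mulr_gt0// lt0r tn0.
lra.
Qed.

(** Near 0 the sign is absorbed: Log (u / (u - 1)) plus or minus pi i is Log u - Log (1 - u). This
    form makes sense on the whole slit plane, where expansions at 0 are taken. *)
Definition landen_loc u : ncs :=
  nc_subst (Hser (u / (u - 1))) ncX dual_letter *
  nc_exp ((Log u - Log (1 - u)) *: ncX).

Lemma modc_landen (u : C) : modc u < 1 / 2 -> modc (u / (u - 1)) <= 2 * modc u.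
Proof.
move=> u2; have h : 1 / 2 <= modc (u - 1).
  by have := modc_dist 1 u; rewrite modc1 modc_sub; lra.
have h0 : 0 < modc (u - 1) by lra.
rewrite modcM modcV ler_pdivrMr//; have := modc_ge0 u; nra.
Qed.

Lemma landen_locE s u : half_plane s u -> modc u < 1 / 2 -> landen s u = landen_loc u.
Proof.
move=> us u2; have [vs qs vE] := half_opp_div us.
have v1 : modc (u / (u - 1)) < 1 by have := modc_landen u2; lra.
have d0 := dual_letter_nil; have X0 : nilfree ncX by [].
rewrite /landen (Gsol_loc vs v1) /Gloc (nc_substM _ _ X0 d0).
rewrite /nc_pow (nc_subst_exp X0 d0 (nilfreeZ _ X0)).
rewrite (nc_substZ _ _ X0 d0) (nc_subst_X X0 d0).
rewrite -mulrA -(nc_exp_scaleD _ _ X0) /landen_loc; congr (_ * nc_exp (_ *: _)).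
by rewrite vE (Log_opp qs) subrK (Log_div1B (half_slit us)).
Qed.

Lemma landen_Hser_polyflat v : polyflat ((1 : ncs) v)%:P
  (fun u : C => nc_subst (Hser (u / (u - 1))) ncX dual_letter v).
Proof.
have d0 := dual_letter_nil.
rewrite -(@nc_subst1 R bool ncX dual_letter)// nc_subst_sumE rmorph_sum /=.
apply: (@polyflat_ext _ _ (fun u => \sum_(n < (size v).+1) \sum_(w <- words n)
   mon ncX dual_letter w v * Hser (u / (u - 1)) w) _ 1) => // [u us u1|].
  rewrite nc_subst_sumE; apply: eq_bigr => n _.
  by apply: eq_bigr => w _; rewrite mulrC.
apply: polyflat_sum => n; rewrite rmorph_sum; apply: polyflat_sum => w.
rewrite mulrC /= -[((_ * _)%:P)]mul1r polyCM mul1r mul_polyC; apply: polyflatZ.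
have half : 0 < 1 / 2 :> R by rewrite divr_gt0.
case: w => [|b w].
  apply: (@polyflat_ext _ _ (fun=> 1) _ (1 / 2)) => // [u us u2|].
    by rewrite /Hser Hloc_nil//; have := modc_landen u2; lra.
  exact: polyflat_cst.
apply: polyflat_flat.
have [g gP gE] := pseries_drop ltr01 (HlocP R (b :: w)) (Hcoef0 R (b :: w)).
have /(cvg_modcP (nbhs_filter (0 : C)))/(_ 1 ltr01)/nbhs_modcP[d d0' dP] :=
  pseries_cont0 ltr01 gP.
apply: (@flat_dom R _ ((modc (g 0) + 1) * 2) (Num.min (1 / 2) (d / 2))).
  by rewrite lt_min half divr_gt0.
move=> u us; rewrite lt_min => /andP[u2 ud]; have le_u := modc_landen u2.
rewrite /Hser gE; last lra.
rewrite modcM mulrC -mulrA; apply: ler_pM; rewrite ?modc_ge0//.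
have := dP (u / (u - 1)); rewrite subr0 => H'.
have := modc_dist (g (u / (u - 1))) (g 0).
have := H' _; lra.
Qed.

Lemma landen_loc_polyflat w : polyflat (log_poly R w) (fun u : C => landen_loc u w).
Proof.
pose E (u : C) (v : word) : C := nc_exp ((Log u - Log (1 - u)) *: ncX) v.
pose S (u : C) v := nc_subst (Hser (u / (u - 1))) ncX dual_letter v.
have PE v : polyflat (log_poly R v) (fun u => E u v).
  apply: (@polyflat_ext _ _ (fun u => (inv_fact R v * (v == nseq (size v) lx)%:R) *
     (Log u - Log (1 - u)) ^+ size v) _ 1) => [//|u _ _|].
    by rewrite /E nc_exp_letter /inv_fact; ring.
  apply: polyflatZ; apply: polyflatX.
  have -> : 'X = 'X + -1 *: 0 :> {poly C} by rewrite scaler0 addr0.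
  apply: polyflatD; first exact: polyflat_Log.
  apply: (@polyflat_ext _ _ (fun u : C => -1 * Log (1 - u)) _ 1) => [//|u _ _|].
    by rewrite mulN1r.
  by apply: polyflatZ; apply: polyflat_flat; exact: Log1B_flat.
have -> : log_poly R w = \sum_(i < (size w).+1)
    ((1 : ncs) (take i w))%:P * log_poly R (drop i w).
  rewrite big_ord_recl take0 drop0 nc_oneE mul1r big1 ?addr0// => i _.
  by rewrite nc_oneE; case: (w) i => [|b v] i; [case: i|rewrite mul0r].
apply: (@polyflat_ext _ _ (fun u => \sum_(i < (size w).+1)
  S u (take i w) * E u (drop i w)) _ 1) => [//|u _ _|].
  by rewrite /landen_loc nc_mulE.
apply: polyflat_sum => i; apply: polyflatM; last exact: PE.
exact: landen_Hser_polyflat.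
Qed.

Lemma landenE s u : half_plane s u -> landen s u = Gsol u.
Proof.
move=> us; apply/eqP; rewrite -subr_eq0; apply/eqP.
have dG : kz_on (@half_plane R s) (@Gsol R).
  by move=> z /half_slit zs; exact: Gsol_kz zs.
apply: (kz_zero (a := 0 +i* (-1) ^+ s) _ (kz_onB (@landen_kz s) dG) _ us).
  by move=> z t; exact: half_plane_star.
move=> w _ Ecst; set k := (X in X = 0).
have h : polyflat (log_poly R w - log_poly R w)
    (fun u : C => landen_loc u w - Gsol u w).
  rewrite -[X in _ + X]scaleN1r.
  apply: (@polyflat_ext _ _ (fun u : C => landen_loc u w + -1 * Gsol u w) _ 1)
    => [//|z _ _|]; first by rewrite mulN1r.
  by apply: polyflatD; [exact: landen_loc_polyflat|apply: polyflatZ; exact: Gsol_polyflat].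
rewrite subrr in h.
(* If k is not 0, flatness gives a point of the imaginary axis in the half plane, close to 0, at
   which the constant difference has modulus below |k|. *)
have [//|k0] := eqVneq k 0.
have m0 : 0 < modc k by rewrite modc_gt0.
have /cvg_to0P/(_ _ m0)[d d0 dP] := flat_cvg h.
pose r := Num.min (1 / 4) (d / 2).
have r0 : 0 < r by rewrite lt_min !divr_gt0.
have r1 : r <= 1 / 4 by rewrite ge_min lexx.
have rd : r <= d / 2 by rewrite ge_min lexx orbT.
pose z : C := 0 +i* (r * (-1) ^+ s).
have zs : half_plane s z.
  by rewrite /half_plane /= mulrCA -expr2 sqrr_sign mulr1.
have mz : modc z = r.
  by rewrite modc_def /= expr0n add0r exprMn sqrr_sign mulr1 sqrtr_sqr gtr0_norm.
have := dP z (half_slit zs); rewrite mz => H.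
have z2 : modc z < 1 / 2 by rewrite mz; lra.
have := H _; rewrite horner0 !subr0 -(landen_locE zs z2) => {}H.
have := Ecst z zs; rewrite nc_addE nc_oppE => Ez.
have : modc k < modc k by rewrite {1}/k -Ez; apply: H; lra.
by rewrite ltxx.
Qed.

End Landen.

(** * Abel limits and multiple zeta values *)

Section AbelLimits.
Local Open Scope classical_set_scope.
Local Open Scope ring_scope.
Variable R : realType.
Notation C := CC[R].
Implicit Types (w v u : word) (a : nat -> C).

Lemma abel_limit a (u : nat -> R) (f : C -> C) (l : C) :
  (forall n, modc (a n) <= u n) -> cvg (series u @ \oo) ->
  psum a 1 @ \oo --> l -> pseries 1 a f ->
  forall e, 0 < e -> exists2 d : R, 0 < d < 1 &
    forall t : R, 1 - d < t < 1 -> modc (f t%:C - l) < e.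
Proof.
move=> au /cvg_ex[/= L uL] /cvg_seqP al [_ fa] e e0.
have u0 n : 0 <= u n by apply: le_trans (au n); exact: modc_ge0.
have u_sub M N : (M <= N)%N -> \sum_(M <= n < N) u n = series u N - series u M.
  by move=> MN; rewrite sub_series_geq.
have uinc M N : (M <= N)%N -> series u M <= series u N.
  by move=> MN; rewrite -subr_ge0 -u_sub//; apply: sumr_ge0.
have uleL N : series u N <= L.
  have <- := cvg_lim (@Rhausdorff R) uL.
  by apply: nondecreasing_cvgn_le uinc _ _; apply/cvg_ex; exists L.
have e4 : 0 < e / 4 by rewrite divr_gt0.
move/cvgrPdist_lt : (uL) => /(_ _ e4) [M _ /(_ M (leqnn M)) /= MP].
have L0 : 0 <= L by apply: le_trans (uleL 0%N); rewrite /series /= big_geq.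
(* For n < M one has 1 - t^n <= M (1 - t), so the head of the series costs at most (1 - t) M L; the
   added 1 keeps D positive. *)
pose D := M%:R * L + 1.
have D0 : 0 < D by rewrite ltr_wpDl// mulr_ge0.
exists (Num.min (1 / 2) (e / 4 / D)).
  by rewrite lt_min gt_min !divr_gt0//=; apply/orP; left; lra.
move=> t /andP[t_d t1].
have m1 : Num.min (1 / 2) (e / 4 / D) <= 1 / 2 by rewrite ge_min lexx.
have m2 : Num.min (1 / 2) (e / 4 / D) <= e / 4 / D by rewrite ge_min lexx orbT.
have t0 : 0 <= t by lra.
have tD : (1 - t) * (M%:R * L) <= e / 4.
  have : (1 - t) * D <= e / 4 by rewrite -ler_pdivlMr//; lra.
  by rewrite /D mulrDr mulr1; lra.
have mt : modc (t%:C : C) < 1 by rewrite modc_real ger0_norm.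
have [N1 N1P] := (cvg_psumP _ _ _).1 (fa _ mt) _ e4.
have [N2 N2P] := al _ e4.
pose N := maxn M (maxn N1 N2).
have NM : (M <= N)%N by rewrite leq_maxl.
have h1 : modc (psum a t%:C N - f t%:C) < e / 4 by apply: N1P; rewrite !leq_max leqnn orbT.
have h2 : modc (psum a 1 N - l) < e / 4 by apply: N2P; rewrite !leq_max leqnn !orbT.
have t_n n : 0 <= 1 - t ^+ n <= 1.
  by rewrite subr_ge0 exprn_ile1 ?(ltW t1)//= gerBl exprn_ge0.
have t_M n : (n < M)%N -> 1 - t ^+ n <= M%:R * (1 - t).
  move=> nM; apply: (@le_trans _ _ (n%:R * (1 - t))); last first.
    by rewrite ler_wpM2r ?ler_nat ?(ltnW nM)//; lra.
  elim: n {nM} => [|n IH]; first by rewrite expr0 mul0r subrr.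
  rewrite exprS -[n.+1%:R]natr1 mulrDl mul1r.
  have := t_n n; set x := t ^+ n in IH * => /andP[x0 x1].
  by nra.
have h3 : modc (psum a t%:C N - psum a 1 N) <= e / 2.
  rewrite /psum -sumrB; apply: le_trans (modc_sum _ _ _) _.
  apply: (@le_trans _ _ (\sum_(0 <= n < N) u n * (1 - t ^+ n))).
    rewrite big_mkord; apply: ler_sum => n _.
    rewrite expr1n -mulrBr modcM ler_pM ?modc_ge0// modc_sub.
    by rewrite -rmorphXn -[1]/(1%:C) -rmorphB modc_real ger0_norm//; case/andP: (t_n n).
  rewrite (@big_cat_nat _ _ _ M)//=.
  have b1 : \sum_(0 <= n < M) u n * (1 - t ^+ n) <= e / 4.
    apply: le_trans tD; rewrite mulrA [(1 - t) * _]mulrC.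
    apply: (@le_trans _ _ (M%:R * (1 - t) * series u M)).
      rewrite /series /= big_distrr /= !big_mkord; apply: ler_sum => n _.
      by rewrite mulrC ler_wpM2r ?u0// t_M.
    by apply: ler_wpM2l (uleL M); rewrite mulr_ge0//; lra.
  have b2 : \sum_(M <= n < N) u n * (1 - t ^+ n) <= e / 4.
    apply: (@le_trans _ _ (\sum_(M <= n < N) u n)).
      by apply: ler_sum => n _; rewrite ler_piMr ?u0//; case/andP: (t_n n).
    rewrite u_sub//; have := ler_norm (L - series u M); have := uleL N; lra.
  lra.
have tri (x y z w : C) : z - w = (x - y) + (y - w) - (x - z) by ring.
rewrite (tri (psum a t%:C N) (psum a 1 N) (f t%:C) l).
have := modcB (psum a t%:C N - psum a 1 N + (psum a 1 N - l)) (psum a t%:C N - f t%:C).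
have := modcD (psum a t%:C N - psum a 1 N) (psum a 1 N - l).
lra.
Qed.

Lemma sqrt_succ n (a := Num.sqrt n%:R : R) (b := Num.sqrt n.+1%:R : R) :
  [/\ 0 <= a, 0 < b, a <= b & b ^+ 2 = a ^+ 2 + 1].
Proof.
split; rewrite ?sqrtr_ge0 ?sqrtr_gt0 ?ltr0n//.
  by rewrite ler_sqrt ?ler_nat ?ltr0n.
by rewrite !sqr_sqrtr ?ler0n// natr1.
Qed.

Lemma sum_inv_sqrt n : \sum_(j < n) (Num.sqrt j%:R)^-1 <= 2 * Num.sqrt n%:R :> R.
Proof.
suff : \sum_(j < n.+1) (Num.sqrt j%:R)^-1 <= 2 * Num.sqrt n%:R :> R.
  by apply: le_trans; rewrite big_ord_recr /= lerDl invr_ge0 sqrtr_ge0.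
elim: n => [|n IH]; first by rewrite big_ord1 sqrtr0 invr0 mulr0.
rewrite big_ord_recr /=; apply: le_trans (lerD IH (lexx _)) _.
have [a0 b0 ab sq] := sqrt_succ n.
set a := Num.sqrt _ in a0 ab sq *; set b := Num.sqrt _ in b0 ab sq *.
rewrite -(ler_pM2r b0) mulrDl mulVf ?gt_eqF//; nra.
Qed.

(** Decay like n^(-1/2) reproduces itself: the sum of j^(-1/2) over j < n is at most 2 sqrt n, and
    the recursion divides by n. The exponent leaves room for the logarithms that nested sums
    produce. *)
Lemma modc_Hcoef_sqrt w : exists B : R, forall n, modc (Hcoef R w n) * Num.sqrt n%:R <= B.
Proof.
have [k wk] := ubnP (size w); elim: k w wk => // k IH [|b v] wk.
  exists 0 => -[|n]; first by rewrite sqrtr0 mulr0.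
  by rewrite Hcoef_nil modc0 mul0r.
have pos u : (exists B : R, forall n, modc (Hcoef R u n) * Num.sqrt n%:R <= B) ->
    exists2 B : R, 0 <= B & forall n, modc (Hcoef R u n) * Num.sqrt n%:R <= B.
  move=> [B BP]; exists B => //; apply: le_trans (BP 0%N).
  by rewrite mulr_ge0 ?modc_ge0 ?sqrtr_ge0.
have vk : (size v < k)%N by [].
have [B B0 BP] := pos _ (IH v vk).
have [D D0 DP] : exists2 D : R, 0 <= D & forall n, modc (Hcoef R (belast b v) n) *
    Num.sqrt n%:R <= D by apply/pos/IH; rewrite size_belast.
have sq1 n : 1 <= Num.sqrt n.+1%:R :> R by rewrite -[leLHS]sqrtr1 ler_sqrt ?ler1n ?ltr0n.
have unsq (c : R) u n : modc (Hcoef R u n.+1) * Num.sqrt n.+1%:R <= c ->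
    modc (Hcoef R u n.+1) <= c.
  by apply: le_trans; rewrite ler_peMr ?modc_ge0.
(* 1 for the term j = 0 and 2 B for the rest of the sum after a y, B for the single coefficient
   after an x, D for the term H X. *)
exists (1 + 2 * B + B + D) => -[|n].
  by rewrite sqrtr0 mulr0; lra.
have [_ s0 _ _] := sqrt_succ n; set s := Num.sqrt _ in s0 *.
have ss : s * s = n.+1%:R by rewrite -expr2 sqr_sqrtr.
rewrite -(ler_pM2r s0) -mulrA ss mulrC -[n.+1%:R](modc_nat R) -modcM Hcoef_cons.
apply: le_trans (modcB _ _) _.
have h1 : modc (if b then \sum_(j < n.+1) Hcoef R v j else Hcoef R v n.+1) <=
    (1 + 2 * B + B) * s.
  have s1 := sq1 n; case: ifP => _; last first.
    by apply: le_trans (unsq _ _ _ (BP n.+1)) _; rewrite -/s in s1; nra.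
  apply: le_trans (modc_sum _ _ _) _.
  apply: (@le_trans _ _ (\sum_(j < n.+1) ((j == 0 :> nat)%:R + B * (Num.sqrt j%:R)^-1))).
    apply: ler_sum => -[[|j] /= _] _.
      rewrite sqrtr0 invr0 mulr0 addr0 Hcoef0 modc_nat; by case: (v == _).
    by rewrite add0r ler_pdivlMr ?BP//; have [] := sqrt_succ j.
  rewrite big_split /= -big_distrr /= big_ord_recl /= big1 ?addr0 => [|i _//].
  have := sum_inv_sqrt n.+1; rewrite -/s; rewrite -/s in s1; nra.
have h2 : modc (if last b v then 0 else Hcoef R (belast b v) n.+1) <= D * s.
  case: ifP => _; first by rewrite modc0 mulr_ge0// ltW.
  have s1 := sq1 n; rewrite -/s in s1.
  by apply: le_trans (unsq _ _ _ (DP n.+1)) _; nra.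
by rewrite mulrDl lerD.
Qed.

(** Telescoping: from n = 2 on, the term is at most 2 / sqrt(n - 1) - 2 / sqrt n. *)
Lemma cvg_inv_32 : cvg (series (fun n => (n%:R * Num.sqrt n%:R)^-1 : R) @ \oo).
Proof.
have H n : series (fun n => (n%:R * Num.sqrt n%:R)^-1 : R) n.+2 <=
    3 - 2 * (Num.sqrt n.+1%:R)^-1.
  elim: n => [|n IH].
    by rewrite /series /= !big_nat_recr //= big_geq// mul0r invr0 sqrtr1 mul1r; lra.
  rewrite /series /= big_nat_recr //=; apply: le_trans (lerD IH (lexx _)) _.
  have [a0 b0 ab sq] := sqrt_succ n.+1.
  have nb : n.+2%:R = Num.sqrt n.+2%:R ^+ 2 :> R by rewrite sqr_sqrtr.
  have a1 : 0 < Num.sqrt n.+1%:R :> R by have [] := sqrt_succ n.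
  set a := Num.sqrt n.+1%:R in a0 a1 ab sq *; set b := Num.sqrt n.+2%:R in nb b0 ab sq *.
  rewrite nb -subr_ge0.
  have -> : 3 - 2 / b - (3 - 2 / a + (b ^+ 2 * b)^-1) =
      (2 * b ^+ 2 * (b - a) - a) / (a * b ^+ 3) by field; rewrite !gt_eqF.
  apply: divr_ge0; last by rewrite mulr_ge0 ?exprn_ge0 ?ltW.
  have e1 : (b - a) * (a + b) = 1 by lra.
  have : a * (a + b) <= 2 * b ^+ 2 * ((b - a) * (a + b)) by rewrite e1; nra.
  by rewrite mulrA ler_pM2r ?subr_ge0//; lra.
apply: nondecreasing_is_cvgn.
  by apply/nondecreasing_seqP => n; rewrite /series /= big_nat_recr//= lerDl
    invr_ge0 mulr_ge0 ?sqrtr_ge0.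
exists 3 => _ [n _ <-].
apply: (@le_trans _ _ (series (fun n => (n%:R * Num.sqrt n%:R)^-1 : R) n.+2)).
  rewrite /series /= 2?big_nat_recr//= -addrA lerDl.
  by rewrite addr_ge0// invr_ge0 mulr_ge0 ?sqrtr_ge0.
by apply: le_trans (H n) _; rewrite gerBl mulr_ge0 ?invr_ge0 ?sqrtr_ge0.
Qed.

(** The leading x of a nonempty word of h^0 divides the coefficients by n, which improves n^(-1/2)
    to the summable n^(-3/2). *)
Lemma zeta_word_abel v : h0_word v -> forall e, 0 < e -> exists2 d : R, 0 < d < 1 &
  forall t : R, 1 - d < t < 1 -> modc (Hloc v t%:C - zeta_word R v) < e.
Proof.
move=> /andP[hx hy].
suff [u uP uc] : exists2 u : nat -> R, forall n, modc (Hcoef R v n) <= u n &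
    cvg (series u @ \oo).
  have [l lP] : exists l : C, psum (Hcoef R v) 1 @ \oo --> l.
    by apply: (@cvg_dominated _ _ _ u) uc => n; rewrite expr1n mulr1.
  suff -> : zeta_word R v = l by exact: abel_limit uP uc lP (HlocP R v).
  apply: cvg_lim; first exact: norm_hausdorff.
  apply/cvg_succ; move/(cvg_succ (psum _ _)) : lP.
  by have -> // : (fun n => psum (Hcoef R v) 1 n.+1) =
    (fun n => Li_sum 1 (index_of v) n.+1) by apply/funext => n; rewrite Li_sumE.
case: v hx hy => [_ _|b v].
  exists (fun n => (n == 0%N)%:R) => [n|]; first by rewrite Hcoef_nil modc_nat.
  apply/cvg_ex; exists 1; apply/cvgrPdist_lt => e e0; exists 1%N => // -[|n] //= _.
  rewrite /series /= big_nat_recl//= big1 ?addr0 ?subrr ?normr0// => i _.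
rewrite /h1_word /= => /eqP -> /eqP lv; have [B BP] := modc_Hcoef_sqrt v.
exists (fun n => B * (n%:R * Num.sqrt n%:R)^-1) => [[|n]|].
- by rewrite Hcoef0 modc0 mul0r invr0 mulr0.
- have [_ s0 _ _] := sqrt_succ n.
  rewrite ler_pdivlMr ?mulr_gt0 ?ltr0n//.
  have -> : modc (Hcoef R (lx :: v) n.+1) * (n.+1%:R * Num.sqrt n.+1%:R) =
      modc (n.+1%:R * Hcoef R (lx :: v) n.+1) * Num.sqrt n.+1%:R.
    by rewrite modcM modc_nat; ring.
  by rewrite Hcoef_cons lv subr0.
have -> : series (fun n => B * (n%:R * Num.sqrt n%:R)^-1) =
    (fun N => B * series (fun n => (n%:R * Num.sqrt n%:R)^-1) N).
  by apply/funext => N; rewrite /series /= big_distrr.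
have /cvg_ex[l lP] := cvg_inv_32; apply/cvg_ex; exists (B * l).
exact: cvgM (cvg_cst B) lP.
Qed.

End AbelLimits.

(** * The connection series between G_0 and G_1 *)

Section Associator.
Local Open Scope classical_set_scope.
Local Open Scope ring_scope.
Variable R : realType.
Notation C := CC[R].
Notation ncs := (ncseries C bool).
Notation ncX := (nc_letter C lx).
Notation ncY := (nc_letter C ly).
Implicit Types (z : C) (w v u : word).

Lemma slit_real (t : R) : 0 < t < 1 -> slit_plane (t%:C : C).
Proof. by move=> /andP[t0 t1] [_ /=] [|]; lra. Qed.

Lemma Gsol_Grefl : exists k : ncs, forall z, slit_plane z -> Gsol z = Grefl z * k.
Proof.
pose half : C := 2^-1; have hs : slit_plane half by exact: slit_half.
have h1 : Grefl half [::] = 1.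
  by rewrite /Grefl /flip expr0 mul1r Gsol_nil//; exact: slit_subr.
have [g gP] := nc_right_inverse h1; exists (g * Gsol half) => z zs.
apply: (kz_uniq (@slit_star R) (@Gsol_kz R) (kz_onMr _ (@Grefl_kz R)) _ zs).
by rewrite mulrA gP mul1r.
Qed.

Lemma log_poly_at0 w : (log_poly R w).[0] = (w == [::])%:R.
Proof.
rewrite /log_poly hornerZ hornerXn expr0n; case: w => [|b w] /=; last by rewrite mulr0.
by rewrite /inv_fact invr1 !mulr1.
Qed.

(** [Grefl] at 1 - t is [flip] of [Gsol] at t, whose expansion has constant term 1 on the empty word
    and 0 elsewhere; in the product only k(w) survives. *)
Lemma Gsol_reflect_polyflat (k : ncs) : (forall z, slit_plane z -> Gsol z = Grefl z * k) ->
  forall w, exists2 q : {poly C}, q.[0] = k w & polyflat q (fun t : C => Gsol (1 - t) w).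
Proof.
move=> kE w; pose c (i : nat) := k (drop i w) * (-1) ^+ size (take i w).
exists (\sum_(i < (size w).+1) c i *: log_poly R (map negb (take i w))).
  rewrite horner_sum big_ord_recl /c take0 drop0 hornerZ log_poly_at0 expr0 !mulr1.
  rewrite big1 ?addr0// => i _; rewrite hornerZ log_poly_at0.
  by case: (w) i => [[]//|b v] i; rewrite lift0 /= mulr0.
apply: (@polyflat_ext _ _ (fun t : C => \sum_(i < (size w).+1)
    c i * Gsol t (map negb (take i w))) _ 1) => [//|t ts _|].
  rewrite (kE _ (slit_subr ts)) nc_mulE; apply: eq_bigr => i _.
  by rewrite /Grefl subKr /flip /c; ring.
by apply: polyflat_sum => i; apply: polyflatZ; exact: Gsol_polyflat.
Qed.

(** Points of ]0, 1[ tending to 0 whose logarithms are the explicit values -(k+1). *)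
Definition abel_point (k : nat) : R := expR (- k.+1%:R).

Lemma abel_point_lt1 k : 0 < abel_point k < 1.
Proof. by rewrite expR_gt0 expR_lt1 oppr_lt0 ltr0n. Qed.

Lemma abel_point_cvg (e : R) : 0 < e -> exists K, forall k, (K <= k)%N -> abel_point k < e.
Proof.
move=> e0; exists (Num.bound (e^-1)) => k Kk.
have eb : e^-1 < k.+1%:R.
  apply: (@lt_le_trans _ _ (Num.bound e^-1)%:R).
    by apply: archi_boundP; rewrite invr_ge0 ltW.
  by rewrite ler_nat; exact: leqW.
rewrite /abel_point expRN -[e]invrK ltf_pV2 ?posrE ?invr_gt0 ?expR_gt0//.
apply: lt_trans eb _; apply: lt_le_trans (expR_ge1Dx _).
by rewrite ltrDr.
Qed.

Lemma Log_abel_point k : Log (abel_point k)%:C = - k.+1%:R :> C.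
Proof.
have -> : - k.+1%:R = (- k.+1%:R)%:C :> C by rewrite rmorphN rmorph_nat.
have -> : (abel_point k)%:C = cexp (- k.+1%:R)%:C :> C.
  by rewrite /cexp /= cos0 sin0 -[_ +i* _]/(1%:C) rmorph1 mulr1.
by rewrite cexpK //= oppr_lt0 pi_gt0 pi_ge0.
Qed.

(** The Abel limit is known on the real segment. Along the sequence [abel_point] it already forces
    q, taken at numbers tending to infinity, to converge, hence to be constant. *)
Lemma zeta_word_polyflat v q : h0_word v ->
  polyflat q (fun t : C => Gsol (1 - t) v) -> q = (zeta_word R v)%:P.
Proof.
move=> v0 qP; apply/eqP; rewrite -subr_eq0; apply/eqP.
apply: (@poly_cvg0 R nat \oo _ (fun k => - k.+1%:R)).
- apply/cvg_seqP => e e0; exists (Num.bound e^-1) => k Kk.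
  have eb : e^-1 < k.+1%:R.
    apply: (@lt_le_trans _ _ (Num.bound e^-1)%:R).
      by apply: archi_boundP; rewrite invr_ge0 ltW.
    by rewrite ler_nat; exact: leqW.
  rewrite subr0 modcV modcN modc_nat -[e]invrK ltf_pV2 ?posrE ?ltr0n// invr_gt0//.
- by apply: nearW => k; rewrite oppr_eq0 pnatr_eq0.
have H := (cvg_to0P _ _).1 (flat_cvg qP).
apply/cvg_seqP => e e0; have e2 : 0 < e / 2 by rewrite divr_gt0.
have [d d0 dP] := H _ e2; have [d' /andP[d'0 _] d'P] := zeta_word_abel v0 e2.
have m0 : 0 < Num.min d d' by rewrite lt_min d0.
have [K KP] := abel_point_cvg m0; exists K => k Kk.
have := KP k Kk; rewrite lt_min => /andP[kd kd'].
have p01 := abel_point_lt1 k; have /andP[p0 p1] := p01.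
have := dP _ (slit_real p01); rewrite modc_real gtr0_norm// subr0 => /(_ kd).
have q01 : 0 < 1 - abel_point k < 1 by apply/andP; split; lra.
have sub1 : 1 - (abel_point k)%:C = (1 - abel_point k)%:C :> C by rewrite rmorphB rmorph1.
rewrite Log_abel_point sub1 Gsol_loc ?modc_real ?gtr0_norm//; [|exact: slit_real|lra..].
rewrite Gloc_h1; [|by case/andP: v0|exact: slit_real|rewrite modc_real gtr0_norm; lra].
have := d'P (1 - abel_point k) _; rewrite ltrD2l ltrN2 kd' /= => h1 h2.
have {}h1 := h1 _; rewrite subr0 hornerD hornerN hornerC.
have tri (x y l : C) : x - l = (y - l) - (y - x) by ring.
rewrite (tri _ (Hloc v (1 - abel_point k)%:C)).
apply: le_lt_trans (modcB _ _) _; lra.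
Qed.

Lemma zeta_hat_polyflat (p : hspace R) : h0 p ->
  polyflat (zeta_hat p)%:P
    (fun t : C => (fglift (Gsol (1 - t) : word -> C^o) : hspace R -> C^o) p).
Proof.
move=> /allP p0; have [k kE] := Gsol_Grefl.
rewrite /zeta_hat (linear_freeg (fglift_is_linear (zeta_word R : word -> C^o))).
apply: (@polyflat_ext _ _ (fun t : C => \sum_(a <- dom p) coeff a p * Gsol (1 - t) a) _ 1)
  => [//|t _ _|].
  rewrite (linear_freeg (fglift_is_linear (Gsol (1 - t) : word -> C^o))).
  by apply: eq_bigr => a _; rewrite fglift1.
elim: (dom p) p0 => [|a s IH] s0.
  rewrite big_nil polyC0; apply: polyflat_flat.
  apply: (@flat_ext _ (fun=> 0) _ 1) => [//|t _ _|]; last exact: flat0.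
  by rewrite big_nil.
apply: (@polyflat_ext _ _ (fun t : C => coeff a p * Gsol (1 - t) a +
    \sum_(a <- s) coeff a p * Gsol (1 - t) a) _ 1) => [//|t _ _|].
  by rewrite big_cons.
rewrite big_cons polyCD; apply: polyflatD; last first.
  by apply: IH => b bs; apply: s0; rewrite in_cons bs orbT.
rewrite fglift1 -[coeff a p *: _]/(coeff a p * _) polyCM mul_polyC; apply: polyflatZ.
have [q _ qP] := Gsol_reflect_polyflat kE a.
by rewrite -(@zeta_word_polyflat a q)// s0// in_cons eqxx.
Qed.

(** k(w) is a constant term in log t, and any decomposition of w over h^0[x, y] computes it; it is
    applied to the decomposition that [reg] has chosen. *)
Lemma phi_KZ_coef (k : ncs) : (forall z, slit_plane z -> Gsol z = Grefl z * k) ->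
  k = @phi_KZ R.
Proof.
move=> kE; apply/funext => w; rewrite /phi_KZ /reg; set P := (X in xget _ X).
have [N [c [c0 wE]]] := reg_exists R w.
have PW : P (c 0%N 0%N) by exists N, c.
have [N' [c' [c'0 wE' ->]]] := xgetPex 0 (ex_intro _ _ PW).
move: N' c' c'0 wE' => {wE PW c0 P} {}N {}c c0 wE.
have [q <- qP] := Gsol_reflect_polyflat kE w.
pose M (t : C) : hspace R -> C^o := fglift (Gsol (1 - t) : word -> C^o).
have MU t v : M t << v >> = Gsol (1 - t) v by exact: fglift1.
have ML t : linear (M t) by exact: fglift_is_linear.
have MM t p p' : slit_plane t -> M t (shuffle p p') = M t p * M t p'.
  by move=> ts; apply: lift_shuffle => u v; apply: Gsol_character; exact: slit_subr.
have MX t p n : slit_plane t -> M t (shuffle_exp p n) = M t p ^+ n.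
  move=> ts; elim: n => [|n IH]; first by rewrite expr0 MU Gsol_nil//; exact: slit_subr.
  by rewrite exprS -IH -MM.
(* At the point 1 - t, x gives Log (1 - t) and y gives - Log t. Their expansions 0 and -'X both
   vanish at 0, so only the exponents a = b = 0 count. *)
have xP : polyflat 0 (fun t : C => Log (1 - t)) by apply: polyflat_flat; exact: Log1B_flat.
have yP : polyflat (-1 *: 'X) (fun t : C => -1 * Log t).
  by apply: polyflatZ; exact: polyflat_Log.
pose Q := \sum_(a < N.+1) \sum_(b < N.+1)
  (zeta_hat (c a b))%:P * (0 ^+ a * (-1 *: 'X) ^+ b) : {poly C}.
have QP : polyflat Q (fun t : C => Gsol (1 - t) w).
  apply: (@polyflat_ext _ _ (fun t : C => \sum_(a < N.+1) \sum_(b < N.+1)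
    M t (c a b) * (Log (1 - t) ^+ a * (-1 * Log t) ^+ b)) _ 1) => [//|t ts _|].
    rewrite -MU wE (linear_map_sum (ML t)); apply: eq_bigr => a _.
    rewrite (linear_map_sum (ML t)); apply: eq_bigr => b _.
    rewrite !MM// !MX// !MU Gsol_x; last exact: slit_subr.
    by rewrite Gsol_y ?subKr ?mulN1r//; exact: slit_subr.
  apply: polyflat_sum => a; apply: polyflat_sum => b; apply: polyflatM.
    exact: zeta_hat_polyflat.
  by apply: polyflatM; apply: polyflatX.
have Q0 a b : ((zeta_hat (c a b))%:P * (0 ^+ a * (-1 *: 'X) ^+ b)).[0] =
    zeta_hat (c a b) * (0 ^+ a * 0 ^+ b).
  by rewrite !hornerM !horner_exp hornerZ hornerX hornerC horner0 mulr0.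
rewrite (polyflat_uniq qP QP) /Q horner_sum big_ord_recl horner_sum big_ord_recl.
rewrite Q0 !expr0 !mulr1 big1 => [|b _]; last by rewrite Q0 lift0 !expr0n /= !mulr0.
rewrite big1 ?addr0// => a _; rewrite horner_sum big1// => b _.
by rewrite Q0 lift0 expr0n mul0r mulr0.
Qed.

Lemma Gsol_phi_KZ z : slit_plane z -> Gsol z = Grefl z * @phi_KZ R.
Proof.
by have [k kE] := Gsol_Grefl; rewrite -(phi_KZ_coef kE); exact: kE.
Qed.

End Associator.

(** * Passage to the algebra of (KZ_3) *)

Section BraidRelations.
Local Open Scope classical_set_scope.
Local Open Scope ring_scope.
Local Open Scope quotient_scope.
Variable R : realType.
Notation C := CC[R].
Notation series := (series3 R).
Notation "[ 'P' f ]" := (\pi_(P3 R) f) (at level 0, format "[ 'P'  f ]").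
Implicit Types (f g h A B T : series) (u z : C).

Let J f : Prop := f \in @P3_null R.

Lemma P3_nullD f g : J f -> J g -> J (f + g).
Proof. by rewrite /J => Jf Jg; rewrite rpredD. Qed.

Lemma P3_null0 : J 0.
Proof. by rewrite /J rpred0. Qed.

Lemma P3_null_closed f : (forall n, exists2 g, J g & agree n f g) -> J f.
Proof.
move=> fJ; apply/asboolP => n; have [g /asboolP/(_ n)[k Ik gk] fg] := fJ n.
by exists k => // w wn; rewrite fg ?gk.
Qed.

Let Jl h f : J f -> J (h * f). Proof. exact: P3_null_mull. Qed.
Let Jr h f : J f -> J (f * h). Proof. exact: P3_null_mulr. Qed.

Lemma pi_P3P f g : eqJ J f g <-> [P f] = [P g].
Proof.
by split=> [fg|/eqP]; [apply/eqP|]; rewrite -Quotient.idealrBE.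
Qed.

Lemma pi_P3M f g : [P f * g] = [P f] * [P g].
Proof. by rewrite !piE. Qed.

Lemma pi_P3D f g : [P f + g] = [P f] + [P g].
Proof. by rewrite !piE. Qed.

Lemma pi_P3N f : [P - f] = - [P f].
Proof. by rewrite !piE. Qed.

Lemma pi_subst_congr c f g f' g' : nilfree f -> nilfree g -> nilfree f' -> nilfree g' ->
  [P f] = [P f'] -> [P g] = [P g'] -> [P nc_subst c f g] = [P nc_subst c f' g'].
Proof.
move=> f0 g0 f'0 g'0 /pi_P3P ff /pi_P3P gg; apply/pi_P3P.
exact: (nc_subst_congr P3_null0 P3_nullD Jl Jr P3_null_closed).
Qed.

Lemma X3_nilfree i j : nilfree (@X3 R i j).
Proof. exact: X3_nil. Qed.

Lemma X3C i j : i != j -> [P @X3 R i j] = [P X3 j i].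
Proof.
move=> ij; apply/pi_P3P; apply/asboolP => n.
exists (X3 i j - X3 j i) => //.
rewrite -[X in P3_ideal X]add0r -[X in 0 + X]mulr1 -[X in 0 + X * 1]mul1r.
by apply: P3_idealD; [exact: P3_ideal0|exact: P3_sym].
Qed.

Lemma X3_comm i j k : uniq [:: i; j; k] ->
  [P @X3 R i j] * ([P X3 i k] + [P X3 k j]) = ([P X3 i k] + [P X3 k j]) * [P X3 i j].
Proof.
move=> ijk; rewrite -!pi_P3D -!pi_P3M; apply/pi_P3P; apply/asboolP => n.
eexists; last by [].
rewrite -[X in P3_ideal X]add0r -[X in 0 + X]mulr1 -[X in 0 + X * 1]mul1r.
by apply: P3_idealD; [exact: P3_ideal0|exact: P3_comm].
Qed.

Lemma addr3_perm (V : zmodType) (x y z : V) :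
  [/\ x + z + y = x + y + z, y + x + z = x + y + z, y + z + x = x + y + z,
      z + x + y = x + y + z & z + y + x = x + y + z].
Proof.
split; first exact: addrAC.
- by rewrite [y + x]addrC.
- by rewrite addrC addrA.
- by rewrite -addrA addrC.
- by rewrite addrC [z + y]addrC addrA.
Qed.

Lemma pi_T3 i j k : uniq [:: i; j; k] ->
  [P T3 R] = [P X3 i j] + [P X3 j k] + [P X3 i k].
Proof.
have ordP (l : 'I_3) : [\/ l = inord 0, l = inord 1 | l = inord 2].
  case: l => -[|[|[|//]]] p; [apply: Or31|apply: Or32|apply: Or33];
  by apply: val_inj; rewrite /= inordK.
have o01 : (inord 0 : 'I_3) != inord 1 by rewrite -val_eqE /= !inordK.
have o02 : (inord 0 : 'I_3) != inord 2 by rewrite -val_eqE /= !inordK.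
have o12 : (inord 1 : 'I_3) != inord 2 by rewrite -val_eqE /= !inordK.
have X01 := X3C o01; have X02 := X3C o02; have X12 := X3C o12.
rewrite /T3 !pi_P3D.
have [p1 p2 p3 p4 p5] := addr3_perm [P X3 (inord 0) (inord 1)]
  [P X3 (inord 0) (inord 2)] [P @X3 R (inord 1) (inord 2)].
by case: (ordP i) => ->; case: (ordP j) => ->; case: (ordP k) => ->;
  rewrite /= ?inE ?eqxx ?orbT ?andbF // => _; rewrite -?X01 -?X02 -?X12.
Qed.

(** T - X_ij is X_ik + X_jk, which commutes with X_ij by the defining relation. *)
Lemma T3_comm i j k : uniq [:: i; j; k] ->
  [P T3 R] * [P X3 i j] = [P X3 i j] * [P T3 R].
Proof.
move=> ijk; have /andP[_ /andP[jk _]] := ijk; rewrite inE in jk.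
rewrite (pi_T3 ijk) -addrA [[P X3 j k] + _]addrC mulrDl mulrDr (X3C jk).
by congr (_ + _); rewrite -X3_comm.
Qed.

Let comP f h := [P h] * [P f] = [P f] * [P h].

Lemma comP_eqJ f h : comP f h <-> eqJ J (h * f) (f * h).
Proof. by rewrite pi_P3P !pi_P3M. Qed.

Lemma comP_sym f h : comP f h -> comP h f.
Proof. by rewrite /comP => ->. Qed.

Lemma comP_Z (a : C) f h : comP f h -> comP (a *: f) h.
Proof. by move=> /comP_eqJ fh; apply/comP_eqJ; rewrite -scalerAl -scalerAr; exact: eqJZ. Qed.

Lemma comP_D f g h : comP f h -> comP g h -> comP (f + g) h.
Proof. by rewrite /comP !pi_P3D mulrDl mulrDr => -> ->. Qed.

Lemma comP_N f h : comP f h -> comP (- f) h.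
Proof. by move=> fh; rewrite -scaleN1r; exact: comP_Z. Qed.

Lemma comP_exp f h : nilfree f -> comP f h -> comP (nc_exp f) h.
Proof.
move=> f0 /comP_eqJ fh; apply/comP_eqJ.
exact: (nc_exp_commute P3_null0 P3_nullD Jl Jr P3_null_closed).
Qed.

Lemma comP_subst c f g h : nilfree f -> nilfree g -> comP f h -> comP g h ->
  comP (nc_subst c f g) h.
Proof.
move=> f0 g0 /comP_eqJ fh /comP_eqJ gh; apply/comP_eqJ.
exact: (nc_subst_commute P3_null0 P3_nullD Jl Jr P3_null_closed).
Qed.

Lemma half_subr s u : half_plane s u -> half_plane (~~ s) (1 - u).
Proof.
rewrite /half_plane /= ImB sub0r.
by case: s; rewrite /= ?expr1 ?expr0 ?mulN1r ?mul1r ?opprK.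
Qed.

(** For v = u / (u - 1), v / (1 - v) = - u; in [Log_div1B] at v the two multiples of pi i cancel. *)
Lemma Log_div_subr1 s u : half_plane s u -> Log (1 - u / (u - 1)) = - Log (1 - u) :> C.
Proof.
move=> us; have [vs qs vE] := half_opp_div us; have su := half_slit us.
have u1 := slit_neq1 su; have u1' : u - 1 != 0 by rewrite -opprB oppr_eq0.
have := Log_div1B vs.
have -> : u / (u - 1) / (1 - u / (u - 1)) = - u.
  have -> : 1 - u / (u - 1) = - (u - 1)^-1 by field.
  by field.
rewrite (Log_opp us) {1}vE (Log_opp qs) (Log_div1B su) => h.
by rewrite -[LHS](subKr (Log u - Log (1 - u) - (0 +i* ((-1) ^+ s * pi)))) -h; ring.
Qed.

(* Stated for arbitrary series, because unification unfolds substitutions and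
   exponentials when it has to compare two of them. *)
Lemma connection_algebra (s1 e1 p s2 e2 e3 s3 : series) :
  [P s1] = [P s2 * e2] -> e2 * e1 = e3 -> comP p e3 -> s2 * p = s3 ->
  [P s1 * e1] * [P p] = [P s3 * e3].
Proof.
move=> h1 h2 h3 <-.
by rewrite pi_P3M h1 -pi_P3M -mulrA h2 !pi_P3M -!mulrA h3.
Qed.

Lemma connection_swap (a e d e' p : series) : [P e] * [P d] = [P e'] * [P p] ->
  [P a * e] * [P d] = [P a * e'] * [P p].
Proof. by move=> ed; rewrite !pi_P3M -!mulrA ed. Qed.

Lemma connection_assoc (a b c d : series) : [P d] = [P b * c] ->
  [P a] * [P d] = [P a * b] * [P c].
Proof. by move=> ->; rewrite !pi_P3M mulrA. Qed.

Section Connection.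
Variables A B T : series.
Hypotheses (A0 : nilfree A) (B0 : nilfree B) (T0 : nilfree T).
Hypotheses (TA : comP A T) (TB : comP B T).

Let pi_i (s : bool) : C := 0 +i* ((-1) ^+ s * pi).

Let AB0 : nilfree (A + B - T).
Proof. by apply: nilfreeD; [exact: nilfreeD|exact: nilfreeN]. Qed.

(** Landen's formula produces the second argument A + B. Subtracting T from it costs exp(- Log (1 -
    u) T), which is compensated by the change of the logarithm from l to l + Log (1 - u). *)
Lemma landen_connection s u (l : C) : half_plane s u ->
  [P nc_subst (G0 (u / (u - 1))) A (A + B - T) * nc_exp ((l + Log (1 - u)) *: T)] *
    [P nc_exp (pi_i s *: A)] = [P nc_subst (G0 u) A (- B) * nc_exp (l *: T)].
Proof.
move=> us; have [vs _ _] := half_opp_div us; have su := half_slit us.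
have ABn : nilfree (A + B) by exact: nilfreeD.
have NBn : nilfree (- B) by exact: nilfreeN.
have NT0 : nilfree (- T) by exact: nilfreeN.
apply: (@connection_algebra _ _ _ (nc_subst (Gsol (u / (u - 1))) A (A + B))
  (nc_exp ((- Log (1 - u)) *: T))).
- rewrite (G0_Gsol vs); apply/pi_P3P.
  have -> : - Log (1 - u) *: T = Gsol (u / (u - 1)) [:: ly] *: - T.
    by rewrite (Gsol_y vs) (Log_div_subr1 us) opprK scaleNr scalerN.
  apply: (nc_subst_shift P3_null0 P3_nullD Jl Jr P3_null_closed) => //.
  + by apply/comP_eqJ/comP_sym/comP_N/comP_sym.
  + by apply/comP_eqJ/comP_sym/comP_N/comP_sym/comP_D.
  + by move=> v w; exact: Gsol_character.
  + exact: Gsol_nil.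
- by rewrite -(nc_exp_scaleD _ _ T0) [- _ + _]addrC addrK.
- apply: comP_exp; first exact: nilfreeZ.
  by apply/comP_Z/comP_sym/comP_exp; [exact: nilfreeZ|apply/comP_Z/comP_sym].
have d0 := @dual_letter_nil R; have X0 : nilfree (nc_letter C lx) by [].
rewrite (G0_Gsol su) -(landenE us) /landen (nc_substM _ _ A0 NBn).
rewrite (nc_subst_comp _ A0 NBn X0 d0) (nc_subst_X A0 NBn).
rewrite (nc_subst_exp A0 NBn (nilfreeZ _ X0)) (nc_substZ _ _ A0 NBn) (nc_subst_X A0 NBn).
have -> // : nc_subst (@dual_letter R) A (- B) = A + B.
rewrite /dual_letter -scaleN1r (nc_substD _ _ A0 NBn) (nc_substZ _ _ A0 NBn).
by rewrite (nc_subst_X A0 NBn) (nc_subst_Y A0 NBn) scaleN1r opprK.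
Qed.

(** Replacing Log (1 - u) by Log (- (1 - u)) subtracts q, equal to pi i up to sign, from the
    coefficient of T. As T and A commute, exp(q (T - A)) restores exp(q T) and leaves exp(- q A). *)
Lemma landen_connection_opp s u (l : C) (D : series) : nilfree D -> [P D] = [P T - A] ->
  half_plane s u ->
  [P nc_subst (G0 (u / (u - 1))) A (A + B - T) * nc_exp ((l + Log (- (1 - u))) *: T)] *
    [P nc_exp (pi_i (~~ s) *: D)] = [P nc_subst (G0 u) A (- B) * nc_exp (l *: T)].
Proof.
move=> D0 DE us; apply: (etrans _ (landen_connection l us)).
have us' := half_subr us.
have TAn : nilfree (- A) by exact: nilfreeN.
have piN : pi_i (~~ s) = - pi_i s.
  by apply/eqC; rewrite /pi_i /= ?oppr0//; case: (s); rewrite /= ?expr1 ?expr0; ring.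
apply: connection_swap; rewrite (Log_opp us') -/(pi_i (~~ s)).
set L := Log _; set q := pi_i (~~ s).
have -> : nc_exp ((l + L) *: T) = nc_exp ((l + (L - q)) *: T) * nc_exp (q *: T).
  by rewrite -(nc_exp_scaleD _ _ T0) -addrA subrK.
apply: connection_assoc.
transitivity [P nc_exp (q *: T + pi_i s *: A)].
  apply/pi_P3P; apply: (nc_exp_congr P3_null0 P3_nullD Jl Jr P3_null_closed).
  - exact: nilfreeZ.
  - by apply: nilfreeD; exact: nilfreeZ.
  have -> : pi_i s *: A = q *: - A by rewrite /q piN scalerN scaleNr opprK.
  by rewrite -scalerDr; apply: eqJZ => //; apply/pi_P3P.
apply/pi_P3P; apply: (nc_expD P3_null0 P3_nullD Jl Jr P3_null_closed).
- exact: nilfreeZ.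
- exact: nilfreeZ.
- by apply/comP_eqJ/comP_Z/comP_sym/comP_Z.
Qed.

End Connection.

Lemma nc_subst_flip (A : eqType) (c : ncseries C bool) (f g : ncseries C A) :
  nilfree f -> nilfree g -> nc_subst (flip c) f g = nc_subst c (- g) (- f).
Proof.
move=> f0 g0; have nf0 := nilfreeN f0; have ng0 := nilfreeN g0.
apply: (subst_rec_uniq (X := fun c => nc_subst (flip c) f g)
  (Y := fun c => nc_subst c (- g) (- f)) ng0 nf0) => {}c; last exact: nc_subst_unfold.
have tail_flip b : nc_tail b (flip c) = -1 *: flip (nc_tail (~~ b) c).
  by apply/funext => w; rewrite nc_scaleE /nc_tail /flip /= exprS mulrA.
rewrite (nc_subst_unfold _ f0 g0) !tail_flip !(nc_substZ _ _ f0 g0) !scaleN1r !mulrN !mulNr.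
by rewrite /flip /= expr0 mul1r -!addrA [- (g * _) + _]addrC.
Qed.

Lemma nc_subst_G1 (A : eqType) z (f g : ncseries C A) : nilfree f -> nilfree g ->
  slit_plane z -> nc_subst (G1 z) f g = nc_subst (G0 (1 - z)) (- g) (- f).
Proof.
by move=> f0 g0 zs; rewrite (G1E zs) (G0_Gsol (slit_subr zs)); exact: nc_subst_flip.
Qed.

Lemma pi_mul_congr (f f' e : series) : [P f] = [P f'] -> [P f * e] = [P f' * e].
Proof. by move=> ff; rewrite !pi_P3M ff. Qed.

Lemma W_leftE (a b c : 'I_3) (z : 'I_3 -> C) (l v : C) f g : nilfree f -> nilfree g ->
  (z b - z a) / (z c - z a) = v -> [P X3 a b] = [P f] -> [P - X3 b c] = [P g] ->
  W_left a b c z l = [P nc_subst (G0 v) f g * nc_exp (l *: T3 R)].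
Proof.
move=> f0 g0 <- ff gg; apply: pi_mul_congr; apply: pi_subst_congr => //.
  exact: X3_nilfree.
by apply: nilfreeN; exact: X3_nilfree.
Qed.

Lemma W_rightE (a b c : 'I_3) (z : 'I_3 -> C) (l v : C) f g : nilfree f -> nilfree g ->
  slit_plane v ->
  1 - (z b - z a) / (z c - z a) = v -> [P X3 b c] = [P f] -> [P - X3 a b] = [P g] ->
  W_right a b c z l = [P nc_subst (G0 v) f g * nc_exp (l *: T3 R)].
Proof.
move=> f0 g0 vs vE ff gg; apply: pi_mul_congr.
have Xn i j : nilfree (@X3 R i j) by exact: X3_nilfree.
have XN : nilfree (- @X3 R b c) by apply: nilfreeN.
have us : slit_plane ((z b - z a) / (z c - z a)).
  by rewrite -[_ / _](subKr 1) vE; exact: slit_subr.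
rewrite (nc_subst_G1 (Xn a b) XN us) vE opprK.
by apply: pi_subst_congr => //; exact: nilfreeN.
Qed.

Lemma mul_eq_trans (V : nzRingType) (x y p x' y' : V) :
  x = x' -> y = y' -> x' * p = y' -> x * p = y.
Proof. by move=> -> ->. Qed.

Lemma phi_connection (A B e : series) u : nilfree A -> nilfree B -> slit_plane u ->
  comP (nc_subst (@phi_KZ R) A B) e ->
  [P nc_subst (G1 u) A B * e] * [P nc_subst (@phi_KZ R) A B] =
  [P nc_subst (G0 u) A B * e].
Proof.
move=> A0 B0 us phie; apply: (@connection_algebra _ _ _ (nc_subst (G1 u) A B) 1) => //.
- by congr [P _]; rewrite mulr1.
- exact: mul1r.
- by rewrite (G0_Gsol us) (Gsol_phi_KZ us) (G1E us) nc_substM.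
Qed.

End BraidRelations.

(** * The five connection formulas of (KZ_3) *)

Theorem proposition8 (R : realType) (i j k : 'I_3) (z : 'I_3 -> CC[R])
    (lki : CC[R]) (hijk : uniq [:: i; j; k]) (hz : injective z)
    (hlki : cexp lki = z k - z i) :
  let u : CC[R] := (z j - z i) / (z k - z i) in
  let lg (p q : 'I_3) : CC[R] := lki + Log ((z p - z q) / (z k - z i)) in
  let pi_i (s : bool) : CC[R] := 0 +i* ((-1) ^+ s * pi) in
  [/\ slit_plane u ->
        W_right i j k z (lg k i) *
          \pi_(P3 R) (nc_subst (@phi_KZ R) (X3 i j) (- X3 j k)) =
        W_left i j k z (lg k i),
      forall s : bool, half_plane s u ->
        W_left j i k z (lg k j) * \pi_(P3 R) (nc_exp (pi_i s *: X3 i j)) =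
        W_left i j k z (lg k i),
      forall s : bool, half_plane (~~ s) u ->
        W_right i k j z (lg j i) * \pi_(P3 R) (nc_exp (pi_i s *: X3 j k)) =
        W_right i j k z (lg k i),
      forall s : bool, half_plane (~~ s) u ->
        W_right k i j z (lg j k) *
          \pi_(P3 R) (nc_exp (pi_i s *: (X3 i k + X3 j k))) =
        W_left i j k z (lg k i)
    & forall s : bool, half_plane s u ->
        W_left j k i z (lg i j) *
          \pi_(P3 R) (nc_exp (pi_i s *: (X3 i j + X3 i k))) =
        W_right i j k z (lg k i)].

Proof.
have ij : i != j by move: hijk; rewrite /= !inE negb_or => /andP[/andP[]].
have ik : i != k by move: hijk; rewrite /= !inE negb_or => /andP[/andP[]].
have jk : j != k by move: hijk; rewrite /= !inE => /andP[_ /andP[]].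
have hjki : uniq [:: j; k; i] by rewrite /= !inE negb_or jk eq_sym ij eq_sym ik.
have zne a b : a != b -> z a - z b != 0.
  by move=> ab; rewrite subr_eq0 (inj_eq hz).
have d0 : z k - z i != 0 by rewrite zne// eq_sym.
move=> u lg pi_i.
have uji : z j - z i = u * (z k - z i) by rewrite /u divfK.
have u0 : u != 0 by rewrite /u mulf_neq0 ?invr_eq0// zne// eq_sym.
have ukj : z k - z j = (1 - u) * (z k - z i) by rewrite mulrBl -uji; ring.
have u1 : 1 - u != 0.
  by apply/eqP => u1; move: (zne k j); rewrite eq_sym jk ukj u1 mul0r eqxx => /(_ isT).
have u1' : u - 1 != 0 by rewrite -opprB oppr_eq0.
have u1u : 1 - u - 1 != 0 by rewrite addrAC subrr add0r oppr_eq0.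
have uij : z i - z j = - u * (z k - z i) by rewrite mulNr -uji opprB.
have ujk : z j - z k = - (1 - u) * (z k - z i) by rewrite mulNr -ukj opprB.
have uik : z i - z k = - (z k - z i) by rewrite opprB.
have lgki : lg k i = lki by rewrite /lg divff// Log1 addr0.
have lgkj : lg k j = lki + Log (1 - u) by rewrite /lg ukj mulfK.
have lgji : lg j i = lki + Log (1 - (1 - u)) by rewrite /lg uji mulfK// subKr.
have lgjk : lg j k = lki + Log (- (1 - u)) by rewrite /lg ujk mulfK.
have lgij : lg i j = lki + Log (- (1 - (1 - u))) by rewrite /lg uij mulfK// subKr.
have A0 := X3_nilfree R i j; have B0 := X3_nilfree R j k.
have NA0 := nilfreeN A0; have NB0 := nilfreeN B0.
have T0 : nilfree (T3 R) by rewrite /T3; do !apply: nilfreeD; exact: X3_nilfree.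
have AB0 := nilfreeD (nilfreeD A0 B0) (nilfreeN T0).
have BA0 := nilfreeD (nilfreeD B0 A0) (nilfreeN T0).
have TA := T3_comm R hijk; have TB := T3_comm R hjki.
have TE := pi_T3 R hijk.
(* This is the second argument that exchanging two of the points produces. *)
have ABE : \pi_(P3 R) (X3 i j + X3 j k - T3 R) = \pi_(P3 R) (- X3 i k).
  by rewrite !pi_P3D !pi_P3N TE opprD addrA subrr add0r.
have BAE : \pi_(P3 R) (X3 j k + X3 i j - T3 R) = \pi_(P3 R) (- X3 i k).
  by rewrite -ABE [X3 j k + _]addrC.
have ikN : \pi_(P3 R) (- X3 k i) = \pi_(P3 R) (- X3 i k) by rewrite !pi_P3N (X3C R ik).
rewrite lgki lgkj lgji lgjk lgij.
have Wl l : W_left i j k z l = \pi_(P3 R) (nc_subst (G0 u) (X3 i j) (- X3 j k) *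
    nc_exp (l *: T3 R)) by [].
have Wr l : slit_plane u -> W_right i j k z l =
    \pi_(P3 R) (nc_subst (G0 (1 - u)) (X3 j k) (- X3 i j) * nc_exp (l *: T3 R)).
  by move=> us; apply: W_rightE => //; exact: slit_subr.
split.
- move=> us; apply: phi_connection => //.
  apply/comP_sym/comP_exp; first exact: nilfreeZ.
  by apply/comP_Z/comP_sym/comP_subst => //; exact: comP_N.
- move=> s us; apply: (mul_eq_trans _ (Wl lki)
    (landen_connection A0 B0 T0 TA TB lki us)).
  apply: W_leftE => //.
  + by rewrite uij ukj; field; rewrite d0 u1 u1'.
  + by rewrite -(X3C R ij).
(* Landen's formula at 1 - u with X_ij and X_jk exchanged; u -> 1 - u swaps the half planes, whence
   the opposite sign. *)
- move=> s /half_subr; rewrite negbK => us.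
  have vs : slit_plane u by rewrite -[u](subKr 1); exact: slit_subr (half_slit us).
  apply: (mul_eq_trans _ (Wr lki vs) (landen_connection B0 A0 T0 TB TA lki us)).
  apply: W_rightE => //.
  + by have [] := half_opp_div us.
  + by rewrite uji; field; rewrite u1u d0 u0.
  + by rewrite -(X3C R jk).
(* The argument after reflection is u / (u - 1) as in the second formula, but the logarithm is that
   of z_jk instead of z_kj; this changes X_ij into T - X_ij. *)
- move=> s us.
  have DE : \pi_(P3 R) (X3 i k + X3 j k) = \pi_(P3 R) (T3 R - X3 i j).
    by rewrite [RHS]pi_P3D pi_P3N TE [LHS]pi_P3D -[X in X - _]addrA [X in X - _]addrC addrK addrC.
  have := landen_connection_opp A0 B0 T0 TA TB lki _ DE us.
  rewrite negbK => H; apply: (mul_eq_trans _ (Wl lki) (H _)).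
    apply: W_rightE => //.
    + by have [] := half_opp_div us.
    + by rewrite uik ujk; field; rewrite d0 u1 u1'.
    + by rewrite ikN.
  by apply: nilfreeD; exact: X3_nilfree.
(* The preceding argument at 1 - u, with X_ij and X_jk exchanged. *)
- move=> s us; have us' := half_subr us.
  have DE : \pi_(P3 R) (X3 i j + X3 i k) = \pi_(P3 R) (T3 R - X3 j k).
    by rewrite [RHS]pi_P3D pi_P3N TE [LHS]pi_P3D addrAC addrK.
  have := landen_connection_opp B0 A0 T0 TB TA lki _ DE us'.
  rewrite negbK => H; apply: (mul_eq_trans _ (Wr lki (half_slit us)) (H _)).
    apply: W_leftE => //.
    + by rewrite ukj uij; field; rewrite u1u d0 u0.
    + by rewrite ikN.
  by apply: nilfreeD; exact: X3_nilfree.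
Qed.
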